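(* Let $\lambda>0$. Place at time zero, independently at each site of $\mathbb{Z}$, a Poisson($\lambda$) number of particles, let the particles move as independent discrete-time simple symmetric random walks on $\mathbb{Z}$, and let $\eta_n(x)$ be the number of particles at site $x$ at time $n\in\mathbb{N}_0$. If $R$ is large enough (depending on $\lambda$), then $$\mathbb{P}\Big[\text{there exists } g:\mathbb{N}_0\to\mathbb{Z} \text{ with } g(0)=0,\ |g(n+1)-g(n)|\le R \text{ and } \eta_n(g(n))=0 \text{ for all } n\in\mathbb{N}_0\Big]>0 .$$
   Context: $\mathbb{N}_0=\{0,1,2,\dots\}$. The product Poisson($\lambda$) measure is stationary for the particle counts $(\eta_n(x))_{x\in\mathbb{Z}}$. *)

(* Defs.v *)
From HB Require Import structures.
From mathcomp Require Import all_boot all_order all_algebra finmap.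
From mathcomp Require Import all_classical all_reals all_analysis.

Set Implicit Arguments.
Unset Strict Implicit.
Unset Printing Implicit Defensive.

Import Order.TTheory GRing.Theory Num.Theory.

Local Open Scope classical_set_scope.
Local Open Scope ring_scope.

HB.instance Definition _ := isPointed.Build int 0.
HB.instance Definition _ := @isMeasurable.Build default_measure_display
  int discrete_measurable discrete_measurable0
  discrete_measurableC discrete_measurableU.

Definition mutually_independent (d : measure_display) (T : measurableType d)
    (K : realType) (P : probability T K) (I : choiceType)
    (F : I -> set_system T) : Prop :=
  forall (J : {fset I}) (E : I -> set T),
    (forall i, i \in J -> F i (E i)) ->
    P (\bigcap_(i in [set` J]) E i) = (\prod_(i <- J) P (E i))%E.

Section PoissonWalks.
Context (d : measure_display) (T : measurableType d) (K : realType)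
  (P : probability T K).

(* Each site y carries an infinite supply of potential particles
   (y, 0), (y, 1), ...; those actually present are the (y, i) with
   i < N y, and X y i k is the step of (y, i) from time k to time k + 1. *)
Variables (N : int -> {RV P >-> nat}) (X : int -> nat -> nat -> {RV P >-> int}).

(* Each source of randomness (an initial count or a single step)
   is represented by the sigma-algebra it generates. *)
Definition source_events (s : int + int * nat * nat) : set_system T :=
  match s with
  | inl y => preimage_set_system setT (N y) measurable
  | inr (y, i, k) => preimage_set_system setT (X y i k) measurable
  end.

Record poisson_walks (lambda : K) : Prop := {
  initial_law : forall (y : int) (k : nat),
    P [set w | N y w = k] = (poisson_pmf lambda k)%:E;
  step_law : forall y i k,
    P [set w | X y i k w = 1] = (2^-1)%:E /\
    P [set w | X y i k w = -1] = (2^-1)%:E;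
  sources_independent : mutually_independent P source_events
}.

Definition position (y : int) (i n : nat) (w : T) : int :=
  y + \sum_(k < n) X y i k w.

(* The count is extended-real valued: since steps are only almost surely
   +1 or -1, it may be infinite on a null set. *)
Definition occupation (n : nat) (x : int) (w : T) : \bar K :=
  counting [set p : int * nat |
    (p.2 < N p.1 w)%N /\ position p.1 p.2 n w = x].

End PoissonWalks.

(* Main.v *)
Require Import Defs.
From mathcomp Require Import all_boot all_order all_algebra finmap.
From mathcomp Require Import zify ring lra.
From mathcomp Require Import all_classical all_reals all_analysis.

(** Only the initial configuration is taken from the Poisson law; afterwards
    everything is quenched: finitely many walks start from a configuration
    that is sparse on mesoscopic intervals, and the coins are uniform on a
    finite cube.

    At scale k one looks for a particle-free path that stays within X_k of a
    slowly moving centre during [T_k, 3 T_k].  At scale 0 jumps are longer than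
    the tube is wide, so it suffices that the tube always contains a hole; given
    the positions one time unit earlier, holes at sites four apart appear
    independently.  A path at scale k+1 is a chain of paths of scale k in one
    of two columns, each link being joined to the next by two slanted paths
    that cross the column: two paths that cross can be exchanged, because the
    jump from one to the other is dominated by a jump of one of them.  So a failure at
    scale k+1 produces a failure at scale k in each of two columns.  Walks
    have speed at most one, hence after resampling the future of the particles
    near the later failure the two become independent, and the failure
    probability is essentially squared.  The later failure is unlikely
    given its past because diffusion makes the configuration sparse again at
    the smaller mesoscopic scale.

    Gluing the chains of all scales gives, for every length, a path of that
    length with probability bounded below; Koenig's lemma then yields an infinite
    path. *)

Set Implicit Arguments.
Unset Strict Implicit.
Unset Printing Implicit Defensive.

Import Order.TTheory GRing.Theory Num.Theory.

Local Open Scope classical_set_scope.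
Local Open Scope ring_scope.

(** * Crossing paths *)

(** The failure bound at a scale holds for every configuration that is sparse at that scale, never
    for the Poisson law given the past. Hence it can be used afresh at any time at which the
    configuration is sparse again, with no control of a conditional law. A path is only asked for
    from time [T_k] on: the time before is what diffusion needs to restore sparsity at smaller
    scales. The scales answer three demands. Columns must be farther apart than particles travel in
    time [T_k], so [X_{k+1}] is a large multiple of [T_k]; the slopes [4 X_k / T_k] must be
    summable, so [T_k / X_k = 2^k]; hence [L = T_{k+1} / T_k = 2^(17+k)]. A failure at scale [k+1]
    selects one of about [L^2] pairs of lanes, and a multiple of [L^2 q_k^2] is at most [q_{k+1}]
    when [q_k = 2^-(e+2k)] with [e] large. The jump range is settled at scale 0, since larger scales
    only exchange crossing paths. *)

Section Paths.
Variable Rn : int.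
Implicit Types (O : nat -> int -> Prop) (a b : nat) (x y : int).

Definition path_on O a b (g : nat -> int) : Prop :=
  (forall n, (a <= n < b)%N -> `|g n.+1 - g n| <= Rn) /\
  (forall n, (a <= n <= b)%N -> O n (g n)).

Definition opath O a b x y : Prop :=
  exists g : nat -> int, [/\ path_on O a b g, g a = x & g b = y].

Lemma path_on_sub O (O' : nat -> int -> Prop) a b a' b' g :
  (a <= a')%N -> (b' <= b)%N ->
  (forall n x, (a' <= n <= b')%N -> O n x -> O' n x) ->
  path_on O a b g -> path_on O' a' b' g.
Proof.
move=> aa bb OO [h1 h2]; split=> n hn; first by apply: h1; lia.
by apply: OO => //; apply: h2; lia.
Qed.

Lemma path_on_cat O a b c g h :
  path_on O a b g -> path_on O b c h -> g b = h b -> (a <= b <= c)%N ->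
  path_on O a c (fun n => if (n <= b)%N then g n else h n).
Proof.
move=> [g1 g2] [h1 h2] gh abc; split=> n hn.
  case: ifP => nb; case: ifP => nb'; try lia.
  - by apply: g1; lia.
  - by have -> : n = b by [lia]; rewrite gh; apply: h1; lia.
  - by apply: h1; lia.
by case: ifP => nb; [apply: g2|apply: h2]; lia.
Qed.

(* Two open paths that cross can be exchanged: at the crossing time the jump
   from one to the other is dominated by a jump of one of them. *)
Lemma opath_switch O a b x y x' y' : (a <= b)%N ->
  opath O a b x y -> opath O a b x' y' -> x <= x' -> y' <= y ->
  opath O a b x y'.
Proof.
move=> ab [p [[p1 p2] px py]] [r [[r1 r2] rx ry]] xx yy.
pose P n := (a <= n)%N && (r n <= p n).
have exP : exists n, P n by exists b; rewrite /P ab ry py.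
case: (ex_minnP exP) => m /andP[am rp] minm.
have mb : (m <= b)%N by apply: minm; rewrite /P ab ry py.
have [ma|ma] := eqVneq m a.
  exists r; split=> //; rewrite rx; apply/eqP; rewrite eq_le xx andbT.
  by rewrite -rx -px -ma.
exists (fun n => if (n < m)%N then p n else r n); split.
- split=> n hn.
    case: ifP => h1; case: ifP => h2; try lia.
    + by apply: p1; lia.
    + have h3 : (p n < r n)%R.
        rewrite ltNge; apply/negP => h; suff: (m <= n)%N by lia.
        by apply: minm; rewrite /P h andbT; lia.
      have h4 : n.+1 = m by lia.
      have := p1 n hn; have := r1 n hn; rewrite h4; lia.
    + by apply: r1; lia.
  by case: ifP => h; [apply: p2|apply: r2]; lia.
- by rewrite ifT //; lia.
- by rewrite ifF //; lia.
Qed.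

Lemma opath_opp O a b x y :
  opath O a b x y -> opath (fun n z => O n (- z)) a b (- x) (- y).
Proof.
move=> [g [[g1 g2] gx gy]]; exists (fun n => - g n); split; rewrite ?gx ?gy //.
split=> n hn; last by rewrite opprK; apply: g2.
by have := g1 n hn; lia.
Qed.

(** A reflection of space turns this into [opath_switch]. *)
Lemma opath_switch_le O a b x y x' y' : (a <= b)%N ->
  opath O a b x y -> opath O a b x' y' -> x' <= x -> y <= y' ->
  opath O a b x y'.
Proof.
move=> ab /opath_opp p /opath_opp r xx yy.
have h : opath (fun n z => O n (- z)) a b (- x) (- y').
  by apply: (opath_switch ab p r); lia.
have [g [[g1 g2] gx gy]] := opath_opp h.
exists g; split; rewrite ?gx ?gy ?opprK //; split=> // n hn.
by have := g2 n hn; rewrite opprK.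
Qed.

(** When the paths from [x] and from [x'] cross, they are exchanged directly. Otherwise one of them
    is on the left at both ends; then the path from [u] to [v], or in the mirrored case the one from
    [u'] to [v'], crosses both and serves as a bridge. *)
Lemma opath_glue O a b x y x' y' u v u' v' : (a <= b)%N ->
  opath O a b x y -> opath O a b x' y' ->
  opath O a b u v -> u <= x -> u <= x' -> y <= v -> y' <= v ->
  opath O a b u' v' -> x <= u' -> x' <= u' -> v' <= y -> v' <= y' ->
  opath O a b x y'.
Proof.
move=> ab p q r ux ux' yv yv' l xu xu' vy vy'.
have [xx|xx] := leP x x'; have [yy|yy] := leP y' y.
- exact: opath_switch p q xx yy.
- exact: (opath_switch ab (opath_switch_le ab p r ux yv) q xx yv').
- exact: (opath_switch_le ab (opath_switch ab p l xu vy) q (ltW xx) vy').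
- exact: opath_switch_le p q (ltW xx) (ltW yy).
Qed.
End Paths.

(** * Tubes, slanted lanes and the chaining of crossings *)

Section Tubes.
Variables (K : realType) (Rn : int) (op : nat -> int -> Prop).
Implicit Types (c : nat -> K) (X : K).

Definition tube c X n (x : int) := op n x /\ `|x%:~R - c n| <= X.

Definition crossing c X t0 t1 := exists g, path_on Rn (tube c X) t0 t1 g.

Section Chain.
Variables (c : nat -> K) (X u : K) (T : nat).
Hypotheses (X0 : 0 <= X) (T0 : (0 < T)%N) (uT : u * T%:R = 4 * X).

(** Since [u * T = 4 * X], for [sg = 1] or [-1] this centre moves from [2 X] on one side of [c] to
    [2 X] on the other during [[(s+2)T, (s+3)T]], whose midpoint is [(s + 5/2) T]. At both ends its
    tube lies beside the tube of [c], so a path in it must pass every path that stays within [X] of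
    [c]. *)
Definition slanted (sg : K) (s n : nat) : K :=
  c n + sg * (u * (n%:R - (s%:R + 5 / 2) * T%:R)).

(** The width [3 X] makes room for the slanted tubes, which reach [2 X + X]. In the last row the
    path must be back within [X], so that the next slanted paths have their ends on definite sides
    of it. *)
Definition chain_inv a x s := exists g,
  [/\ path_on Rn (tube c (3 * X)) a ((s + 3) * T)%N g, g a = x &
      forall n, ((s + 2) * T <= n <= (s + 3) * T)%N -> `|(g n)%:~R - c n| <= X].

Lemma slanted_tube sg s n x : (sg = 1 \/ sg = -1) ->
  ((s + 2) * T <= n <= (s + 3) * T)%N ->
  tube (slanted sg s) X n x -> tube c (3 * X) n x.
Proof.
move=> hsg /andP[h1 h2] [h3 h4]; split=> //.
have u0 : 0 <= u.
  have T0' : 0 < T%:R :> K by rewrite ltr0n.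
  by rewrite -(pmulr_lge0 _ T0') uT mulr_ge0.
have e1 : (s%:R + 2) * T%:R <= n%:R :> K.
  by rewrite -(natrD _ s 2) -natrM ler_nat.
have e2 : n%:R <= (s%:R + 3) * T%:R :> K.
  by rewrite -(natrD _ s 3) -natrM ler_nat.
have e3 : `|u * (n%:R - (s%:R + 5 / 2) * T%:R)| <= 2 * X.
  have -> : 2 * X = u * (T%:R / 2) by rewrite mulrA uT; lra.
  by rewrite ler_norml -mulrN !ler_wpM2l //; lra.
move: h4 e3; rewrite /slanted; set w := u * _.
by case: hsg => ->; rewrite !ler_norml; lra.
Qed.

Lemma slanted_ends s :
  slanted 1 s ((s + 2) * T) = c ((s + 2) * T) - 2 * X /\
  slanted 1 s ((s + 3) * T) = c ((s + 3) * T) + 2 * X.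
Proof.
have e : 2 * X = u * T%:R / 2 by rewrite uT; lra.
by rewrite /slanted !natrM !natrD e; split; field.
Qed.

Lemma slantedN_ends s :
  slanted (-1) s ((s + 2) * T) = c ((s + 2) * T) + 2 * X /\
  slanted (-1) s ((s + 3) * T) = c ((s + 3) * T) - 2 * X.
Proof.
have e : 2 * X = u * T%:R / 2 by rewrite uT; lra.
by rewrite /slanted !natrM !natrD e; split; field.
Qed.

Lemma tube_below (z w : int) (m : K) :
  `|z%:~R - (m - 2 * X)| <= X -> `|w%:~R - m| <= X -> z <= w.
Proof. by rewrite -(ler_int K) !ler_norml => /andP[_ h1] /andP[h2 _]; lra. Qed.

Lemma tube_above (z w : int) (m : K) :
  `|z%:~R - (m + 2 * X)| <= X -> `|w%:~R - m| <= X -> w <= z.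
Proof. by rewrite -(ler_int K) !ler_norml => /andP[h1 _] /andP[_ h2]; lra. Qed.

Lemma chain_times s : [/\ ((s + 2) * T < (s + 3) * T)%N,
  ((s + 3) * T <= (s + 4) * T)%N & ((s + 1) * T <= (s + 2) * T)%N].
Proof. by rewrite ltn_mul2r !leq_mul2r T0; split; lia. Qed.

Lemma opath_tube c' t0 t1 a b (g : nat -> int) :
  (t0 <= a)%N -> (b <= t1)%N ->
  (forall n z, (a <= n <= b)%N -> tube c' X n z -> tube c (3 * X) n z) ->
  path_on Rn (tube c' X) t0 t1 g ->
  opath Rn (tube c (3 * X)) a b (g a) (g b).
Proof. by move=> ta bt h pg; exists g; split=> //; apply: path_on_sub pg. Qed.

Lemma tube_mul3 n z : tube c X n z -> tube c (3 * X) n z.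
Proof. by move=> [h1 h2]; split=> //; apply: le_trans h2 _; rewrite ler_peMl // ler1n. Qed.

(** On [[(s+2)T, (s+3)T]] the old path and the new link coexist in the narrow tube. The ends of the
    two slanted paths lie on opposite sides of both, and [opath_glue] leads from one to the
    other. *)
Lemma chain_step a x s : (a <= (s + 2) * T)%N -> chain_inv a x s ->
  crossing (slanted 1 s) X ((s + 1) * T) ((s + 3) * T) ->
  crossing (slanted (-1) s) X ((s + 1) * T) ((s + 3) * T) ->
  crossing c X ((s + 2) * T) ((s + 4) * T) ->
  chain_inv a x s.+1.
Proof.
have [r2 r3] := slanted_ends s; have [l2 l3] := slantedN_ends s.
have [t23 t34 t12] := chain_times s.
have e3 : ((s.+1 + 2) * T = (s + 3) * T)%N by congr muln; lia.
have e4 : ((s.+1 + 3) * T = (s + 4) * T)%N by congr muln; lia.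
have tub1 := slanted_tube (sg := 1) (s := s) (or_introl erefl).
have tub2 := slanted_tube (sg := -1) (s := s) (or_intror erefl).
move=> has [g [pg gx gX]] [r pr] [l pl] [q pq].
rewrite /chain_inv e3 e4.
move: t12 t23 t34 has pg gX pr pl pq r2 r3 l2 l3 tub1 tub2 {e3 e4}.
move: ((s + 1) * T)%N ((s + 2) * T)%N ((s + 3) * T)%N ((s + 4) * T)%N.
move=> t1 t2 t3 t4 t12 t23 t34 has pg gX pr pl pq r2 r3 l2 l3 tub1 tub2.
have t23' := ltnW t23.
have m2 : (t2 <= t2 <= t3)%N by rewrite leqnn.
have m3 : (t2 <= t3 <= t3)%N by rewrite leqnn andbT.
have wide n : (t2 <= n <= t3)%N -> (t1 <= n <= t3)%N.
  by move=> /andP[n1 ->]; rewrite (leq_trans t12).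
have wide' n : (t2 <= n <= t3)%N -> (t2 <= n <= t4)%N.
  by move=> /andP[-> n1]; rewrite (leq_trans n1).
have [h [ph h2 h3]] : opath Rn (tube c (3 * X)) t2 t3 (g t2) (q t3).
  have [_ qb2] := pq.2 _ (wide' _ m2); have [_ qb3] := pq.2 _ (wide' _ m3).
  have [_ rb2] := pr.2 _ (wide _ m2); have [_ rb3] := pr.2 _ (wide _ m3).
  have [_ lb2] := pl.2 _ (wide _ m2); have [_ lb3] := pl.2 _ (wide _ m3).
  move: rb2 rb3 lb2 lb3; rewrite r2 r3 l2 l3 => rb2 rb3 lb2 lb3.
  have gb2 := gX _ m2; have gb3 := gX _ m3.
  have pg' : opath Rn (tube c (3 * X)) t2 t3 (g t2) (g t3).
    by exists g; split=> //; apply: path_on_sub pg.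
  have pq' := opath_tube (leqnn _) t34 (fun n z _ => @tube_mul3 n z) pq.
  have pr' := opath_tube t12 (leqnn _) tub1 pr.
  have pl' := opath_tube t12 (leqnn _) tub2 pl.
  apply: (opath_glue t23' pg' pq' pr' _ _ _ _ pl').
  - exact: tube_below rb2 gb2.
  - exact: tube_below rb2 qb2.
  - exact: tube_above rb3 gb3.
  - exact: tube_above rb3 qb3.
  - exact: tube_above lb2 gb2.
  - exact: tube_above lb2 qb2.
  - exact: tube_below lb3 gb3.
  - exact: tube_below lb3 qb3.
have pg1 : path_on Rn (tube c (3 * X)) a t2 g by apply: path_on_sub pg.
have pq1 : path_on Rn (tube c (3 * X)) t3 t4 q.
  by apply: path_on_sub pq => // n z _; apply: tube_mul3.
have p1 := path_on_cat ph pq1 h3.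
have p2 := path_on_cat pg1 (p1 _).
exists (fun n => if (n <= t2)%N then g n else if (n <= t3)%N then h n else q n).
split.
- by apply: p2; rewrite ?t23' ?h2 // has (leq_trans t23').
- by rewrite ifT.
- move=> n /andP[n1 n2]; rewrite ifF; last first.
    by apply/negbTE; rewrite -ltnNge (leq_trans t23).
  suff -> : (if (n <= t3)%N then h n else q n) = q n.
    by apply: (proj2 (pq.2 n _)); rewrite n2 (leq_trans t23').
  by case: ifP => // n3; have -> : n = t3 by apply/eqP; rewrite eqn_leq n3.
Qed.

Lemma chain_iter a x s d : (a <= (s + 2) * T)%N -> chain_inv a x s ->
  (forall i, (s <= i < s + d)%N ->
     [/\ crossing (slanted 1 i) X ((i + 1) * T) ((i + 3) * T),
         crossing (slanted (-1) i) X ((i + 1) * T) ((i + 3) * T) &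
         crossing c X ((i + 2) * T) ((i + 4) * T)]) ->
  chain_inv a x (s + d).
Proof.
move=> has h0; elim: d => [|d IH] H; first by rewrite addn0.
rewrite addnS; have [|h1 h2 h3] := H (s + d)%N; first by lia.
apply: chain_step => //; first by apply: leq_trans has _; rewrite leq_mul2r; lia.
by apply: IH => i hi; apply: H; lia.
Qed.

Lemma chain_start s :
  crossing c X ((s + 1) * T) ((s + 3) * T) ->
  exists x, chain_inv ((s + 1) * T) x s.
Proof.
have [t23 t34 t12] := chain_times s.
move=> [g pg]; exists (g ((s + 1) * T)%N), g; split=> //.
- by apply: path_on_sub pg => // n z _; apply: tube_mul3.
- by move=> n /andP[n1 n2]; apply: (proj2 (pg.2 n _)); rewrite n2 (leq_trans t12).
Qed.
End Chain.
End Tubes.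

(** * The simple random walk *)

Section Walk.
Variable K : realType.

(** Expectation of [f] at the position of the walk after [t] steps, as a recursion free of any
    sample space; [mean_walk] links it to the coins. *)
Fixpoint walk_mean (t : nat) (f : int -> K) : K :=
  if t is t'.+1 then
    (walk_mean t' (fun x => f (x + 1)) + walk_mean t' (fun x => f (x - 1))) / 2
  else f 0.

Lemma walk_mean_le t f g :
  (forall x : int, (`|x| <= t%:Z) -> f x <= g x) -> walk_mean t f <= walk_mean t g.
Proof.
elim: t f g => [|t IH] f g fg /=; first by apply: fg.
rewrite ler_pM2r ?invr_gt0 // lerD //; apply: IH => x hx; apply: fg; lia.
Qed.

Lemma eq_walk_mean t f g :
  (forall x : int, (`|x| <= t%:Z) -> f x = g x) -> walk_mean t f = walk_mean t g.
Proof.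
by move=> fg; apply/eqP; rewrite eq_le; apply/andP; split;
  apply: walk_mean_le => x hx; rewrite fg.
Qed.

Lemma walk_meanD t f g :
  walk_mean t (fun x => f x + g x) = walk_mean t f + walk_mean t g.
Proof. by elim: t f g => [//|t IH] f g /=; rewrite !IH; field. Qed.

Lemma walk_meanZ t k f : walk_mean t (fun x => k * f x) = k * walk_mean t f.
Proof. by elim: t f => [//|t IH] f /=; rewrite !IH; field. Qed.

Lemma walk_mean_cst t k : walk_mean t (fun=> k) = k.
Proof. by elim: t => [//|t IH] /=; rewrite IH; field. Qed.

Lemma walk_mean_sum t (J : finType) (F : J -> int -> K) :
  walk_mean t (fun x => \sum_j F j x) = \sum_j walk_mean t (F j).
Proof.
elim: t F => [//|t IH] F /=.
by rewrite !IH -big_split /= mulr_suml.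
Qed.

Lemma walk_mean_sqr t : walk_mean t (fun x => x%:~R ^+ 2) = t%:R.
Proof.
have odd s : walk_mean s (fun x => x%:~R) = 0.
  elim: s => [//|s IH] /=.
  rewrite (_ : (fun x : int => (x + 1)%:~R) = (fun x => x%:~R + 1 :> K)); last first.
    by apply/funext => x; rewrite intrD.
  rewrite (_ : (fun x : int => (x - 1)%:~R) = (fun x => x%:~R + (-1) :> K)); last first.
    by apply/funext => x; rewrite intrD.
  by rewrite !walk_meanD IH !walk_mean_cst; field.
elim: t => [|t IH] /=; first by rewrite expr0n.
rewrite (_ : (fun x : int => (x + 1)%:~R ^+ 2) =
  (fun x => x%:~R ^+ 2 + (2 * x%:~R + 1) :> K)); last first.
  by apply/funext => x; rewrite intrD; ring.
rewrite (_ : (fun x : int => (x - 1)%:~R ^+ 2) =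
  (fun x => x%:~R ^+ 2 + ((-2) * x%:~R + 1) :> K)); last first.
  by apply/funext => x; rewrite intrD; ring.
by rewrite !(walk_meanD, walk_meanZ) IH !walk_mean_cst odd -natr1; field.
Qed.

(* By exchangeability of the steps, (t + 1) E[xi_1; S_{t+1} = x] = x P(S_{t+1} = x). *)
Lemma walk_mean_diff t f :
  t.+1%:R * (walk_mean t (fun x => f (x + 1)) - walk_mean t (fun x => f (x - 1))) =
  2 * walk_mean t.+1 (fun x => x%:~R * f x).
Proof.
elim: t f => [|t IH] f; first by rewrite /= !add0r; field.
have shift (g : int -> K) (e : int) :
    walk_mean t.+1 (fun x => (x + e)%:~R * g x) =
    walk_mean t.+1 (fun x => x%:~R * g x) + e%:~R * walk_mean t.+1 g.
  rewrite -walk_meanZ -walk_meanD; congr walk_mean; apply/funext => x.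
  by rewrite intrD mulrDl.
rewrite -natr1.
have -> : walk_mean t.+2 (fun x => x%:~R * f x) =
  (walk_mean t.+1 (fun x => (x + 1)%:~R * f (x + 1)) +
   walk_mean t.+1 (fun x => (x - 1)%:~R * f (x - 1))) / 2 by [].
rewrite (shift (fun x => f (x + 1)) 1) (shift (fun x => f (x - 1)) (-1)).
have := IH (fun x => f (x + 1)); have := IH (fun x => f (x - 1)).
have e1 : (fun x : int => f (x - 1 + 1)) = f.
  by apply/funext => x; rewrite subrK.
have e2 : (fun x : int => f (x + 1 - 1)) = f.
  by apply/funext => x; rewrite addrK.
move: (walk_mean t.+1 (fun x => x%:~R * f (x + 1)))
      (walk_mean t.+1 (fun x => x%:~R * f (x - 1))) => A B.
rewrite /= e1 e2.
move: (walk_mean t f) (walk_mean t (fun x => f (x + 1 + 1)))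
  (walk_mean t (fun x => f (x - 1 - 1))) (t.+1%:R) => p q r k h1 h2.
have -> : A = k * (q - p) / 2 by rewrite h2; field.
have -> : B = k * (p - r) / 2 by rewrite h1; field.
by field.
Qed.

(** The inequality [|y| <= (y^2 / s + s) / 2] and the second moment; the free [s] stands in for the
    square root of [t]. *)
Lemma walk_mean_abs t (s : K) : 0 < s ->
  walk_mean t (fun x => `|x%:~R|) <= (t%:R / s + s) / 2.
Proof.
move=> s0; apply: (@le_trans _ _
    (walk_mean t (fun x => (2 * s)^-1 * x%:~R ^+ 2 + s / 2))).
  apply: walk_mean_le => x _; rewrite -(real_normK (num_real _)).
  rewrite -subr_ge0; set y := `|_|.
  have -> : (2 * s)^-1 * y ^+ 2 + s / 2 - y = (2 * s)^-1 * (y - s) ^+ 2.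
    by field; rewrite gt_eqF.
  by rewrite mulr_ge0 ?sqr_ge0 // invr_ge0 mulr_ge0 // ltW.
rewrite walk_meanD (walk_meanZ t (2 * s)^-1 (fun x => x%:~R ^+ 2)) walk_mean_cst walk_mean_sqr.
by rewrite le_eqVlt; apply/orP; left; apply/eqP; field; rewrite gt_eqF.
Qed.

(** By [walk_mean_diff], a shift by 2, the smallest that respects parity, lowers the mean by at most
    [2 A E|S_{t+1}| / (t+1)], which is of order [A / sqrt t]. *)
Lemma walk_mean_shift2 t f (A s : K) : 0 < s -> s ^+ 2 <= t.+1%:R ->
  (forall x, 0 <= f x <= A) ->
  walk_mean t f <= walk_mean t (fun x => f (x + 2)) + 2 * A / s.
Proof.
move=> s0 st fA.
have A0 : 0 <= A by have /andP[/le_trans] := fA 0; apply.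
have t0 : 0 < t.+1%:R :> K by rewrite ltr0n.
have e1 : f = (fun x => f (x - 1 + 1)) by apply/funext => x; rewrite subrK.
have e2 : (fun x => f (x + 2)) = (fun x => f (x + 1 + 1)).
  by apply/funext => x; congr f; lia.
have := walk_mean_diff t (fun x => f (x + 1)).
rewrite -e1 -e2; set w := walk_mean _ (fun x => _ * _).
set p := walk_mean t _; set q := walk_mean t f => h.
have hw : - w <= A * ((t.+1%:R / s + s) / 2).
  apply: le_trans (ler_wpM2l A0 (walk_mean_abs t.+1 s0)).
  rewrite -walk_meanZ -mulN1r -walk_meanZ; apply: walk_mean_le => x _.
  have /andP[f0 f1] := fA (x + 1).
  rewrite mulN1r; apply: (le_trans (ler_norm _)); rewrite normrN normrM mulrC.
  by rewrite ler_wpM2r // ger0_norm.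
have : t.+1%:R * (q - p) <= t.+1%:R * (2 * A / s).
  have -> : t.+1%:R * (q - p) = 2 * (- w) by rewrite mulrN -h; ring.
  apply: (@le_trans _ _ (2 * (A * ((t.+1%:R / s + s) / 2)))).
    by rewrite ler_wpM2l.
  rewrite -subr_ge0.
  have -> : t.+1%:R * (2 * A / s) - 2 * (A * ((t.+1%:R / s + s) / 2)) =
     A / s * (t.+1%:R - s ^+ 2) by field; rewrite gt_eqF.
  by rewrite mulr_ge0 ?subr_ge0 // divr_ge0 // ltW.
by rewrite ler_pM2l // lerBlDl.
Qed.

Lemma walk_mean_shift t f (A s : K) j : 0 < s -> s ^+ 2 <= t.+1%:R ->
  (forall x, 0 <= f x <= A) ->
  walk_mean t f <= walk_mean t (fun x => f (x + (2 * j)%:Z)) + j%:R * (2 * A / s).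
Proof.
move=> s0 st; elim: j f => [|j IH] f fA.
  rewrite mul0r addr0; apply: walk_mean_le => x _.
  by rewrite le_eqVlt; apply/orP; left; apply/eqP; congr f; lia.
apply: (le_trans (walk_mean_shift2 s0 st fA)).
apply: (@le_trans _ _ (walk_mean t (fun x => f (x + (2 * j)%:Z + 2)) +
   j%:R * (2 * A / s) + 2 * A / s)).
  by rewrite lerD2r; apply: (IH (fun x => f (x + 2))) => x; apply: fA.
rewrite -addrA -[j.+1%:R]natr1 [X in _ <= _ + X]mulrDl mul1r lerD2r.
by apply: walk_mean_le => x _; rewrite le_eqVlt; apply/orP; left; apply/eqP; congr f; lia.
Qed.

(* Averaging over the translates of a block that tile a long interval. *)
Lemma walk_mean_tile t f (A B s : K) (m h : nat) :
  (0 < m)%N -> 0 < s -> s ^+ 2 <= t.+1%:R ->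
  (forall x, 0 <= f x <= A) ->
  (forall x : int, `|x| <= t%:Z -> \sum_(j < m) f (x + (2 * (h * j))%:Z) <= B) ->
  walk_mean t f <= B / m%:R + (h * m)%:R * (2 * A / s).
Proof.
move=> m0 s0 st fA fB.
have A0 : 0 <= A by have /andP[/le_trans] := fA 0; apply.
have mR : 0 < m%:R :> K by rewrite ltr0n.
rewrite -(ler_pM2l mR) mulrDr mulrCA divff ?gt_eqF // mulr1.
apply: (@le_trans _ _ (\sum_(j < m) (walk_mean t (fun x => f (x + (2 * (h * j))%:Z)) +
   (h * m)%:R * (2 * A / s)))); last first.
  rewrite big_split /= sumr_const card_ord -[_ *+ m]mulr_natl lerD2r -walk_mean_sum.
  by rewrite -[leRHS](walk_mean_cst t); apply: walk_mean_le.
have -> : m%:R * walk_mean t f = \sum_(j < m) walk_mean t f.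
  by rewrite sumr_const card_ord mulr_natl.
apply: ler_sum => j _.
apply: (le_trans (walk_mean_shift (h * j) s0 st fA)).
rewrite lerD2l; apply: ler_wpM2r; last by rewrite ler_nat leq_mul2l ltnW ?orbT.
by rewrite divr_ge0 ?mulr_ge0 // ltW.
Qed.
End Walk.

(** * Uniform coins and resampling *)

Section Mean.
Variable K : realType.

Definition mean (O : finType) (f : O -> K) : K := (\sum_w f w) / #|O|%:R.

Definition prob (O : finType) (E : pred O) : K := mean (fun w => (E w)%:R).

Lemma mean_le (O : finType) (f g : O -> K) :
  (forall w, f w <= g w) -> mean f <= mean g.
Proof. by move=> fg; rewrite ler_wpM2r ?invr_ge0 ?ler0n // ler_sum. Qed.

Lemma meanD (O : finType) (f g : O -> K) :
  mean (fun w => f w + g w) = mean f + mean g.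
Proof. by rewrite /mean big_split mulrDl. Qed.

Lemma meanZ (O : finType) k (f : O -> K) :
  mean (fun w => k * f w) = k * mean f.
Proof. by rewrite /mean -mulr_sumr mulrA. Qed.

Lemma mean_ge0 (O : finType) (f : O -> K) : (forall w, 0 <= f w) -> 0 <= mean f.
Proof. by move=> f0; rewrite divr_ge0 ?ler0n // sumr_ge0. Qed.

Lemma mean_sum (O J : finType) (F : J -> O -> K) :
  mean (fun w => \sum_j F j w) = \sum_j mean (F j).
Proof. by rewrite /mean exchange_big mulr_suml. Qed.

Lemma mean_cst (O : finType) k : (0 < #|O|)%N -> mean (fun _ : O => k) = k.
Proof.
move=> O0; rewrite /mean sumr_const -[_ *+ _]mulr_natr mulfK //.
by rewrite pnatr_eq0 -lt0n.
Qed.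

Lemma prob_le (O : finType) (E F : pred O) :
  (forall w, E w -> F w) -> prob E <= prob F.
Proof.
move=> EF; apply: mean_le => w; rewrite ler_nat.
by case h : (E w) => //; rewrite (EF _ h).
Qed.

Lemma prob_union (O J : finType) (F : J -> pred O) (E : pred O) :
  (forall w, E w -> exists j, F j w) -> prob E <= \sum_j prob (F j).
Proof.
move=> EF; rewrite -mean_sum; apply: mean_le => w.
case h : (E w); last by apply: sumr_ge0 => j _; rewrite ler0n.
have [j Fj] := EF _ h.
by rewrite (bigD1 j) //= Fj lerDl sumr_ge0 // => i _; rewrite ler0n.
Qed.

Lemma prob_or (O : finType) (E F : pred O) :
  prob (fun w => E w || F w) <= prob E + prob F.
Proof.
rewrite -meanD; apply: mean_le => w; rewrite -natrD ler_nat.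
by case: (E w); case: (F w).
Qed.

Lemma probC (O : finType) (E : pred O) : (0 < #|O|)%N ->
  prob (fun w => ~~ E w) = 1 - prob E.
Proof.
move=> O0; apply/esym/eqP; rewrite subr_eq -meanD -{1}(mean_cst (1 : K) O0).
by apply/eqP; congr mean; apply/funext => w; case: (E w); rewrite ?addr0 ?add0r.
Qed.

Lemma mean_prod (I W : finType) (f : I -> W -> K) :
  mean (fun w : {ffun I -> W} => \prod_i f i (w i)) = \prod_i mean (f i).
Proof.
rewrite /mean -bigA_distr_bigA prodf_div; congr (_ / _).
by rewrite card_ffun natrX prodr_const.
Qed.

(** An involution of the pairs preserves their uniform law, so [w] may be replaced by the first
    component of [s (w, w')]. *)
Lemma mean_pair_involution (O : finType) (s : O * O -> O * O) (f : O -> K) :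
  (0 < #|O|)%N -> involutive s ->
  mean f = mean (fun w => mean (fun w' => f (s (w, w')).1)).
Proof.
move=> O0 sK.
have ON : #|O|%:R != 0 :> K by rewrite pnatr_eq0 -lt0n.
rewrite /mean; congr (_ / _).
transitivity ((\sum_w \sum_(w' : O) f w) / #|O|%:R).
  under [X in _ = X / _]eq_bigr do rewrite sumr_const -mulr_natr.
  by rewrite -mulr_suml mulfK.
rewrite -mulr_suml; congr (_ / _).
rewrite (pair_bigA _ (fun w w' => f w)) /= (reindex s) /=; last first.
  by exists s => x _; apply: sK.
by rewrite (pair_bigA _ (fun w w' => f (s (w, w')).1)) /=; apply: eq_bigr => -[].
Qed.
End Mean.

Section Coins.
Variables (n : nat) (I : finType).

Definition coins := {ffun 'I_n -> bool}.

Definition coin (w : coins) (k : nat) : bool :=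
  if insub k is Some k' then w k' else false.

Definition step (b : bool) : int := if b then 1 else -1.

Definition wpos (w : coins) (t : nat) : int := \sum_(k < t) step (coin w k).

Definition pos (x0 : I -> int) (w : {ffun I -> coins}) (t : nat) (i : I) : int :=
  x0 i + wpos (w i) t.

Lemma coinE (w : coins) (k : 'I_n) : coin w k = w k.
Proof. by rewrite /coin insubT //= => h; congr (w _); apply: val_inj. Qed.

Lemma wposS w t : wpos w t.+1 = wpos w t + step (coin w t).
Proof. by rewrite /wpos big_ord_recr. Qed.

Lemma wpos_dist w s t : (s <= t)%N -> `|wpos w t - wpos w s| <= (t - s)%:Z.
Proof.
move=> st; rewrite -(subnKC st); move: (t - s)%N => d; rewrite addKn.
elim: d => [|d IH]; first by rewrite addn0 subrr.
rewrite addnS wposS.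
have : `|step (coin w (s + d))| = 1 by rewrite /step; case: coin.
lia.
Qed.

Lemma pos_dist x0 w s t i : (s <= t)%N -> `|pos x0 w t i - pos x0 w s i| <= (t - s)%:Z.
Proof.
move=> st; rewrite /pos; have := wpos_dist (w i) st; lia.
Qed.

Lemma pos0 x0 w i : pos x0 w 0 i = x0 i.
Proof. by rewrite /pos /wpos big_ord0 addr0. Qed.

(* Exchanges the steps of the particles of B from time r on in w with
   their steps from time 0 on in w'. *)
Definition swap_walks (r : nat) (B : {set I}) (w w' : {ffun I -> coins}) : {ffun I -> coins} :=
  [ffun i => [ffun k : 'I_n =>
    if (i \in B) && (r <= k)%N then coin (w' i) (k - r) else w i k]].

(** The other half of the exchange: it stores the coins removed from [w], which makes the map on
    pairs an involution. Coins of [w'] that would fall beyond the horizon [n] stay in place. *)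
Definition swap_back (r : nat) (B : {set I}) (w w' : {ffun I -> coins}) : {ffun I -> coins} :=
  [ffun i => [ffun k : 'I_n =>
    if (i \in B) && (k + r < n)%N then coin (w i) (k + r) else w' i k]].

Implicit Types (B : {set I}) (w : {ffun I -> coins}).

Lemma swap_walks_out r B w w' i : i \notin B -> swap_walks r B w w' i = w i.
Proof.
by move=> iB; apply/ffunP => k; rewrite !ffunE (negbTE iB).
Qed.

Lemma coin_swap_past r B w w' i k : (k < r)%N -> coin (swap_walks r B w w' i) k = coin (w i) k.
Proof.
move=> kr; rewrite /coin; case: insubP => // k' _ kk.
by rewrite !ffunE kk leqNgt kr andbF.
Qed.

Lemma coin_swap_future r B w w' i k : i \in B -> (r + k < n)%N ->
  coin (swap_walks r B w w' i) (r + k) = coin (w' i) k.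
Proof.
move=> iB kr; rewrite {1}/coin insubT !ffunE iB /= leq_addr.
by rewrite addKn.
Qed.

Lemma wpos_swap_past r B w w' i t : (t <= r)%N ->
  wpos (swap_walks r B w w' i) t = wpos (w i) t.
Proof.
move=> tr; apply: eq_bigr => k _; rewrite coin_swap_past //.
by apply: leq_trans tr.
Qed.

Lemma pos_swap_past x0 r B w w' i t : (t <= r)%N ->
  pos x0 (swap_walks r B w w') t i = pos x0 w t i.
Proof. by move=> tr; rewrite /pos wpos_swap_past. Qed.

Lemma pos_swap_out x0 r B w w' i t : i \notin B ->
  pos x0 (swap_walks r B w w') t i = pos x0 w t i.
Proof. by move=> iB; rewrite /pos swap_walks_out. Qed.

Lemma pos_swap_future x0 r B w w' i t : i \in B -> (r + t <= n)%N ->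
  pos x0 (swap_walks r B w w') (r + t) i = pos (pos x0 w r) w' t i.
Proof.
move=> iB rt; rewrite /pos -(wpos_swap_past B w w' i (leqnn r)) -addrA; congr (_ + _).
elim: t rt => [|t IH] rt; first by rewrite addn0 /wpos big_ord0 addr0.
rewrite addnS !wposS IH; last by lia.
rewrite coin_swap_future //; last by lia.
by rewrite addrA.
Qed.

(** [B] may depend on [w] provided the exchange does not change it, as when it is read off the
    positions at time [r]. The second exchange then uses the same set and undoes the first. *)
Lemma swap_walks_invol r (B : {ffun I -> coins} -> {set I}) :
  (forall w w', B (swap_walks r (B w) w w') = B w) ->
  involutive (fun p : {ffun I -> coins} * {ffun I -> coins} =>
    (swap_walks r (B p.1) p.1 p.2, swap_back r (B p.1) p.1 p.2)).
Proof.
move=> Bs [w w'] /=; rewrite Bs; set A := B w.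
congr pair; apply/ffunP => i; apply/ffunP => k; rewrite !ffunE.
- case: ifP => [/andP[iA rk]|c0]; last by rewrite ?ffunE c0.
  have kn : (k - r < n)%N by have := ltn_ord k; lia.
  by rewrite {1}/coin insubT !ffunE /= iA subnK // ltn_ord /= coinE.
- case: ifP => [/andP[iA rk]|c0]; last by rewrite ?ffunE c0.
  by rewrite {1}/coin insubT ffunE /= iA leq_addl addnK coinE.
Qed.

Lemma card_coins_gt0 : (0 < #|{ffun I -> coins}|)%N.
Proof. by apply/card_gt0P; exists [ffun=> [ffun=> true]]. Qed.

(** Plays the part of a conditional expectation: inside the outer mean [w] is fixed, and the
    particles of [B w] get fresh coins from time [r] on. *)
Lemma mean_swap (K : realType) r (B : {ffun I -> coins} -> {set I})
    (f : {ffun I -> coins} -> K) :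
  (forall w w', B (swap_walks r (B w) w w') = B w) ->
  mean f = mean (fun w => mean (fun w' => f (swap_walks r (B w) w w'))).
Proof.
move=> Bs; exact: (mean_pair_involution f card_coins_gt0 (swap_walks_invol Bs)).
Qed.

Lemma mean_walk (K : realType) t (f : int -> K) : (t <= n)%N ->
  mean (fun w : coins => f (wpos w t)) = walk_mean t f.
Proof.
elim: t f => [|t IH] f tn.
  under eq_fun do rewrite /wpos big_ord0.
  rewrite mean_cst //=; apply/card_gt0P; by exists [ffun=> true].
(* Flipping the coin number [t] preserves the uniform law, so [f] can be averaged over both values
   of the last step. *)
pose fl (w : coins) : coins := [ffun k : 'I_n => if (k : nat) == t then ~~ w k else w k].
have flK : involutive fl.
  move=> w; apply/ffunP => k; rewrite !ffunE; by case: eqP => //; rewrite negbK.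
have fl_out (w : coins) k : k != t -> coin (fl w) k = coin w k.
  move=> kt; rewrite /coin; case: insubP => // k' _ kk.
  by rewrite ffunE kk (negbTE kt).
have fl_in (w : coins) : coin (fl w) t = ~~ coin w t.
  by rewrite /coin insubT /= ffunE /= eqxx.
have wpos_fl (w : coins) : wpos (fl w) t = wpos w t.
  by apply: eq_bigr => k _; rewrite fl_out // neq_ltn ltn_ord.
have : mean (fun w : coins => f (wpos w t.+1)) = mean (fun w : coins => f (wpos (fl w) t.+1)).
  rewrite /mean; congr (_ / _); rewrite [LHS](reindex fl) //=.
  by exists fl => x _; apply: flK.
move=> e; have {e} : mean (fun w : coins => f (wpos w t.+1)) =
   mean (fun w : coins => 2^-1 * (f (wpos w t.+1) + f (wpos (fl w) t.+1))).
  by rewrite meanZ meanD -e; field.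
move=> ->; rewrite /= -!IH ?(ltnW tn) // -meanD mulrC -meanZ.
congr mean; apply/funext => w; congr (_ * _).
rewrite !wposS wpos_fl fl_in.
by case: coin => //=; rewrite addrC.
Qed.
End Coins.

(** * Sparse configurations *)

Section Density.
Variables (K : realType) (I : finType).
Implicit Types (x : I -> int) (y : int) (l : nat).

Definition count_in x y l : nat := (\sum_i (y <= x i < y + l%:Z)%R)%N.

Definition sparse x (z W D : K) l :=
  forall y, `|y%:~R - z| <= W -> (count_in x y l)%:R <= D.

Lemma count_inD x y l l' :
  count_in x y (l + l') = (count_in x y l + count_in x (y + l%:Z) l')%N.
Proof.
rewrite /count_in -big_split; apply: eq_bigr => i _ /=.
have [h1|h1] := leP y (x i); have [h2|h2] := ltP (x i) (y + l%:Z) => /=.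
- by rewrite (_ : x i < y + (l + l')%N%:Z) //; lia.
- by rewrite PoszD addrA.
- by [].
- by lia.
Qed.

Lemma count_in_tile x y l m :
  (\sum_(j < m) count_in x (y + (l * j)%:Z) l)%N = count_in x y (l * m).
Proof.
elim: m => [|m IH].
  rewrite big_ord0 muln0 /count_in big1 // => i _.
  by case: (leP y (x i)) => //= h; rewrite ltNge addr0 h.
by rewrite big_ord_recr /= IH mulnSr count_inD.
Qed.

Lemma count_in_le x y l l' : (l <= l')%N -> (count_in x y l <= count_in x y l')%N.
Proof. by move=> /subnKC <-; rewrite count_inD leq_addr. Qed.

Variable n : nat.
Implicit Types (w : {ffun I -> coins n}).

Lemma card_walk_gt0 : (0 < #|coins n|)%N.
Proof. by apply/card_gt0P; exists [ffun=> true]. Qed.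

Lemma mean_coord (f : coins n -> K) (i : I) : mean (fun w => f (w i)) = mean f.
Proof.
pose g (j : I) (u : coins n) : K := if j == i then f u else 1.
have e w : f (w i) = \prod_j g j (w j).
  by rewrite (bigD1 i) //= /g eqxx big1 ?mulr1 // => j /negbTE ->.
under eq_fun do rewrite e.
rewrite mean_prod (bigD1 i) //= big1 ?mulr1; first by rewrite /g eqxx.
by move=> j ji; rewrite /g (negbTE ji) mean_cst // card_walk_gt0.
Qed.

Lemma mean_count_sum x0 t y l :
  mean (fun w => (count_in (pos x0 w t) y l)%:R : K) =
  \sum_i mean (fun u : coins n => (y <= x0 i + wpos u t < y + l%:Z)%R%:R).
Proof.
under eq_fun do rewrite natr_sum.
rewrite mean_sum; apply: eq_bigr => i _.
exact: (mean_coord (fun u => (y <= x0 i + wpos u t < y + l%:Z)%R%:R)).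
Qed.

Lemma mean_count x0 t y l : (t <= n)%N ->
  mean (fun w => (count_in (pos x0 w t) y l)%:R : K) =
  walk_mean t (fun z => (count_in x0 (y - z) l)%:R).
Proof.
move=> tn; rewrite mean_count_sum.
have -> : (fun z => (count_in x0 (y - z) l)%:R : K) =
    (fun z => \sum_i (y <= x0 i + z < y + l%:Z)%R%:R).
  apply/funext => z; rewrite natr_sum; apply: eq_bigr => i _; congr (_%:R).
  by rewrite lerBlDr addrAC ltrBrDr.
rewrite walk_mean_sum; apply: eq_bigr => i _.
by rewrite -(@mean_walk n K t (fun z => (y <= x0 i + z < y + l%:Z)%R%:R)).
Qed.

(** Counting in a window after a displacement [z] is counting in the window moved by [-z];
    [walk_mean_tile] compares this with [m] adjacent windows that make up one long window. *)
Lemma mean_count_le x0 t y (h m : nat) (D s : K) :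
  (t <= n)%N -> (0 < m)%N -> 0 < s -> s ^+ 2 <= t.+1%:R ->
  (forall y', `|y' - y| <= (t + 2 * h * m)%:Z ->
     (count_in x0 y' (2 * h * m))%:R <= D) ->
  mean (fun w => (count_in (pos x0 w t) y (2 * h))%:R) <=
    D / m%:R + (h * m)%:R * (2 * D / s).
Proof.
move=> tn m0 s0 st HD; rewrite mean_count //.
(* Sparsity is known only near [y]. Cutting [f] off beyond the range of the walk leaves its mean
   unchanged and makes the bound [D] global. *)
pose f (z : int) : K := if `|z| <= (t + 2 * h * m)%:Z then (count_in x0 (y - z) (2 * h))%:R else 0.
rewrite (@eq_walk_mean _ t _ f); last first.
  by move=> z zt; rewrite /f ifT //; lia.
have D0 : 0 <= D.
  by apply: le_trans (HD y _); rewrite ?ler0n // subrr.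
apply: walk_mean_tile => //.
  move=> z; rewrite /f; case: ifP => hz; rewrite ?lexx ?D0 // ler0n /=.
  apply: le_trans (HD (y - z) _); last by lia.
  by rewrite ler_nat count_in_le // leq_pmulr.
move=> z zt.
(* As [j] grows the windows move to the left; listed in reverse order they form one long window. *)
apply: (@le_trans _ _ (\sum_(j < m)
    (count_in x0 (y - z - (2 * h * m.-1)%:Z + (2 * h * rev_ord j)%:Z) (2 * h))%:R)).
  apply: ler_sum => j _; rewrite /f; case: ifP => _; last by rewrite ler0n.
  rewrite ler_nat; apply: eq_leq; congr count_in.
  have e : (2 * h * m.-1 = 2 * h * rev_ord j + 2 * (h * j))%N.
    rewrite [(2 * (h * j))%N]mulnA -mulnDr; congr muln => /=.
    by have := ltn_ord j; lia.
  by rewrite e; lia.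
have -> : \sum_(j < m)
    (count_in x0 (y - z - (2 * h * m.-1)%:Z + (2 * h * rev_ord j)%:Z) (2 * h))%:R =
  \sum_(j < m) (count_in x0 (y - z - (2 * h * m.-1)%:Z + (2 * h * j)%:Z) (2 * h))%:R :> K.
  by rewrite [RHS](reindex_inj rev_ord_inj).
rewrite -natr_sum count_in_tile; apply: HD.
have : (2 * h * m.-1 <= 2 * h * m)%N by rewrite leq_mul2l leq_pred orbT.
lia.
Qed.

(** Chernoff's bound for independent indicators with different means: each satisfies
    [E e^(th b) <= e^((e^th - 1) E b)], so only the total mean enters. *)
Lemma count_tail x0 t y l (mu th A : K) :
  0 <= th <= 2^-1 -> mean (fun w => (count_in (pos x0 w t) y l)%:R) <= mu ->
  prob K (fun w => A < (count_in (pos x0 w t) y l)%:R) <=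
    expR ((th + 2 * th ^+ 2) * mu - th * A).
Proof.
move=> /andP[th0 th1] hmu.
(* From [e^th <= 1 / (1 - th)], which is at most [1 + th + 2 th^2] for [th] in [[0, 1/2]]. *)
have hexp : expR th - 1 <= th + 2 * th ^+ 2.
  have h : 0 < 1 - th by lra.
  have : expR th <= (1 - th)^-1.
    rewrite -[leLHS]invrK -expRN lef_pV2 ?posrE ?expR_gt0 //.
    exact: expR_ge1Dx.
  move=> /le_trans; rewrite lerBlDr; apply.
  rewrite -(ler_pM2r h) mulVf ?gt_eqF //; nra.
have e1 : 0 <= expR th - 1 by rewrite subr_ge0 -expR0 ler_expR.
pose b (i : I) (u : coins n) : bool := y <= x0 i + wpos u t < y + l%:Z.
have step1 : prob K (fun w => A < (count_in (pos x0 w t) y l)%:R) <=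
    expR (- (th * A)) * mean (fun w => \prod_i expR (th * (b i (w i))%:R)).
  rewrite -meanZ; apply: mean_le => w.
  have -> : \prod_i expR (th * (b i (w i))%:R) =
     expR (th * (count_in (pos x0 w t) y l)%:R).
    by rewrite -expR_sum -mulr_sumr natr_sum.
  rewrite -expRD; case: ltP => h; last by rewrite expR_ge0.
  rewrite -[leLHS]expR0 ler_expR addrC subr_ge0.
  by rewrite ler_wpM2l // ltW.
apply: (le_trans step1).
rewrite addrC expRD ler_wpM2l ?expR_ge0 //.
rewrite (mean_prod (fun i u => expR (th * (b i u)%:R))).
apply: (@le_trans _ _ (\prod_(i : I) expR ((expR th - 1) * mean (fun u => (b i u)%:R)))).
  apply: ler_prod => i _; rewrite mean_ge0 /=; last by move=> u; rewrite expR_ge0.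
  apply: le_trans (expR_ge1Dx _).
  rewrite -{2}(mean_cst (1 : K) card_walk_gt0) -meanZ -meanD.
  apply: mean_le => u; case: (b i u); rewrite ?mulr1 ?mulr0 ?expR0 ?addr0 //; lra.
rewrite -expR_sum ler_expR -mulr_sumr -mean_count_sum.
apply: (le_trans (ler_wpM2l e1 hmu)); apply: ler_wpM2r => //.
by apply: le_trans hmu; apply: mean_ge0 => w; rewrite ler0n.
Qed.
End Density.

(** * Holes *)

Section Occupied.
Variables (K : realType) (I : finType) (n : nat).
Implicit Types (w : {ffun I -> coins n}) (B : {set I}).

Definition occupied (x0 : I -> int) w (t : nat) (y : int) : bool := [exists i, pos x0 w t i == y].

Definition adjacent (x0 : I -> int) w (r : nat) (y : int) : {set I} :=
  [set i | (pos x0 w r i == y + 1) || (pos x0 w r i == y - 1)].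

Lemma pos_next (x0 : I -> int) w r i y : pos x0 w r.+1 i = y -> i \in adjacent x0 w r y.
Proof.
rewrite inE /pos wposS /step; case: coin => h.
- by apply/orP; right; apply/eqP; lia.
- by apply/orP; left; apply/eqP; lia.
Qed.

Lemma adjacent_swap (x0 : I -> int) w w' r B y :
  adjacent x0 (swap_walks r B w w') r y = adjacent x0 w r y.
Proof. by apply/setP => i; rewrite !inE pos_swap_past. Qed.

Lemma occupied_swap_out (x0 : I -> int) w w' r B y : (forall i, i \in adjacent x0 w r y -> i \notin B) ->
  occupied x0 (swap_walks r B w w') r.+1 y = occupied x0 w r.+1 y.
Proof.
move=> dis; apply/existsP/existsP => -[i /eqP h].
- have iB : i \notin B.
    by move: (pos_next h); rewrite adjacent_swap; apply: dis.
  by exists i; rewrite -h pos_swap_out.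
- have iB : i \notin B := dis _ (pos_next h).
  by exists i; rewrite pos_swap_out // h.
Qed.

(** Each particle adjacent to [y] steps away from it with probability 1/2, independently of the
    others, and no other particle can arrive. *)
Lemma mean_resample_occupied (x0 : I -> int) w r y : (r < n)%N ->
  mean (fun w' : {ffun I -> coins n} =>
    (occupied x0 (swap_walks r (adjacent x0 w r y) w w') r.+1 y)%:R) <=
  1 - 2^-1 ^+ #|adjacent x0 w r y| :> K.
Proof.
move=> rn; set B := adjacent x0 w r y.
pose g (i : I) (z : int) : K := if i \in B then (pos x0 w r i + z != y)%:R else 1.
have e w' : (occupied x0 (swap_walks r B w w') r.+1 y)%:R =
    1 - \prod_i g i (wpos (w' i) 1%N) :> K.
  apply/eqP; rewrite eq_sym subr_eq; apply/eqP.
  case h : occupied => /=; last first.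
    rewrite add0r big1 // => i _; rewrite /g; case: ifP => // iB.
    have := pos_swap_future x0 w w' iB (r := r) (t := 1%N); rewrite addn1 => /(_ rn) e.
    suff -> : pos x0 w r i + wpos (w' i) 1 != y by [].
    apply: (contraFN _ h) => /eqP h'; apply/existsP; exists i.
    by rewrite e -h'.
  rewrite [X in _ = _ + X](_ : _ = 0) ?addr0 //.
  have /existsP[i /eqP hi] := h.
  have iB : i \in B by move: (pos_next hi); rewrite adjacent_swap.
  apply/eqP/prodf_eq0; exists i => //; rewrite /g iB.
  have := pos_swap_future x0 w w' iB (r := r) (t := 1%N); rewrite addn1 => /(_ rn).
  by rewrite hi /pos => <-; rewrite eqxx.
under eq_fun do rewrite e.
have -> : (fun w' : {ffun I -> coins n} => 1 - \prod_i g i (wpos (w' i) 1%N)) =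
    (fun w' => 1 + (-1) * \prod_i g i (wpos (w' i) 1%N)).
  by apply/funext => w'; rewrite mulN1r.
rewrite meanD meanZ mean_cst ?card_coins_gt0 // mulN1r lerD2l lerN2.
rewrite (mean_prod (fun i u => g i (wpos u 1%N))).
rewrite -prodr_const [leRHS](bigID (mem B)) /= [X in _ <= _ * X]big1 ?mulr1; last first.
  by move=> i iB; rewrite /g (negbTE iB) mean_cst // card_walk_gt0.
apply: ler_prod => i iB; rewrite invr_ge0 ler0n /=.
rewrite mean_walk; last by lia.
rewrite /= /g iB !add0r.
move: iB; rewrite inE => /orP[/eqP ->|/eqP ->].
- by rewrite addrK eqxx (_ : y + 1 + 1 != y) ?mulr0n ?mulr1n //; [lra|lia].
- by rewrite subrK eqxx (_ : y - 1 - 1 != y) ?mulr0n ?mulr1n //; [lra|lia].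
Qed.

(** By counting, at least half of the candidate sites have at most [2 M] adjacent particles. Given
    the positions at time [r], each of these is empty with probability at least [2^-(2M)],
    independently, since sites four apart have disjoint sets of adjacent particles. *)
Lemma prob_all_occupied (x0 : I -> int) r (y0 : int) (J M : nat) : (r < n)%N -> (0 < M)%N ->
  (count_in x0 (y0 - 1 - r%:Z) (4 * J + 2 * r) <= M * J)%N ->
  prob K (fun w => [forall j : 'I_J, occupied x0 w r.+1 (y0 + (4 * j)%:Z)]) <=
    (1 - 2^-1 ^+ (2 * M)) ^+ J./2.
Proof.
move=> rn M0 hM; set q : K := 1 - _.
have h0 : 0 < (2^-1 : K) ^+ (2 * M) by rewrite exprn_gt0 // invr_gt0.
have h1 : (2^-1 : K) ^+ (2 * M) <= 1 by rewrite exprn_ile1 // ?invr_ge0 // invf_le1 // ler1n.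
have q_gt0 : 0 < q.
  rewrite subr_gt0 exprn_ilt1 ?invr_ge0 ?invf_lt1 ?ltr1n //; lia.
have q0 := ltW q_gt0.
have q1 : q <= 1 by rewrite /q; lra.
pose ys (j : nat) : int := y0 + (4 * j)%:Z.
pose light w j := (#|adjacent x0 w r (ys j)| <= 2 * M)%N.
(* Which sites are light is random. The default value [q] at a dark site gives every factor
   conditional mean at most [q], and it is divided out at the end. *)
pose Z j w : K := if light w j then (occupied x0 w r.+1 (ys j))%:R else q.
have adj_dis w j j' i : j != j' -> i \in adjacent x0 w r (ys j) ->
    i \notin adjacent x0 w r (ys j').
  move=> jj hi; apply/negP => hi'; move: hi hi'.
  rewrite !inE /ys => h2 h3; case/orP: h2 => /eqP h2; case/orP: h3 => /eqP h3; lia.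
have Zprod m : mean (fun w => \prod_(j < m) Z j w) <= q ^+ m.
  elim: m => [|m IH].
    by under eq_fun do rewrite big_ord0; rewrite mean_cst // card_coins_gt0.
  pose B w := adjacent x0 w r (ys m).
  rewrite (mean_swap (r := r) (B := B)); last by move=> w w'; rewrite /B adjacent_swap.
  apply: (@le_trans _ _ (mean (fun w => q * \prod_(j < m) Z j w))); last first.
    by rewrite meanZ exprS ler_wpM2l.
  apply: mean_le => w.
  have Zpast j w' : (j < m)%N -> Z j (swap_walks r (B w) w w') = Z j w.
    move=> jm; rewrite /Z /light adjacent_swap occupied_swap_out //.
    by move=> i; apply: adj_dis; lia.
  have P0 : 0 <= \prod_(j < m) Z j w.
    by apply: prodr_ge0 => j _; rewrite /Z; case: ifP.
  have -> : (fun w' => \prod_(j < m.+1) Z j (swap_walks r (B w) w w')) =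
     (fun w' => (\prod_(j < m) Z j w) * Z m (swap_walks r (B w) w w')).
    apply/funext => w'; rewrite big_ord_recr /=; congr (_ * _).
    by apply: eq_bigr => j _; rewrite Zpast.
  rewrite meanZ mulrC ler_wpM2r //.
  have Zm w' : Z m (swap_walks r (B w) w w') = if light w m
      then (occupied x0 (swap_walks r (B w) w w') r.+1 (ys m))%:R else q.
    by rewrite /Z /light adjacent_swap.
  under eq_fun do rewrite Zm.
  case hl : (light w m); last by rewrite mean_cst // card_coins_gt0.
  apply: (le_trans (mean_resample_occupied x0 w (ys m) rn)).
  rewrite lerD2l lerN2; apply: ler_wiXn2l => //.
  by rewrite invf_le1 // ler1n.
have few_dark w : (#|[pred j : 'I_J | ~~ light w j]| <= J./2)%N.
  have tot : (\sum_(j < J) #|adjacent x0 w r (ys j)| <= M * J)%N.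
    apply: leq_trans hM; rewrite /count_in.
    have -> : (\sum_(j < J) #|adjacent x0 w r (ys j)| =
        \sum_(j < J) \sum_i (i \in adjacent x0 w r (ys j)))%N.
      by apply: eq_bigr => j _; rewrite -sum1_card big_mkcond; apply: eq_bigr => i _; case: ifP.
    rewrite exchange_big /=; apply: leq_sum => i _.
    (* A particle is adjacent to at most one candidate site, and it started within [r] of its
       position at time [r], so it is counted in the initial window. *)
    have [j hj|none] := pickP [pred j : 'I_J | i \in adjacent x0 w r (ys j)]; last first.
      by rewrite big1 // => j _; have /= -> := none j.
    rewrite (bigD1 j) //= big1 ?addn0; last first.
      by move=> j' jj; rewrite (negbTE (adj_dis w j j' i _ hj)) // eq_sym.
    move: hj; rewrite /= => hj; rewrite hj.
    suff -> : y0 - 1 - r%:Z <= x0 i < y0 - 1 - r%:Z + (4 * J + 2 * r)%N%:Z by [].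
    have := pos_dist x0 w i (leq0n r); rewrite pos0 subn0.
    have jJ := ltn_ord j.
    by move: hj; rewrite inE /ys => /orP[] /eqP ->; lia.
  have : (#|[pred j : 'I_J | ~~ light w j]| * (2 * M).+1 <= M * J)%N.
    apply: leq_trans tot; rewrite -sum1_card big_distrl /= big_mkcond /=.
    apply: leq_sum => j _; case: ifP => // hj; rewrite mul1n.
    by move: hj; rewrite inE /light -ltnNge.
  set d := #|_| => hd.
  have : (2 * d * M <= J * M)%N by lia.
  rewrite leq_pmul2r //; lia.
have pointwise w : [forall j : 'I_J, occupied x0 w r.+1 (ys j)]%:R * q ^+ J./2 <=
    \prod_(j < J) Z j w.
  case h : [forall _, _]; last first.
    by rewrite mul0r; apply: prodr_ge0 => j _; rewrite /Z; case: ifP.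
  rewrite mul1r (bigID (fun j : 'I_J => light w j)) /= big1 ?mul1r; last first.
    by move=> j lj; rewrite /Z lj (forallP h j).
  rewrite (eq_bigr (fun _ => q)); last by move=> j lj; rewrite /Z (negbTE lj).
  by rewrite prodr_const; apply: ler_wiXn2l => //; apply: few_dark.
have : prob K (fun w => [forall j : 'I_J, occupied x0 w r.+1 (ys j)]) * q ^+ J./2 <= q ^+ J.
  rewrite mulrC -meanZ; apply: le_trans (Zprod J); apply: mean_le => w.
  by rewrite mulrC.
have eJ : q ^+ J = q ^+ (J - J./2) * q ^+ J./2.
  by rewrite -exprD subnK // -{2}(odd_double_half J); lia.
rewrite eJ ler_pM2r ?exprn_gt0 // => /le_trans; apply.
by apply: ler_wiXn2l => //; rewrite -{2}(odd_double_half J); lia.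
Qed.
End Occupied.

(** * Decoupling *)

Section Decoupling.
Variables (K : realType) (Rn : int) (I : finType) (n : nat).
Implicit Types (w : {ffun I -> coins n}) (B : {set I}) (c : nat -> K) (X : K).

Definition cross (x0 : I -> int) w c X t0 t1 : bool :=
  `[< crossing Rn (fun t y => ~~ occupied x0 w t y) c X t0 t1 >].

Lemma crossing_mono (op op' : nat -> int -> Prop) c c' X t0 t1 :
  (forall t y, (t0 <= t <= t1)%N -> tube op c X t y -> tube op' c' X t y) ->
  crossing Rn op c X t0 t1 -> crossing Rn op' c' X t0 t1.
Proof. by move=> h [g pg]; exists g; apply: path_on_sub pg. Qed.

Lemma crossing_shift (op : nat -> int -> Prop) c X r t0 t1 :
  crossing Rn (fun t y => op (r + t)%N y) (fun t => c (r + t)%N) X t0 t1 <->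
  crossing Rn op c X (r + t0) (r + t1).
Proof.
split=> [[g [g1 g2]]|[g [g1 g2]]].
- exists (fun t => g (t - r)%N); split=> t ht.
    by rewrite subSn; [apply: g1; lia|lia].
  have := g2 (t - r)%N; rewrite /tube subnKC; [apply; lia|lia].
- exists (fun t => g (r + t)%N); split=> t ht.
    by rewrite addnS; apply: g1; lia.
  by apply: g2; lia.
Qed.

Definition nearby (x0 : I -> int) w r (z D : K) : {set I} :=
  [set i | `|(pos x0 w r i)%:~R - z| <= D].

Lemma nearby_swap x0 w w' r z D B :
  nearby x0 (swap_walks r B w w') r z D = nearby x0 w r z D.
Proof. by apply/setP => i; rewrite !inE pos_swap_past. Qed.

(* After the swap, the particles that can reach the tube of c move according
   to w', so that this crossing is that of a fresh system. *)
Lemma cross_swap x0 w w' c X T0 T1 r D : (r + T1 <= n)%N ->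
  (forall t (y p : int), (T0 <= t <= T1)%N -> `|y%:~R - c (r + t)%N| <= X ->
     `|p - y| <= t%:Z -> `|p%:~R - c r| <= D) ->
  cross x0 (swap_walks r (nearby x0 w r (c r) D) w w') c X (r + T0) (r + T1) =
  cross (pos x0 w r) w' (fun t => c (r + t)%N) X T0 T1.
Proof.
move=> rn H; set B := nearby _ _ _ _ _.
have eq_occ t y : (T0 <= t <= T1)%N -> `|y%:~R - c (r + t)%N| <= X ->
    occupied x0 (swap_walks r B w w') (r + t) y = occupied (pos x0 w r) w' t y.
  move=> ht hy.
  have inB i (u : {ffun I -> coins n}) : i \notin B -> pos (pos x0 w r) u t i != y.
    rewrite inE => hi; apply: contra hi => /eqP hi.
    apply: (H t y) => //.
    have := pos_dist (pos x0 w r) u i (leq0n t).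
    by rewrite pos0 subn0 hi distrC.
  have same i : i \in B ->
      pos x0 (swap_walks r B w w') (r + t) i = pos (pos x0 w r) w' t i.
    by move=> iB; apply: pos_swap_future => //; lia.
  have out i : i \notin B -> pos x0 (swap_walks r B w w') (r + t) i != y.
    move=> iB; rewrite pos_swap_out //; move: (iB); rewrite inE.
    apply: contra => /eqP hi; apply: (H t y) => //.
    have := pos_dist x0 w i (leq_addr t r); rewrite hi addKn distrC; lia.
  apply/existsP/existsP => -[i /eqP hi]; exists i.
  - have [iB|iB] := boolP (i \in B); first by rewrite -same ?hi.
    by have := out i iB; rewrite hi eqxx.
  - have [iB|iB] := boolP (i \in B); first by rewrite same ?hi.
    by have := inB i w' iB; rewrite hi eqxx.
set op := fun (t : nat) (y : int) =>
  is_true (~~ occupied x0 (swap_walks r B w w') t y).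
have sh := crossing_shift op c X r T0 T1.
apply/asboolP/asboolP => [/(iffRL sh)|h].
- by apply: crossing_mono => t y ht [h1 h2]; split=> //; rewrite -eq_occ.
- apply: (iffLR sh); apply: crossing_mono h => t y ht [h1 h2].
  by split=> //; rewrite /op eq_occ.
Qed.

(** [A] need not belong to the past of [r]: it only has to be insensitive to new coins for the
    particles near [c r]. This allows [A] to be a failure still in progress in the other column. *)
Lemma decouple x0 (A : pred {ffun I -> coins n}) (G : pred (I -> int)) c X T0 T1 r D Q :
  (r + T1 <= n)%N -> 0 <= Q ->
  (forall t (y p : int), (T0 <= t <= T1)%N -> `|y%:~R - c (r + t)%N| <= X ->
     `|p - y| <= t%:Z -> `|p%:~R - c r| <= D) ->
  (forall w w', A (swap_walks r (nearby x0 w r (c r) D) w w') = A w) ->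
  (forall x, G x ->
     prob K (fun w' => ~~ cross x w' (fun t => c (r + t)%N) X T0 T1) <= Q) ->
  prob K (fun w => [&& A w, G (pos x0 w r) & ~~ cross x0 w c X (r + T0) (r + T1)]) <=
    Q * prob K A.
Proof.
move=> rn Q0 H HA HG; rewrite /prob.
rewrite (mean_swap (r := r) (B := fun w => nearby x0 w r (c r) D)); last first.
  by move=> w w'; rewrite nearby_swap.
rewrite -meanZ; apply: mean_le => w.
have Gs w' : G (pos x0 (swap_walks r (nearby x0 w r (c r) D) w w') r) = G (pos x0 w r).
  by congr G; apply/funext => i; rewrite pos_swap_past.
under eq_fun do rewrite HA Gs cross_swap //.
have [Aw|Aw] := boolP (A w); last by rewrite mulr0 mean_cst // card_coins_gt0.
have [Gw|Gw] := boolP (G (pos x0 w r)); first by rewrite mulr1 /=; apply: HG.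
by rewrite mulr1 mean_cst // card_coins_gt0.
Qed.

(** Speed at most one: after time [r] the particles of [B] are too far from the tube to visit it,
    with the old coins or with the new ones. *)
Lemma cross_swap_out x0 w w' B c X t0 t1 r :
  (forall t (y : int), (t0 <= t <= t1)%N -> (r < t)%N -> `|y%:~R - c t| <= X ->
     forall i, i \in B -> t%:Z - r%:Z < `|pos x0 w r i - y|) ->
  cross x0 (swap_walks r B w w') c X t0 t1 = cross x0 w c X t0 t1.
Proof.
move=> H.
have eq_occ t y : (t0 <= t <= t1)%N -> `|y%:~R - c t| <= X ->
    occupied x0 (swap_walks r B w w') t y = occupied x0 w t y.
  move=> ht hy; have [tr|tr] := leqP t r.
    by apply: eq_existsb => i; rewrite pos_swap_past.
  have far i (u : {ffun I -> coins n}) : i \in B -> (forall s, (s <= r)%N -> pos x0 u s i = pos x0 w s i) ->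
      pos x0 u t i != y.
    move=> iB e; apply/negP => /eqP h; have := H t y ht tr hy i iB.
    have := pos_dist x0 u i (ltnW tr); rewrite h e // distrC; lia.
  apply: eq_existsb => i; have [iB|iB] := boolP (i \in B); last by rewrite pos_swap_out.
  rewrite (negbTE (far i w iB _)) //; apply/negbTE; apply: far => // s sr.
  by rewrite pos_swap_past.
apply/asboolP/asboolP; apply: crossing_mono => t y ht [h1 h2]; split=> //.
  by rewrite -eq_occ.
by rewrite eq_occ.
Qed.
End Decoupling.

(** * Sparsity restored by diffusion *)

Section Resparse.
Variables (K : realType) (I : finType) (n : nat).
Implicit Types (w : {ffun I -> coins n}).

Lemma int_window (z : K) (W : nat) (y : int) : `|y%:~R - z| <= W%:R ->
  exists j : 'I_(2 * W).+1, y = Num.ceil (z - W%:R) + j%:Z.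
Proof.
rewrite ler_norml => /andP[h1 h2].
have c1 : Num.ceil (z - W%:R) <= y.
  by rewrite ceil_le_int; lra.
have c2 : y <= Num.ceil (z - W%:R) + (2 * W)%:Z.
  have := ceil_ge (z - W%:R) => h3.
  by rewrite -(ler_int K) intrD -[((2 * W)%:Z)%:~R]pmulrn natrM; lra.
have hj : (absz (y - Num.ceil (z - W%:R))%R < (2 * W).+1)%N by lia.
by exists (Ordinal hj) => /=; lia.
Qed.

(** The room [eps] is split in two: one half pays for the imperfect averaging over long windows,
    which the condition on [s * eps] keeps small, the other is the deviation in Chernoff's bound.
    The prefactor counts left ends of windows. *)
Lemma prob_dense (x0 : I -> int) z0 W0 (d s eps : K) (h m W t : nat) z :
  (t <= n)%N -> (0 < m)%N -> 1 <= d -> 0 < s -> s ^+ 2 <= t.+1%:R ->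
  0 < eps <= 4^-1 -> 4 * h%:R * m%:R ^+ 2 <= s * eps ->
  `|z - z0| + W%:R + t%:R + (2 * h * m)%:R <= W0 ->
  sparse x0 z0 W0 (d * (2 * h * m)%:R) (2 * h * m) ->
  prob K (fun w => ~~ `[< sparse (pos x0 w t) z W%:R (d * (1 + eps) * (2 * h)%:R) (2 * h) >]) <=
   (2 * W).+1%:R * expR (- ((2 * h)%:R * eps ^+ 2 / 64)).
Proof.
move=> tn m0 d1 s0 st /andP[eps0 eps1] hs hW sp.
set A := d * (1 + eps) * _.
pose F (j : 'I_(2 * W).+1) (w : {ffun I -> coins n}) :=
  let y := Num.ceil (z - W%:R) + j%:Z in
  (`|y%:~R - z| <= W%:R) && (A < (count_in (pos x0 w t) y (2 * h))%:R).
apply: (@le_trans _ _ (\sum_j prob K (F j))).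
  apply: prob_union => w /asboolPn.
  rewrite /sparse => /existsNP[y /not_implyP[hy /negP]]; rewrite -ltNge => hA.
  by have [j ej] := int_window hy; exists j; rewrite /F -ej hy hA.
set q := expR _.
have -> : (2 * W).+1%:R * q = \sum_(j < (2 * W).+1) q.
  by rewrite sumr_const card_ord mulr_natl.
apply: ler_sum => j _.
set y := Num.ceil (z - W%:R) + j%:Z.
have [hy|hy] := boolP (`|y%:~R - z| <= W%:R); last first.
  rewrite /F -/y (negbTE hy) /prob /= mean_cst ?card_coins_gt0 //.
  exact: expR_ge0.
rewrite /q {q}; have d0 : 0 < d by lra.
have mu : mean (fun w => (count_in (pos x0 w t) y (2 * h))%:R) <= d * (2 * h)%:R * (1 + eps / 2).
  apply: (le_trans (mean_count_le (D := d * (2 * h * m)%:R) tn m0 s0 st _)).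
    move=> y' hy'; apply: sp.
    have h1 : `|(y' - y)%:~R| <= (t + 2 * h * m)%:R :> K.
      by rewrite -intr_norm [leRHS]pmulrn ler_int.
    apply: le_trans hW; rewrite -(subrKA y%:~R) -rmorphB /=.
    apply: (le_trans (ler_normD _ _)).
    have -> : y%:~R - z0 = (y%:~R - z) + (z - z0) by ring.
    have := ler_normD (y%:~R - z) (z - z0); move: h1; rewrite natrD; lra.
  have mR : 0 < m%:R :> K by rewrite ltr0n.
  rewrite mulrDr mulr1 lerD //.
    by rewrite natrM mulrA mulfK // gt_eqF.
  rewrite !natrM -subr_ge0.
  have -> : d * (2 * h%:R) * (eps / 2) - h%:R * m%:R * (2 * (d * (2 * h%:R * m%:R)) / s) =
      d * h%:R / s * (s * eps - 4 * h%:R * m%:R ^+ 2) by field; rewrite gt_eqF.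
  by rewrite mulr_ge0 ?subr_ge0 // divr_ge0 ?mulr_ge0 ?ler0n // ltW.
(* With the parameter [eps / 8] the gain [eps^2 / 16] in the exponent outweighs the loss
   [eps^2 / 32 * (1 + eps / 2)], both in units of [d * (2 * h)]. *)
have th : 0 <= eps / 8 <= 2^-1 by apply/andP; split; lra.
apply: (@le_trans _ _ (prob K (fun w => A < (count_in (pos x0 w t) y (2 * h))%:R))).
  by apply: prob_le => w /andP[].
apply: (le_trans (count_tail A th mu)).
rewrite ler_expR /A; set H := (2 * h)%:R.
have H0 : 0 <= H by rewrite ler0n.
have -> : (eps / 8 + 2 * (eps / 8) ^+ 2) * (d * H * (1 + eps / 2)) - eps / 8 * (d * (1 + eps) * H)
   = - (d * H * (eps ^+ 2 * (1 - eps / 2) / 32)) by field.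
rewrite lerN2.
apply: (@le_trans _ _ (d * (H * eps ^+ 2 / 64))).
  by rewrite ler_peMl // divr_ge0 // mulr_ge0 // sqr_ge0.
rewrite -!mulrA; apply: ler_wpM2l; first exact: ltW.
apply: ler_wpM2l => //; have := sqr_ge0 eps; move: (eps ^+ 2) => e2 he2.
nra.
Qed.
End Resparse.

(** * Crossings at the smallest scale *)

Section BaseScale.
Variables (K : realType) (I : finType) (n : nat).

Lemma count_in_blocks (x : I -> int) (z W D : K) l (y : int) (b : nat) :
  sparse x z W D l ->
  (forall j, (j < b)%N -> `|(y + (l * j)%:Z)%:~R - z| <= W) ->
  (count_in x y (l * b))%:R <= b%:R * D.
Proof.
move=> sp H; rewrite -count_in_tile natr_sum.
have -> : b%:R * D = \sum_(j < b) D by rewrite sumr_const card_ord mulr_natl.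
by apply: ler_sum => j _; apply: sp; apply: H.
Qed.

(* With jumps as long as the tube is wide, a crossing only needs one empty site
   of the tube at each time. *)
Lemma prob_base (x0 : I -> int) (c : nat -> K) (W D z : K) (J l b M N : nat) :
  (N <= n)%N -> (0 < M)%N -> (0 < J)%N ->
  (forall t, `|c t.+1 - c t| <= 8) ->
  (forall t, (t <= N)%N -> `|c t - z| + (2 * J)%:R + 2 + N%:R + (l * b)%:R <= W) ->
  sparse x0 z W D l ->
  (4 * J + 2 * N <= l * b)%N -> b%:R * D <= (M * J)%:R ->
  prob K (fun w : {ffun I -> coins n} =>
    ~~ cross (4 * J + 8)%N%:Z x0 w c (2 * J)%:R 1 N) <=
  N%:R * (1 - 2^-1 ^+ (2 * M)) ^+ J./2.
Proof.
move=> Nn M0 J0 hc hW sp hl hD.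
pose y0 (r : nat) : int := Num.ceil (c r.+1 - (2 * J)%:R).
pose F (r : 'I_N) (w : {ffun I -> coins n}) :=
  [forall j : 'I_J, occupied x0 w r.+1 (y0 r + (4 * j)%:Z)].
have y0_near (r : nat) (k : nat) : (k + 1 <= 4 * J)%N ->
    `|(y0 r + k%:Z)%:~R - c r.+1| <= (2 * J)%:R.
  move=> kJ; have h1 := ceil_ge (c r.+1 - (2 * J)%:R).
  have h2 := gt_pred_ceil (c r.+1 - (2 * J)%:R).
  have h3 : k%:R + 1 <= (4 * J)%:R :> K by rewrite -(natrD _ k 1) ler_nat.
  have h4 : 0 <= k%:R :> K by rewrite ler0n.
  rewrite /y0; move: h1 h2 h3 h4; set y := Num.ceil _.
  rewrite rmorphB /= intrD -[k%:Z%:~R]pmulrn !natrM ler_norml => h1 h2 h3 h4.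
  by apply/andP; split; lra.
apply: (@le_trans _ _ (\sum_r prob K (F r))).
  apply: prob_union => w; rewrite /cross => /asboolPn nc.
  apply: contrapT => /forallNP hF; apply: nc.
  have ex t : exists y : int, (1 <= t <= N)%N ->
      ~~ occupied x0 w t y /\ `|y%:~R - c t| <= (2 * J)%:R.
    have [ht|ht] := boolP (1 <= t <= N)%N; last by exists 0.
    case: t ht => // r /andP[_ rN].
    have := hF (Ordinal rN) => /negP; rewrite negb_forall => /existsP[j hj].
    exists (y0 r + (4 * j)%:Z) => _; split=> //; apply: y0_near.
    by have := ltn_ord j; lia.
  have [g hg] := choice ex.
  exists g; split=> t ht.
    have [_ h1] : ~~ occupied x0 w t (g t) /\ `|(g t)%:~R - c t| <= (2 * J)%:R.
      by apply: hg; lia.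
    have [_ h2] : ~~ occupied x0 w t.+1 (g t.+1) /\ `|(g t.+1)%:~R - c t.+1| <= (2 * J)%:R.
      by apply: hg; lia.
    rewrite -(ler_int K) intr_norm rmorphB /= -[_%:Z%:~R]pmulrn natrD.
    have -> : (4 * J)%:R = (2 * J)%:R + (2 * J)%:R :> K by rewrite -natrD; congr _%:R; lia.
    move: h1 h2 (hc t); rewrite !ler_norml => /andP[a1 a2] /andP[a3 a4] /andP[a5 a6].
    by apply/andP; split; lra.
  exact: hg.
have -> : N%:R * (1 - 2^-1 ^+ (2 * M)) ^+ J./2 = \sum_(r < N) (1 - 2^-1 ^+ (2 * M)) ^+ J./2 :> K.
  by rewrite sumr_const card_ord mulr_natl.
apply: ler_sum => r _; apply: prob_all_occupied => //.
  exact: leq_trans (ltn_ord r) Nn.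
have rN := ltn_ord r.
have le1 : (count_in x0 (y0 r - 1 - r%:Z) (4 * J + 2 * r) <= count_in x0 (y0 r - 1 - r%:Z) (l * b))%N.
  by apply: count_in_le; lia.
apply: (leq_trans le1); rewrite -(ler_nat K); apply: le_trans hD.
apply: (count_in_blocks sp) => j jb.
have := y0_near r 0%N; rewrite addr0 => /(_ ltac:(lia)) h1.
have := hW r.+1 rN.
have h2 : (l * j)%:R <= (l * b)%:R :> K by rewrite ler_nat leq_mul2l ltnW ?orbT.
have h3 : (r : nat)%:R + 1 <= N%:R :> K by rewrite -(natrD _ r 1) ler_nat addn1.
have h4 : 0 <= (r : nat)%:R :> K by rewrite ler0n.
have h5 : 0 <= (l * j)%:R :> K by rewrite ler0n.
move: h1; rewrite !rmorphD !rmorphN /= -![_%:Z%:~R]pmulrn !ler_norml.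
move=> /andP[b1 b2] hw.
have := ler_norm (c r.+1 - z); have := ler_norm (- (c r.+1 - z)); rewrite normrN.
move=> n1 n2; apply/andP; split; lra.
Qed.
End BaseScale.

(** * The scales *)

Section Scales.
Variables (K : realType) (a e rho : nat).

(* T_k = 2^tau k = 2^k X_k is the time scale and X_k the half-width of a tube, with
   X_{k+1} = 2^16 T_k; sparsity at scale k is measured on intervals of length
   2 hlen k << sqrt T_k.  The densities dens k decrease to rho, each step
   leaving the room needed by Chernoff's bound.  The slopes of the crossing
   paths are summable, as each scale adds one slope to those of the
   scale above. *)
Fixpoint tau k := if k is k'.+1 then (tau k' + 16 + k)%N else (4 * a)%N.
Definition tm k := (2 ^ tau k)%N.
Definition wd k := (2 ^ (tau k - k))%N.
Definition tm_ratio k := (2 ^ (17 + k))%N.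
Definition hlen k := (2 ^ (a + 4 * k))%N.
Definition eps k : K := 2^-1 ^+ k.+2.
Definition dens k : K := rho%:R * (1 + 2^-1 ^+ k).
Definition slope k : K := 4 * 2^-1 ^+ k.
(** The bound [2 * slope k] is the sum of [slope j] over [j >= k]: a lane of slope [slope k] around
    an admissible centre of scale [k + 1] is admissible at scale [k]. *)
Definition lips k (c : nat -> K) := forall t, `|c t.+1 - c t| <= 2 * slope k.
(** Half of the radius [40 T_k] is for the displacement of the centre plus the elapsed time, the
    other half for the region in which sparsity is to be restored one scale below. *)
Definition sparse_at (I : finType) k (x : I -> int) (z : K) :=
  sparse x z (40 * tm k)%:R (dens k * (2 * hlen k)%:R) (2 * hlen k).
Definition err k : K := (2 * (40 * tm k)).+1%:R * expR (- ((2 * hlen k)%:R * eps k ^+ 2 / 64)).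
(* 2 X_0 + 8: the width of a tube of scale 0 plus the speed of its centre. *)
Definition jump : int := (4 * 2 ^ (4 * a - 1) + 8)%N%:Z.
(* qs k bounds the failure probability at scale k, err k the probability that
   sparsity at scale k has not been restored. *)
Definition qs k : K := 2^-1 ^+ (e + 2 * k).

Lemma tau_ge k : (4 * a + 16 * k <= tau k)%N.
Proof. by elim: k => [|k IH] /=; lia. Qed.

Lemma tm_gt0 k : (0 < tm k)%N.
Proof. by rewrite expn_gt0. Qed.

Lemma tmS k : tm k.+1 = (tm_ratio k * tm k)%N.
Proof. by rewrite /tm /tm_ratio -expnD /=; congr expn; lia. Qed.

Lemma wdS k : wd k.+1 = (2 ^ 16 * tm k)%N.
Proof. by rewrite /wd /tm -expnD /=; congr expn; lia. Qed.

Lemma tm_wd k : tm k = (2 ^ k * wd k)%N.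
Proof. by rewrite /tm /wd -expnD subnKC //; have := tau_ge k; lia. Qed.

Lemma wd_le k : (wd k <= tm k)%N.
Proof. by rewrite tm_wd leq_pmull // expn_gt0. Qed.

Lemma tm_ratio_ge k : (2 ^ 17 <= tm_ratio k)%N.
Proof. by rewrite /tm_ratio leq_pexp2l // leq_addr. Qed.

Lemma halfX_inv k : 2^-1 ^+ k * (2 ^ k)%N%:R = 1 :> K.
Proof. by rewrite natrX -exprMn mulVf ?expr1n // pnatr_eq0. Qed.

Lemma slope_tm k : slope k * (tm k)%:R = 4 * (wd k)%:R.
Proof. by rewrite /slope tm_wd natrM mulrA -[4 * _ * _]mulrA halfX_inv mulr1. Qed.

Lemma halfX_le1 k : 0 < (2^-1 : K) ^+ k <= 1.
Proof.
by rewrite exprn_gt0 ?invr_gt0 //= exprn_ile1 ?invr_ge0 // invf_le1 // ler1n.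
Qed.

Lemma slope_le k : 0 < slope k <= 4.
Proof. by have := halfX_le1 k; rewrite /slope => /andP[h1 h2]; apply/andP; split; lra. Qed.

Lemma slopeS k : 2 * slope k.+1 = slope k.
Proof. by rewrite /slope exprS; field. Qed.

Lemma lips_dist k c s d : lips k c -> `|c (s + d)%N - c s| <= 2 * slope k * d%:R.
Proof.
move=> hc; elim: d => [|d IH]; first by rewrite addn0 subrr normr0 mulr0.
rewrite addnS -(subrKA (c (s + d)%N)) -[d.+1%:R]natr1 mulrDr mulr1 addrC.
exact: le_trans (ler_normD _ _) (lerD IH (hc _)).
Qed.

Lemma dens_step k : dens k.+1 * (1 + eps k) <= dens k.
Proof.
rewrite /dens /eps -mulrA ler_wpM2l ?ler0n // !exprS.
by have := halfX_le1 k; move: (_ ^+ k) => x /andP[x0 x1]; nra.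
Qed.

Lemma dens_init k : rho%:R * (1 + eps k) <= dens k.
Proof.
rewrite /dens /eps ler_wpM2l ?ler0n // lerD2l !exprS.
by have := halfX_le1 k; move: (_ ^+ k) => x /andP[x0 x1]; lra.
Qed.

Lemma eps_bounds k : 0 < eps k <= 4^-1.
Proof.
rewrite /eps !exprS; have := halfX_le1 k; move: (_ ^+ k) => x /andP[x0 x1].
by apply/andP; split; lra.
Qed.

Hypotheses (a5 : (5 <= a)%N) (rho0 : (0 < rho)%N).

Section Regenerate.
Variables (I : finType) (n : nat).

Lemma sparse_weaken (x : I -> int) (z W W' D D' : K) l :
  W' <= W -> D <= D' -> sparse x z W D l -> sparse x z W' D' l.
Proof. by move=> WW DD h y hy; apply: le_trans DD; apply: h; apply: le_trans WW. Qed.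

Lemma regenerate k (x0 : I -> int) (z0 z : K) t :
  (t <= n)%N -> (2 ^ (tau k.+1 - 1) <= t)%N ->
  `|z - z0| + t%:R <= (20 * tm k.+1)%:R ->
  sparse_at k.+1 x0 z0 ->
  prob K (fun w : {ffun I -> coins n} => ~~ `[< sparse_at k (pos x0 w t) z >]) <= err k.
Proof.
move=> tn tt hz sp; have lam := tau_ge k.+1.
have e16 : (2 * hlen k.+1 = 2 * hlen k * 16)%N.
  rewrite /hlen (_ : (a + 4 * k.+1 = a + 4 * k + 4)%N); last by lia.
  by rewrite expnD mulnA.
have h40 : (40 * tm k <= tm k.+1)%N.
  rewrite tmS leq_mul2r; apply/orP; right.
  by apply: leq_trans (tm_ratio_ge k).
have hel : (2 * hlen k * 16 <= tm k.+1)%N.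
  by rewrite -e16 /hlen /tm -expnS leq_pexp2l //; lia.
(* Window lengths of consecutive scales have ratio 16, and [s] solves [4 h m^2 = s * eps]; its
   square is at most [t], because windows are short compared with the square root of the time. *)
apply: le_trans (prob_dense (z := z) (z0 := z0) (W0 := (40 * tm k.+1)%:R) (d := dens k.+1) (m := 16)
    (s := (2 ^ (a + 5 * k + 12))%N%:R) (eps := eps k) (h := hlen k) (W := (40 * tm k)%N)
    tn _ _ _ _ (eps_bounds k) _ _ _).
- apply: prob_le => w; apply: contra => /asboolP h; apply/asboolP.
  by apply: sparse_weaken h => //; rewrite ler_wpM2r ?ler0n // dens_step.
- by [].
- rewrite /dens; have : 1 <= rho%:R :> K by rewrite ler1n.
  by have := halfX_le1 k.+1; move: (_ ^+ k.+1) => x /andP[x1 x2]; nra.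
- by rewrite ltr0n expn_gt0.
- rewrite -natrX ler_nat -expnM; apply: leq_trans (leqW tt).
  by rewrite leq_pexp2l //; lia.
- rewrite le_eqVlt; apply/orP; left; apply/eqP; rewrite /eps.
  have -> : (2 ^ (a + 5 * k + 12) = 4 * hlen k * 16 ^ 2 * 2 ^ k.+2)%N.
    rewrite /hlen -(expnD 2 2) (_ : 16 ^ 2 = 2 ^ 8)%N // -!expnD; congr expn; lia.
  rewrite natrM -[RHS]mulrA [X in _ = _ * X]mulrC halfX_inv mulr1 !natrM natrX.
  by [].
- rewrite -[X in _ <= X%:R]/((20 + 20) * tm k.+1)%N mulnDl natrD.
  have : (40 * tm k)%:R <= (tm k.+1)%:R :> K by rewrite ler_nat.
  have : (2 * hlen k * 16)%:R <= (tm k.+1)%:R :> K by rewrite ler_nat.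
  have : 0 <= (tm k.+1)%:R :> K by rewrite ler0n.
  move: hz; rewrite !(natrM _ 20 (tm k.+1)).
  move: (tm k.+1)%:R (40 * tm k)%:R (2 * hlen k * 16)%:R (t%:R) `|_| => A B C D E.
  by lra.
- rewrite -e16; exact: sp.
Qed.

(** The initial configuration is sparse at every scale, so no longer windows are needed ([m = 1]):
    the density [rho] merely has to persist, up to the factor [1 + eps k]. *)
Lemma regenerate_init k (x0 : I -> int) (z0 z W0 : K) t :
  (t <= n)%N -> (tm k <= t)%N ->
  `|z - z0| + t%:R + (42 * tm k)%:R <= W0 ->
  sparse x0 z0 W0 (rho%:R * (2 * hlen k)%:R) (2 * hlen k) ->
  prob K (fun w : {ffun I -> coins n} => ~~ `[< sparse_at k (pos x0 w t) z >]) <= err k.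
Proof.
move=> tn tt hz sp; have lam := tau_ge k.
have hel : (2 * hlen k <= tm k)%N.
  by rewrite /hlen /tm -expnS leq_pexp2l //; lia.
apply: le_trans (prob_dense (z := z) (z0 := z0) (W0 := W0) (d := rho%:R) (m := 1)
    (s := (2 ^ (a + 5 * k + 4))%N%:R) (eps := eps k) (h := hlen k) (W := (40 * tm k)%N)
    tn _ _ _ _ (eps_bounds k) _ _ _).
- apply: prob_le => w; apply: contra => /asboolP h; apply/asboolP.
  by apply: sparse_weaken h => //; rewrite ler_wpM2r ?ler0n // dens_init.
- by [].
- by rewrite ler1n.
- by rewrite ltr0n expn_gt0.
- rewrite -natrX ler_nat -expnM; apply: leq_trans (leqW tt).
  by rewrite leq_pexp2l //; lia.
- rewrite le_eqVlt; apply/orP; left; apply/eqP; rewrite /eps.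
  have -> : (2 ^ (a + 5 * k + 4) = 4 * hlen k * 2 ^ k.+2)%N.
    rewrite /hlen -(expnD 2 2) -!expnD; congr expn; lia.
  rewrite natrM -[RHS]mulrA [X in _ = _ * X]mulrC halfX_inv mulr1 !natrM expr1n mulr1.
  by [].
- apply: le_trans hz; rewrite muln1 -[X in _ <= _ + X%:R]/((40 + 2) * tm k)%N mulnDl natrD.
  have : (2 * hlen k)%:R <= (tm k)%:R :> K by rewrite ler_nat.
  have : 0 <= (tm k)%:R :> K by rewrite ler0n.
  rewrite (natrM _ 2 (tm k)).
  move: (tm k)%:R (40 * tm k)%:R (2 * hlen k)%:R (t%:R) `|_| => A B C D E.
  by lra.
- by rewrite muln1; exact: sp.
Qed.
End Regenerate.
End Scales.

(** Triangle inequality along [c1], [l1], [lt], [y], [p], [l2], [c2]: [W] would be at most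
    [21 X + 55 T], hence at most [76 T]. *)
Lemma columns_apart (K : realType) (p y t W X T c1 c2 l1 l2 lt : K) :
  `|lt - l1| <= 24 * T -> `|p - y| <= t -> t <= 3 * T ->
  `|l1 - c1| <= 10 * X -> `|l2 - c2| <= 10 * X -> `|c1 - c2| = W ->
  `|p - l2| <= 28 * T -> `|y - lt| <= X -> 400 * T <= W -> X <= T -> 0 < T -> False.
Proof.
rewrite (distrC l1 c1) (distrC lt l1) (distrC p y) (distrC y lt) => h1 h2 h3 h4 h5 h6 h7 h8 h9 h10 h11.
have := ler_distD l1 c1 c2; have := ler_distD lt l1 c2; have := ler_distD y lt c2.
have := ler_distD p y c2; have := ler_distD l2 p c2.
by lra.
Qed.

(** * From scale k to scale k + 1 *)

Section Step.
Variables (K : realType) (a e rho : nat).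
Hypotheses (a5 : (5 <= a)%N) (rho0 : (0 < rho)%N).
Variables (I : finType) (n k : nat) (x0 : I -> int) (c : nat -> K).
Local Notation T := (tm a k).
Local Notation X := ((wd a k)%:R : K).
Local Notation L := (tm_ratio k).
Local Notation cross := (cross (jump a)).
Hypotheses (nT : (3 * tm a k.+1 <= n)%N) (c_lip : lips k.+1 c).
Hypothesis x0_sparse : sparse_at a rho k.+1 x0 (c 0%N).
Hypothesis IH : forall (x : I -> int) (c' : nat -> K), lips k c' ->
  sparse_at a rho k x (c' 0%N) ->
  prob K (fun w : {ffun I -> coins n} => ~~ cross x w c' X T (3 * T)) <= qs K e k.

(** For [d = 1] and [d = -1] the columns are [X_{k+1}] apart, and a chain of half-width [3 X_k]
    around either stays within [X_{k+1}] of [c]. *)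
Definition shift_col (d : K) (t : nat) : K := c t + d * ((wd a k.+1)%:R / 2).

(* d = 1 or -1 selects the column; sg = 0 is a link of the chain, sg = 1 or -1 a
   path crossing the column. *)
Definition lane (d sg : K) (s : nat) : nat -> K :=
  slanted (shift_col d) (slope K k) T sg s.

Definition bad (d sg : K) (s : nat) (w : {ffun I -> coins n}) : bool :=
  ~~ cross x0 w (lane d sg s) X (s * T + T) (s * T + 3 * T).

Definition sparse_then (d sg : K) (s : nat) (w : {ffun I -> coins n}) : bool :=
  `[< sparse_at a rho k (pos x0 w (s * T)) (lane d sg s (s * T)%N) >].

Lemma step_sizes : [/\ 0 < T%:R :> K, 0 <= X, X <= T%:R,
  400 * T%:R <= (wd a k.+1)%:R :> K & 2 * (wd a k.+1)%:R <= (tm a k.+1)%:R :> K].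
Proof.
split.
- by rewrite ltr0n tm_gt0.
- by rewrite ler0n.
- by rewrite ler_nat wd_le.
- rewrite -(natrM _ 400) ler_nat wdS leq_mul2r; apply/orP; right.
  by rewrite (_ : 400 = 400 * 1)%N // (expnD 2 9 7) leq_mul.
- rewrite -(natrM _ 2) ler_nat [X in (_ <= X)%N]tm_wd leq_mul2r expnS leq_pmulr ?orbT //.
  by rewrite expn_gt0.
Qed.

Lemma mulr_norm_le (x y z : K) : `|x| <= 1 -> `|y| <= z -> `|x * y| <= z.
Proof.
move=> h1 h2; rewrite normrM -[z]mul1r ler_pM ?normr_ge0 //.
Qed.

Lemma lane_lip d sg s : `|sg| <= 1 -> lips k (lane d sg s).
Proof.
move=> hsg t; rewrite /lane /slanted /shift_col.
have /andP[u0 _] := slope_le K k.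
have h1 := c_lip t; rewrite slopeS in h1.
have h2 : `|sg * slope K k| <= slope K k.
  by apply: mulr_norm_le => //; rewrite ger0_norm // ltW.
rewrite -[t.+1%:R]natr1.
set A := c t.+1; set B := c t; set E := d * _.
have -> : A + E + sg * (slope K k * (t%:R + 1 - (s%:R + 5 / 2) * T%:R)) -
  (B + E + sg * (slope K k * (t%:R - (s%:R + 5 / 2) * T%:R))) = (A - B) + sg * slope K k.
  by ring.
apply: (le_trans (ler_normD _ _)); rewrite -/A -/B in h1; move: h1 h2.
by lra.
Qed.

Lemma lane_offset d sg s t : `|sg| <= 1 -> (s * T <= t <= s * T + 3 * T)%N ->
  `|lane d sg s t - shift_col d t| <= 10 * X.
Proof.
move=> hsg /andP[t1 t2]; rewrite /lane /slanted addrAC subrr add0r.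
apply: mulr_norm_le => //; have /andP[u0 _] := slope_le K k.
have e1 : (s * T)%:R <= t%:R :> K by rewrite ler_nat.
have e2 : t%:R <= (s * T)%:R + 3 * T%:R :> K by rewrite -(natrM _ 3) -natrD ler_nat.
have e3 : 10 * X = slope K k * (5 / 2 * T%:R).
  by rewrite mulrCA slope_tm; field.
rewrite e3 normrM (ger0_norm (ltW u0)) ler_pM2l // mulrDl -natrM.
have [T0 _ _ _ _] := step_sizes.
move: e1 e2 T0; rewrite ler_norml; move: (t%:R) (s * T)%:R (T%:R) => p q r h1 h2 h3.
by apply/andP; split; lra.
Qed.

(** These are the rows whose crossings fill [[T_{k+1}, 3 T_{k+1}]]. None starts before
    [T_{k+1} / 2], which leaves time enough for [regenerate]. *)
Lemma row_time s : (L.-1 <= s <= 3 * L - 3)%N ->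
  [/\ (s * T + 3 * T <= 3 * tm a k.+1)%N & (2 ^ (tau a k.+1 - 1) <= s * T)%N].
Proof.
have h := tm_ratio_ge k.
have hL : (4 <= L)%N.
  by apply: leq_trans h; rewrite (_ : 4 = 4 * 1)%N // (expnD 2 2 15) leq_mul.
move=> /andP[s1 s2]; split.
  by rewrite -mulnDl tmS mulnA leq_mul2r; apply/orP; right; lia.
have -> : (2 ^ (tau a k.+1 - 1) = 2 ^ (16 + k) * T)%N.
  by rewrite /tm -expnD /=; congr expn; lia.
rewrite leq_mul2r; apply/orP; right; apply: leq_trans s1.
have : (L = 2 * 2 ^ (16 + k))%N by rewrite /tm_ratio -expnS.
by lia.
Qed.

Lemma dist_col d t : `|d| <= 1 -> (t <= 3 * tm a k.+1)%N ->
  `|shift_col d t - c 0%N| <= 13 * (tm a k.+1)%:R.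
Proof.
move=> hd ht; rewrite /shift_col.
have h1 := lips_dist 0 t c_lip; rewrite add0n slopeS in h1.
have [T0 _ _ h2 h3] := step_sizes.
have h4 : `|d * ((wd a k.+1)%:R / 2)| <= (tm a k.+1)%:R :> K.
  apply: mulr_norm_le => //; rewrite ger0_norm ?divr_ge0 ?ler0n //; lra.
have h5 : slope K k * t%:R <= 12 * (tm a k.+1)%:R.
  have -> : 12 * (tm a k.+1)%:R = 4 * (3 * tm a k.+1)%:R :> K by rewrite natrM; ring.
  have /andP[/ltW u0 u4] := slope_le K k.
  by apply: ler_pM => //; rewrite ?ler0n // ler_nat.
rewrite addrAC; apply: (le_trans (ler_normD _ _)).
by move: h1 h4 h5; lra.
Qed.

(** The lane starts within [13 T_{k+1} + 10 X_k] of [c 0], at a time at most [3 T_{k+1}]: together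
    below the [20 T_{k+1}] that [regenerate] allows. *)
Lemma prob_not_sparse d sg s : `|d| <= 1 -> `|sg| <= 1 ->
  (L.-1 <= s <= 3 * L - 3)%N ->
  prob K (fun w => ~~ sparse_then d sg s w) <= err K a k.
Proof.
move=> hd hsg hs; have [h1 h2] := row_time hs.
apply: (regenerate a5 rho0 (z0 := c 0%N) (x0 := x0)) => //.
  by apply: leq_trans nT; apply: leq_trans h1; rewrite leq_addr.
have le0 : (s * T <= s * T <= s * T + 3 * T)%N by rewrite leqnn leq_addr.
have h3 := lane_offset d hsg le0.
have h1' : (s * T <= 3 * tm a k.+1)%N by apply: leq_trans h1; rewrite leq_addr.
have h4 := dist_col hd h1'.
have h5 : (s * T)%:R <= 3 * (tm a k.+1)%:R :> K by rewrite -(natrM _ 3) ler_nat.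
have [T0 X0 h6 h7 h8] := step_sizes.
have h9 : `|lane d sg s (s * T)%N - c 0%N| <=
   `|lane d sg s (s * T)%N - shift_col d (s * T)%N| + `|shift_col d (s * T)%N - c 0%N|.
  by apply: le_trans (ler_normD _ _); rewrite subrKA.
by move: h3 h4 h5 h6 h7 h8 h9 T0 X0; rewrite (natrM _ 20); lra.
Qed.

Lemma lane_move d sg s r t : `|sg| <= 1 -> (t <= 3 * T)%N ->
  `|lane d sg s (r + t)%N - lane d sg s r| <= 24 * T%:R.
Proof.
move=> hsg ht; apply: (le_trans (lips_dist r t (lane_lip d s hsg))).
have /andP[/ltW u0 u4] := slope_le K k.
have h : t%:R <= 3 * T%:R :> K by rewrite -(natrM _ 3) ler_nat.
have -> : 24 * T%:R = 2 * (4 * (3 * T%:R)) :> K by ring.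
rewrite -mulrA ler_pM2l //; apply: ler_pM => //; exact: ler0n.
Qed.

Lemma int_near (p y : int) (t : nat) : `|p - y| <= t%:Z -> `|p%:~R - y%:~R| <= t%:R :> K.
Proof. by move=> h; rewrite -rmorphB /= -intr_norm [leRHS]pmulrn ler_int. Qed.

(** Either sparsity is back at time [s T], and the failure is that of a fresh system, or it is not,
    at cost [err]. The radius [28 T] is the drift [24 T] of the lane plus its half-width [X <= T]
    plus the distance [3 T] that a particle can travel. *)
Lemma bad_after d sg s (A : pred {ffun I -> coins n}) :
  `|d| <= 1 -> `|sg| <= 1 -> (L.-1 <= s <= 3 * L - 3)%N ->
  (forall w w', A (swap_walks (s * T)
     (nearby x0 w (s * T) (lane d sg s (s * T)%N) (28 * T%:R)) w w') = A w) ->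
  prob K (fun w => A w && bad d sg s w) <= qs K e k * prob K A + err K a k.
Proof.
move=> hd hsg hs HA; have [h1 _] := row_time hs.
have [T0 X0 XT _ _] := step_sizes.
apply: (@le_trans _ _ (prob K (fun w => [&& A w, sparse_then d sg s w & bad d sg s w] ||
    ~~ sparse_then d sg s w))).
  apply: prob_le => w /andP[-> ->] /=.
  by rewrite andbT orbN.
apply: (le_trans (prob_or _ _ _)); apply: lerD; last exact: prob_not_sparse.
apply: (decouple (Rn := jump a) (G := fun x => `[< sparse_at a rho k x (lane d sg s (s * T)%N) >])
  (D := 28 * T%:R)) => //.
- exact: leq_trans h1 nT.
- by rewrite /qs exprn_ge0 // invr_ge0.
- move=> t y p /andP[_ t3] hy hp.
  have h2 := lane_move d s (s * T) hsg t3.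
  have h3 := int_near hp.
  have h4 : t%:R <= 3 * T%:R :> K by rewrite -(natrM _ 3) ler_nat.
  have -> : p%:~R - lane d sg s (s * T)%N = (p%:~R - y%:~R) +
    ((y%:~R - lane d sg s (s * T + t)%N) + (lane d sg s (s * T + t)%N - lane d sg s (s * T)%N)).
    by ring.
  apply: (le_trans (ler_normD _ _)).
  have h5 := ler_normD (y%:~R - lane d sg s (s * T + t)%N)
     (lane d sg s (s * T + t)%N - lane d sg s (s * T)%N).
  by lra.
- move=> x /asboolP hx; apply: IH; last by rewrite addn0.
  by move=> t; rewrite addnS; apply: lane_lip.
Qed.

Lemma bad_single d sg s : `|d| <= 1 -> `|sg| <= 1 -> (L.-1 <= s <= 3 * L - 3)%N ->
  prob K (bad d sg s) <= qs K e k + err K a k.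
Proof.
move=> hd hsg hs.
have h := bad_after (A := xpredT) hd hsg hs (fun _ _ => erefl).
apply: (le_trans h); rewrite lerD2r /prob (mean_cst (1 : K)) ?card_coins_gt0 //.
by rewrite mulr1.
Qed.

(** The rows may overlap in time, so the first failure need not be decided when the second lane
    starts; the distance between the columns protects it from the resampling. *)
Lemma bad_pair (d sg1 sg2 : K) s1 s2 : `|d| = 1 -> `|sg1| <= 1 -> `|sg2| <= 1 ->
  (L.-1 <= s1 <= 3 * L - 3)%N -> (L.-1 <= s2 <= 3 * L - 3)%N -> (s1 <= s2)%N ->
  prob K (fun w => bad d sg1 s1 w && bad (- d) sg2 s2 w) <=
    qs K e k * (qs K e k + err K a k) + err K a k.
Proof.
move=> hd hsg1 hsg2 hs1 hs2 s12.
have hd1 : `|d| <= 1 by rewrite hd.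
have hd2 : `|- d| <= 1 by rewrite normrN.
have Q0 : 0 <= qs K e k by rewrite /qs exprn_ge0 // invr_ge0.
have [T0 X0 XT hw _] := step_sizes.
apply: (@le_trans _ _ (qs K e k * prob K (bad d sg1 s1) + err K a k)); last first.
  by rewrite lerD2r ler_wpM2l // bad_single.
apply: bad_after => // w w'; rewrite /bad; congr (~~ _).
apply: cross_swap_out => t y /andP[t1 t2] rt hy i; rewrite inE => hi.
rewrite ltNge; apply/negP => hp.
have st : (s1 * T <= s2 * T)%N by rewrite leq_mul2r s12 orbT.
have t3 : (t - s2 * T <= 3 * T)%N.
  by rewrite leq_subLR (leq_trans t2) // leq_add2r.
have hp' : `|pos x0 w (s2 * T) i - y| <= (t - s2 * T)%:Z by rewrite -subzn // ltnW.
have h1 := lane_move d s1 (s2 * T) hsg1 t3; rewrite subnKC ?(ltnW rt) // in h1.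
have h2 := int_near hp'.
have h3 : (t - s2 * T)%:R <= 3 * T%:R :> K by rewrite -(natrM _ 3) ler_nat.
have h4 : `|lane d sg1 s1 (s2 * T)%N - shift_col d (s2 * T)%N| <= 10 * X.
  by apply: lane_offset => //; rewrite st /= ltnW // (leq_trans rt).
have h5 : `|lane (- d) sg2 s2 (s2 * T)%N - shift_col (- d) (s2 * T)%N| <= 10 * X.
  by apply: lane_offset => //; rewrite leqnn leq_addr.
have h6 : `|shift_col d (s2 * T)%N - shift_col (- d) (s2 * T)%N| = (wd a k.+1)%:R.
  rewrite /shift_col (_ : _ - _ = d * (wd a k.+1)%:R); last by field.
  by rewrite normrM hd mul1r ger0_norm ?ler0n.
exact: columns_apart h1 h2 h3 h4 h5 h6 hi hy hw XT T0.
Qed.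

Lemma lane0 d s : lane d 0 s = shift_col d.
Proof. by apply/funext => t; rewrite /lane /slanted mul0r addr0. Qed.

Lemma tm_ratio_gt3 : (3 < L)%N.
Proof.
apply: leq_trans (tm_ratio_ge k).
by rewrite (_ : 4 = 4 * 1)%N // (expnD 2 2 15) leq_mul.
Qed.

Lemma lanes_cross d w : `|d| = 1 ->
  (forall s, (L.-1 <= s <= 3 * L - 3)%N ->
     [/\ ~~ bad d 0 s w, ~~ bad d 1 s w & ~~ bad d (-1) s w]) ->
  cross x0 w c (wd a k.+1)%:R (tm a k.+1) (3 * tm a k.+1).
Proof.
move=> hd H; have [T0 X0 XT hw _] := step_sizes; have L3 := tm_ratio_gt3.
pose op (t : nat) (y : int) := is_true (~~ occupied x0 w t y).
have H' s : (L.-1 <= s <= 3 * L - 3)%N ->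
  [/\ crossing (jump a) op (shift_col d) X ((s + 1) * T) ((s + 3) * T),
      crossing (jump a) op (slanted (shift_col d) (slope K k) T 1 s) X ((s + 1) * T) ((s + 3) * T) &
      crossing (jump a) op (slanted (shift_col d) (slope K k) T (-1) s) X ((s + 1) * T) ((s + 3) * T)].
  move=> hs; have [] := H s hs; rewrite /bad lane0 !mulnDl mul1n.
  by move=> /negPn/asboolP h1 /negPn/asboolP h2 /negPn/asboolP h3.
have first : crossing (jump a) op (shift_col d) X ((L.-1 + 1) * T) ((L.-1 + 3) * T).
  by have [] := H' L.-1 _; [lia|].
have [x hx] := chain_start X0 (tm_gt0 a k) first.
(* Row [L - 1] starts the chain at time [T_{k+1}]; after [2 L - 2] joints it reaches [3 T_{k+1}]. *)
have := chain_iter (d := (2 * L - 2)%N) X0 (tm_gt0 a k) (slope_tm K a k) _ hx.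
have -> : (L.-1 + (2 * L - 2) = 3 * L - 3)%N by lia.
move=> /(_ _ _) [| |g [pg _ _]].
- by rewrite leq_mul2r; apply/orP; right; lia.
- move=> i hi; have [_ h2 h3] := H' i ltac:(lia).
  have [h4 _ _] := H' i.+1 ltac:(lia).
  by split=> //; move: h4; rewrite -[i.+1]addn1 -!addnA.
have eL : ((3 * L - 3 + 3) * T = 3 * tm a k.+1)%N by rewrite tmS mulnA; congr muln; lia.
have eL' : ((L.-1 + 1) * T = tm a k.+1)%N by rewrite tmS; congr muln; lia.
rewrite eL eL' in pg.
apply/asboolP; exists g; apply: path_on_sub pg => // t y _ [h1 h2]; split=> //.
have h3 : `|d * ((wd a k.+1)%:R / 2)| = (wd a k.+1)%:R / 2 :> K.
  by rewrite normrM hd mul1r ger0_norm // divr_ge0 // ler0n.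
have h4 : y%:~R - c t = (y%:~R - shift_col d t) + d * ((wd a k.+1)%:R / 2).
  by rewrite /shift_col; ring.
rewrite h4; apply: (le_trans (ler_normD _ _)); rewrite h3.
by lra.
Qed.

Definition row (i : 'I_(2 * L).-1) : nat := (L.-1 + i)%N.
Definition tilt (j : 'I_3) : K := (j : nat)%:R - 1.

Lemma row_bounds i : (L.-1 <= row i <= 3 * L - 3)%N.
Proof. by rewrite /row; have := ltn_ord i; have := tm_ratio_gt3; lia. Qed.

Lemma tilt_le1 j : `|tilt j| <= 1.
Proof.
rewrite /tilt; have : (j : nat)%:R <= 2%:R :> K by rewrite ler_nat -ltnS.
have : 0 <= (j : nat)%:R :> K by rewrite ler0n.
by rewrite ler_norml => h1 h2; apply/andP; split; lra.
Qed.

Lemma some_bad d w : `|d| = 1 ->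
  ~~ cross x0 w c (wd a k.+1)%:R (tm a k.+1) (3 * tm a k.+1) ->
  exists p : 'I_(2 * L).-1 * 'I_3, bad d (tilt p.2) (row p.1) w.
Proof.
move=> hd; apply: contraNP => /forallNP h; apply: (lanes_cross hd) => s hs.
have L3 := tm_ratio_gt3.
have hi : (s - L.-1 < (2 * L).-1)%N by lia.
have hr : row (Ordinal hi) = s by apply: subnKC; case/andP: hs.
have key (j : 'I_3) : ~~ bad d (tilt j) s w.
  by apply/negP => hb; apply: (h (Ordinal hi, j)); rewrite hr.
have t0 : tilt (inord 1) = 0 by rewrite /tilt inordK // subrr.
have t1 : tilt (inord 2) = 1 by rewrite /tilt inordK //; lra.
have t2 : tilt (inord 0) = -1 by rewrite /tilt inordK // sub0r.
by split; [rewrite -t0|rewrite -t1|rewrite -t2].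
Qed.

(** There are at most [36 L^2] pairs of lanes, each costing at most [2 Q^2]. As [L^2 = 2^34 * 4^k]
    and [Q = 2^-e * 4^-k], the total is [72 * 2^(34 - e) * Q], which must be at most [Q / 4]; 43 is
    the least [e] with [288 * 2^34 <= 2^e]. *)
Lemma step_bound : (43 <= e)%N -> err K a k <= 2^-1 ^+ (2 * e + 4 * k + 2) ->
  prob K (fun w : {ffun I -> coins n} =>
    ~~ cross x0 w c (wd a k.+1)%:R (tm a k.+1) (3 * tm a k.+1)) <= qs K e k.+1.
Proof.
move=> e43 herr; set Q := qs K e k; set E := err K a k.
pose J := ('I_(2 * L).-1 * 'I_3)%type.
pose F (p : J * J) (w : {ffun I -> coins n}) :=
  bad 1 (tilt p.1.2) (row p.1.1) w && bad (-1) (tilt p.2.2) (row p.2.1) w.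
apply: (@le_trans _ _ (\sum_p prob K (F p))).
  apply: prob_union => w hw.
  have [p hp] := some_bad (normr1 K) hw.
  have [p' hp'] := some_bad (normrN1 K) hw.
  by exists (p, p'); rewrite /F hp hp'.
have bound p : prob K (F p) <= Q * (Q + E) + E.
  (* The lane in the earlier row must come first; otherwise the columns change roles. *)
  have [h|h] := leqP (row p.1.1) (row p.2.1).
    by apply: bad_pair; rewrite ?normr1 ?tilt_le1 ?row_bounds.
  have e1 : F p = (fun w => bad (-1) (tilt p.2.2) (row p.2.1) w &&
      bad (- -1) (tilt p.1.2) (row p.1.1) w).
    by apply/funext => w; rewrite /F opprK andbC.
  by rewrite e1; apply: bad_pair; rewrite ?normrN1 ?tilt_le1 ?row_bounds // ltnW.
apply: (le_trans (ler_sum _ (fun p _ => bound p))).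
rewrite sumr_const -[_ *+ _]mulr_natl !card_prod !card_ord.
have h2 : (((2 * L).-1 * 3) * ((2 * L).-1 * 3) <= 36 * L ^ 2)%N.
  have : ((2 * L).-1 * 3 <= 6 * L)%N by lia.
  by move=> h; apply: (leq_trans (leq_mul h h)); lia.
have Q0 : 0 <= Q by rewrite /Q /qs exprn_ge0 // invr_ge0.
have Q1 : Q <= 1 by have /andP[] := halfX_le1 K (e + 2 * k).
have E0 : 0 <= E by rewrite /E /err mulr_ge0 ?ler0n ?expR_ge0.
have E1 : E <= Q ^+ 2 / 4.
  apply: (le_trans herr); rewrite /Q /qs -exprM.
  rewrite (_ : ((e + 2 * k) * 2 = 2 * e + 4 * k)%N); last by lia.
  by rewrite exprD le_eqVlt; apply/orP; left; apply/eqP; field.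
have b1 : Q * (Q + E) + E <= 2 * Q ^+ 2.
  have : Q * E <= E by rewrite ler_piMl.
  have : 0 <= Q ^+ 2 by rewrite sqr_ge0.
  rewrite mulrDr -expr2; by lra.
have b0 : 0 <= 2 * Q ^+ 2 by rewrite mulr_ge0 // sqr_ge0.
have bb : 0 <= Q * (Q + E) + E by rewrite addr_ge0 // mulr_ge0 // addr_ge0.
have y0 := halfX_le1 K k; have ye := halfX_le1 K e.
have hL : L%:R * 2^-1 ^+ k = 2 ^+ 17 :> K.
  by rewrite /tm_ratio expnD natrM -mulrA [_%:R * _ ^+ _]mulrC halfX_inv mulr1 natrX.
have hx : 2^-1 ^+ e * 2 ^+ 43 <= 1 :> K.
  rewrite -(subnKC e43) exprD mulrAC -exprMn mulVf ?expr1n ?mul1r //.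
  by have /andP[] := halfX_le1 K (e - 43).
have eQ : Q = 2^-1 ^+ e * (2^-1 ^+ k) ^+ 2.
  by rewrite /Q /qs exprD -exprM [(2 * k)%N]mulnC.
have eQ' : qs K e k.+1 = 4^-1 * (2^-1 ^+ e * (2^-1 ^+ k) ^+ 2).
  have h : (e + 2 * k.+1 = 2 + (e + 2 * k))%N by rewrite mulnS addnCA.
  rewrite -eQ /Q /qs h.
  rewrite [LHS]exprD.
  congr (_ * _).
  by field.
apply: (@le_trans _ _ ((36 * L%:R ^+ 2) * (2 * Q ^+ 2))).
  have h3 : (((2 * L).-1 * 3) * ((2 * L).-1 * 3))%N%:R <= 36 * L%:R ^+ 2 :> K.
    by rewrite -natrX -(natrM _ 36) ler_nat.
  exact: (ler_pM (ler0n _ _) bb h3 b1).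
rewrite eQ' eQ.
move: hL hx y0 ye; clear; move: (2^-1 ^+ k) (2^-1 ^+ e) (L%:R) => y x l hL hx /andP[y0' _] /andP[x0' _].
have -> : 36 * l ^+ 2 * (2 * (x * y ^+ 2) ^+ 2) = 72 * (l * y) ^+ 2 * x * (x * y ^+ 2) by ring.
rewrite hL.
have xy : 0 <= x * y ^+ 2 by rewrite mulr_ge0 ?sqr_ge0 // ltW.
apply: ler_wpM2r => //.
have e9 : (2 : K) ^+ 43 = 512 * (2 ^+ 17) ^+ 2.
  by rewrite -exprM (_ : 512 = 2 ^+ 9 :> K) -?exprD // -natrX.
move: hx; rewrite e9; have : 0 <= ((2 : K) ^+ 17) ^+ 2 * x by rewrite mulr_ge0 ?sqr_ge0 ?ltW.
rewrite -[72 * _ * x]mulrA [x * _]mulrC -[512 * _ * x]mulrA.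
move: (_ * x) => z z0 hz; lra.
Qed.
End Step.

(** * Induction over the scales and gluing from scale 0 upwards *)

Section Induction.
Variables (K : realType) (a e rho : nat).
Hypotheses (a5 : (5 <= a)%N) (rho0 : (0 < rho)%N) (e43 : (43 <= e)%N).
Hypothesis small_err : forall k, err K a k <= 2^-1 ^+ (2 * e + 4 * k + 2).
Hypothesis small_base :
  (3 * tm a 0)%:R * (1 - 2^-1 ^+ (2 * (32 * rho))) ^+ (2 ^ (4 * a - 1))./2 <= qs K e 0.
Variables (I : finType) (n : nat).
Local Notation cross := (cross (jump a)).
Local Notation T k := (tm a k).
Local Notation X k := ((wd a k)%:R : K).
Local Notation W k := ((5 * tm a k.+1)%:R : K).

Lemma base_cross (x0 : I -> int) (c : nat -> K) : (3 * T 0 <= n)%N -> lips 0 c ->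
  sparse_at a rho 0 x0 (c 0%N) ->
  prob K (fun w : {ffun I -> coins n} => ~~ cross x0 w c (X 0) 1 (3 * T 0)) <= qs K e 0.
Proof.
move=> nT hc sp; apply: le_trans small_base.
set J := (2 ^ (4 * a - 1))%N.
have eT : T 0 = (2 * J)%N by rewrite /tm /J -expnS /=; congr expn; lia.
have eX : wd a 0 = (2 * J)%N by rewrite /wd /J -expnS /=; congr expn; lia.
have J0 : (0 < J)%N by rewrite expn_gt0.
(* The [2^(3a+2)] windows cover length [16 J], exactly [4 J] for the tube plus [2 N] with
   [N = 3 T_0 = 6 J]. They hold at most [2 rho * 16 J] particles, whence [M = 32 rho]. *)
have elb : (2 * hlen a 0 * 2 ^ (3 * a + 2) = 16 * J)%N.
  rewrite /hlen /J -expnS -expnD (_ : 16 = 2 ^ 4)%N // -expnD; congr expn; lia.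
have ed : dens K rho 0 = 2 * rho%:R by rewrite /dens expr0; ring.
rewrite eX; apply: (prob_base (J := J) (b := (2 ^ (3 * a + 2))%N) _ _ J0 _ _ sp) => //.
- by rewrite muln_gt0.
- move=> t; apply: le_trans (hc t) _; rewrite /slope expr0; lra.
- move=> t ht; rewrite elb eT.
  have := lips_dist 0 t hc; rewrite add0n /slope expr0 => h1.
  have h2 : t%:R <= 6 * J%:R :> K by rewrite -(natrM _ 6) ler_nat; apply: leq_trans ht _; rewrite eT mulnA.
  have h3 : 1 <= J%:R :> K by rewrite ler1n.
  rewrite !natrM; move: h1 h2 h3; lra.
- by rewrite elb eT; lia.
- rewrite ed -mulrA -natrM; have -> : (32 * rho * J)%:R = 2 * (rho%:R * (16 * J)%:R) :> K.
    by rewrite !natrM; ring.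
  by rewrite -elb !natrM le_eqVlt; apply/orP; left; apply/eqP; ring.
Qed.

Lemma cross_sub (x0 : I -> int) (w : {ffun I -> coins n}) (c : nat -> K) Y t0 t0' t1 :
  (t0 <= t0')%N -> cross x0 w c Y t0 t1 -> cross x0 w c Y t0' t1.
Proof.
by move=> tt /asboolP[g pg]; apply/asboolP; exists g; apply: path_on_sub pg.
Qed.

Theorem multiscale k : (3 * T k <= n)%N -> forall (x0 : I -> int) (c : nat -> K), lips k c ->
  sparse_at a rho k x0 (c 0%N) ->
  prob K (fun w : {ffun I -> coins n} => ~~ cross x0 w c (X k) (T k) (3 * T k)) <= qs K e k.
Proof.
elim: k => [|k IH] nT x0 c hc sp.
  apply: le_trans (base_cross nT hc sp); apply: prob_le => w; apply: contra.
  by apply: cross_sub; rewrite tm_gt0.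
apply: (step_bound a5 rho0 (c := c)) => //.
apply: IH; apply: leq_trans nT; rewrite leq_mul2l tmS leq_pmull //.
by rewrite expn_gt0.
Qed.

(** The Markov property at time [r] applied to [multiscale]; [E] pays for configurations that are
    not sparse at that time. *)
Lemma fresh_cross k (x0 : I -> int) (c : nat -> K) r E : (r + 3 * T k <= n)%N -> lips k c ->
  prob K (fun w : {ffun I -> coins n} => ~~ `[< sparse_at a rho k (pos x0 w r) (c r) >]) <= E ->
  prob K (fun w : {ffun I -> coins n} => ~~ cross x0 w c (X k) (r + T k) (r + 3 * T k)) <=
    qs K e k + E.
Proof.
move=> rn hc hE.
pose G (w : {ffun I -> coins n}) := `[< sparse_at a rho k (pos x0 w r) (c r) >].
apply: (@le_trans _ _ (prob K (fun w => [&& true, G w &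
   ~~ cross x0 w c (X k) (r + T k) (r + 3 * T k)] || ~~ G w))).
  by apply: prob_le => w -> /=; rewrite andbT orbN.
apply: (le_trans (prob_or _ _ _)); apply: lerD hE.
have Q0 : 0 <= qs K e k by rewrite /qs exprn_ge0 // invr_ge0.
have := decouple (Rn := jump a) (A := xpredT) (x0 := x0) (c := c) (X := X k) (T0 := T k)
  (G := fun x => `[< sparse_at a rho k x (c r) >]) (D := 28 * (T k)%:R) rn Q0.
rewrite /prob (mean_cst (1 : K)) ?card_coins_gt0 // mulr1; apply => //.
- move=> t y p /andP[_ t3] hy hp.
  have h2 := lips_dist r t hc.
  have h3 := int_near K hp.
  have h4 : t%:R <= 3 * (T k)%:R :> K by rewrite -(natrM _ 3) ler_nat.
  have XT : X k <= (T k)%:R by rewrite ler_nat wd_le.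
  have /andP[/ltW u0 u4] := slope_le K k.
  have h6 : 2 * slope K k * t%:R <= 24 * (T k)%:R.
    have -> : 24 * (T k)%:R = 2 * (4 * (3 * (T k)%:R)) :> K by ring.
    rewrite -mulrA ler_pM2l //; apply: ler_pM => //; exact: ler0n.
  have -> : p%:~R - c r = (p%:~R - y%:~R) + ((y%:~R - c (r + t)%N) + (c (r + t)%N - c r)) by ring.
  apply: (le_trans (ler_normD _ _)).
  have h5 := ler_normD (y%:~R - c (r + t)%N) (c (r + t)%N - c r).
  by lra.
- move=> x /asboolP hx; apply: multiscale.
  + by apply: leq_trans rn; rewrite leq_addl.
  + by move=> t; rewrite addnS.
  + by rewrite addn0.
Qed.

Variables (m : nat) (x0 : I -> int).
Hypothesis nm : (3 * T m <= n)%N.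
Hypothesis x0_sparse : forall k, (k <= m)%N ->
  sparse x0 0 (W k) (rho%:R * (2 * hlen a k)%:R) (2 * hlen a k).

Definition ray (k : nat) (sg : K) (s : nat) : nat -> K :=
  slanted (fun=> 0) (slope K k) (T k) sg s.

Definition bad_ray k sg s (w : {ffun I -> coins n}) : bool :=
  ~~ cross x0 w (ray k sg s) (X k) (s * T k + T k) (s * T k + 3 * T k).

Lemma tm_le k k' : (k <= k')%N -> (T k <= T k')%N.
Proof.
move=> /subnKC <-; elim: (k' - k)%N => [|d IH]; first by rewrite addn0.
by rewrite addnS; apply: leq_trans IH _; rewrite tmS leq_pmull // expn_gt0.
Qed.

Lemma tm_big k : 400 * (T k)%:R <= (T k.+1)%:R :> K.
Proof.
rewrite -(natrM _ 400) ler_nat tmS leq_mul2r; apply/orP; right.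
apply: leq_trans (tm_ratio_ge k).
by rewrite (_ : 400 = 400 * 1)%N // (expnD 2 9 8) leq_mul.
Qed.

Lemma prob_bad_ray k sg s : `|sg| <= 1 -> (k < m)%N -> (s <= 3 * tm_ratio k - 3)%N ->
  prob K (bad_ray k sg s) <= qs K e k + err K a k.
Proof.
move=> hsg km hs.
have /andP[u0 _] := slope_le K k.
have L3 := tm_ratio_gt3 k.
have hsT : ((s + 3) * T k <= 3 * T k.+1)%N.
  by rewrite tmS mulnA leq_mul2r; apply/orP; right; lia.
have XT : X k <= (T k)%:R by rewrite ler_nat wd_le.
have X0 : 0 <= X k by rewrite ler0n.
have big := tm_big k.
have start : `|ray k sg s (s * T k)%N| <= 10 * X k.
  rewrite /ray /slanted add0r; apply: mulr_norm_le => //.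
  have -> : (s * T k)%:R - (s%:R + 5 / 2) * (T k)%:R = - (5 / 2 * (T k)%:R) :> K.
    by rewrite natrM; ring.
  rewrite mulrN normrN mulrCA slope_tm ger0_norm; first by lra.
  by rewrite mulr_ge0 ?divr_ge0 ?mulr_ge0.
apply: fresh_cross.
- rewrite -mulnDl; apply: leq_trans nm; apply: leq_trans hsT _.
  by rewrite leq_mul2l tm_le.
- move=> t; rewrite /ray /slanted -[t.+1%:R]natr1 !add0r.
  have -> : sg * (slope K k * (t%:R + 1 - (s%:R + 5 / 2) * (T k)%:R)) -
    sg * (slope K k * (t%:R - (s%:R + 5 / 2) * (T k)%:R)) = sg * slope K k by ring.
  apply: (@le_trans _ _ (slope K k)); last by lra.
  by apply: mulr_norm_le => //; rewrite ger0_norm // ltW.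
(* At [s = 0] diffusion has had no time, and the initial sparsity is used as it is. *)
have [s0|s0] := posnP s.
  rewrite s0 mul0n in start *.
  apply: (@le_trans _ _ 0); last by rewrite /err mulr_ge0 ?ler0n ?expR_ge0.
  rewrite -(mean_cst (0 : K) (card_coins_gt0 n I)); apply: mean_le => w.
  rewrite (_ : `[< _ >] = true) //; apply/asboolP => y hy.
  have -> : pos x0 w 0 = x0 by apply/funext => i; rewrite pos0.
  apply: le_trans (_ : rho%:R * (2 * hlen a k)%:R <= _).
    apply: (x0_sparse (ltnW km)); rewrite subr0.
    move: hy start; have := ler_normD (y%:~R - ray k sg 0 0) (ray k sg 0 0).
    by rewrite subrK !natrM; lra.
  rewrite ler_wpM2r ?ler0n //; apply: le_trans (dens_init K rho k).
  by rewrite ler_peMr ?ler0n // lerDl; have /andP[/ltW] := eps_bounds K k.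
apply: (regenerate_init a5 rho0 (z0 := 0) _ _ _ (x0_sparse (ltnW km))).
- apply: leq_trans nm; apply: leq_trans (_ : 3 * T k.+1 <= _)%N; last by rewrite leq_mul2l tm_le.
  by apply: leq_trans hsT; rewrite leq_mul2r; apply/orP; right; lia.
- by rewrite leq_pmull.
- rewrite subr0; have h : (s * T k)%:R <= 3 * (T k.+1)%:R :> K.
    rewrite -(natrM _ 3) ler_nat; apply: leq_trans hsT.
    by rewrite leq_mul2r; apply/orP; right; lia.
  by move: start h; rewrite (natrM _ 42) (natrM _ 5); lra.
Qed.

Definition long_path (w : {ffun I -> coins n}) : Prop := exists g,
  path_on (jump a) (fun t y => is_true (~~ occupied x0 w t y)) 1 (3 * T m) g /\
  `|(g 1%N)%:~R| <= X 0.

(** During [[2 T_k, 3 T_k]] the path built so far is within [X_k] of the origin, so it can be the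
    first link of a chain of scale [k] around the constant centre 0. That chain ends at [3 T_{k+1}]
    and fits in the tube of scale [k + 1], as [3 X_k <= X_{k+1}]. *)
Lemma assemble w : cross x0 w (fun=> 0) (X 0) 1 (3 * T 0) ->
  (forall k s, (k < m)%N -> (s <= 3 * tm_ratio k - 3)%N ->
    [/\ ~~ bad_ray k 0 s w, ~~ bad_ray k 1 s w & ~~ bad_ray k (-1) s w]) ->
  long_path w.
Proof.
move=> hb H; pose op (t : nat) (y : int) := is_true (~~ occupied x0 w t y).
suff : forall k, (k <= m)%N -> exists h, [/\ path_on (jump a) op 1 (3 * T k) h,
    `|(h 1%N)%:~R| <= X 0 &
    forall t, (2 * T k <= t <= 3 * T k)%N -> `|(h t)%:~R| <= X k].
  by move=> /(_ m (leqnn _)) [h [h1 h2 _]]; exists h.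
elim=> [_|k IH km].
  have [g [g1 g2]] := asboolW hb; have T0 := tm_gt0 a 0.
  have gX t : (1 <= t <= 3 * T 0)%N -> `|(g t)%:~R| <= X 0.
    by move=> ht; have [_] := g2 t ht; rewrite subr0.
  exists g; split.
  - by split=> // t ht; have [] := g2 t ht.
  - by apply: gX; rewrite leqnn muln_gt0.
  - by move=> t /andP[h1 h2]; apply: gX; rewrite h2 andbT; apply: leq_trans h1; rewrite muln_gt0.
have [h [h1 h2 h3]] := IH (ltnW km).
have L3 := tm_ratio_gt3 k; have T0 := tm_gt0 a k.
have X0 : 0 <= X k by rewrite ler0n.
have X3 : 3 * X k <= X k.+1.
  rewrite -(natrM _ 3) ler_nat wdS; apply: leq_mul (wd_le a k).
  by rewrite (_ : 3 = 3 * 1)%N // (expnD 2 2 14) leq_mul.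
have H' s : (s <= 3 * tm_ratio k - 3)%N ->
  [/\ crossing (jump a) op (fun=> 0) (X k) ((s + 1) * T k) ((s + 3) * T k),
      crossing (jump a) op (slanted (fun=> 0) (slope K k) (T k) 1 s) (X k) ((s + 1) * T k) ((s + 3) * T k) &
      crossing (jump a) op (slanted (fun=> 0) (slope K k) (T k) (-1) s) (X k) ((s + 1) * T k) ((s + 3) * T k)].
  move=> hs; have [] := H k s km hs; rewrite /bad_ray !mulnDl mul1n.
  have -> : ray k 0 s = (fun=> 0) by apply/funext => t; rewrite /ray /slanted mul0r addr0.
  by move=> /negPn/asboolP q1 /negPn/asboolP q2 /negPn/asboolP q3.
have inv0 : chain_inv (jump a) op (fun=> 0) (X k) (T k) (2 * T k) (h (2 * T k)%N) 0.
  exists h; rewrite add0n; split=> //; last first.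
    by move=> t ht; rewrite subr0; apply: h3.
  have T1 : (1 <= 2 * T k)%N by rewrite muln_gt0.
  split=> t /andP[t1 t2]; first by apply: h1.1; rewrite (leq_trans T1).
  split; first by apply: h1.2; rewrite (leq_trans T1).
  rewrite subr0; apply: le_trans (h3 t _) _; first by rewrite t1.
  by rewrite ler_peMl // ler1n.
have := chain_iter (d := (3 * tm_ratio k - 3)%N) X0 T0 (slope_tm K a k) _ inv0.
rewrite add0n => /(_ _ _) [| |g [pg g2 _]].
- by [].
- move=> i hi; have [_ q2 q3] := H' i ltac:(lia).
  have [q4 _ _] := H' i.+1 ltac:(lia).
  by split=> //; move: q4; rewrite -[i.+1]addn1 -!addnA.
have eL : ((3 * tm_ratio k - 3 + 3) * T k = 3 * T k.+1)%N.
  by rewrite tmS mulnA; congr muln; lia.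
rewrite eL in pg.
have TT : (2 * T k < 2 * T k.+1)%N.
  rewrite tmS ltn_mul2l /= -{1}[T k]mul1n ltn_mul2r T0 /=; lia.
exists (fun t => if (t <= 2 * T k)%N then h t else g t); split.
- apply: path_on_cat.
  + by apply: path_on_sub h1 => //; rewrite leq_mul2r orbT.
  + by apply: path_on_sub pg => // t y _ [].
  + by rewrite g2.
  + by rewrite muln_gt0 T0 /= (leq_trans (ltnW TT)) // leq_mul2r orbT.
- by rewrite muln_gt0 T0.
- move=> t /andP[t1 t2]; rewrite ifF; last first.
    by apply/negbTE; rewrite -ltnNge (leq_trans TT).
  have ht : (2 * T k <= t <= 3 * T k.+1)%N by rewrite t2 (leq_trans (ltnW TT)).
  by have [_] := pg.2 t ht; rewrite subr0 => q; apply: le_trans q X3.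
Qed.

(** About [9 L] lanes with [L = 2^(17+k)], each failing with probability at most [2 qs k]: the decay
    [4^-k] built into [qs] beats the growth of [L] and leaves a summable bound. *)
Lemma prob_level k : (k < m)%N ->
  prob K (fun w => [exists p : 'I_(3 * tm_ratio k - 2) * 'I_3, bad_ray k (tilt K p.2) p.1 w]) <=
  2^-1 ^+ (k + 3).
Proof.
move=> km; have L3 := tm_ratio_gt3 k.
apply: (@le_trans _ _ (\sum_(p : 'I_(3 * tm_ratio k - 2) * 'I_3)
    prob K (fun w => bad_ray k (tilt K p.2) p.1 w))).
  by apply: prob_union => w /existsP[p hp]; exists p.
apply: (@le_trans _ _ (\sum_(p : 'I_(3 * tm_ratio k - 2) * 'I_3) (2 * qs K e k))).
  apply: ler_sum => -[i j] _ /=.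
  have hi : (i <= 3 * tm_ratio k - 3)%N by have := ltn_ord i; lia.
  apply: le_trans (prob_bad_ray (tilt_le1 K j) km hi) _.
  rewrite mulr_natl mulr2n lerD2l; apply: (le_trans (small_err k)); rewrite /qs.
  by apply: ler_wiXn2l; rewrite ?invr_ge0 ?invf_le1 ?ler1n //; lia.
rewrite sumr_const -[_ *+ _]mulr_natl card_prod !card_ord.
have h1 : ((3 * tm_ratio k - 2) * 3)%:R <= 9 * (tm_ratio k)%:R :> K.
  by rewrite -(natrM _ 9) ler_nat; lia.
have hL : (tm_ratio k)%:R * 2^-1 ^+ k = 2 ^+ 17 :> K.
  by rewrite /tm_ratio expnD natrM -mulrA [_%:R * _ ^+ _]mulrC halfX_inv mulr1 natrX.
have he : 2^-1 ^+ e <= 2^-1 ^+ 17 * 2^-1 ^+ 8 :> K.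
  rewrite -exprD; apply: ler_wiXn2l; rewrite ?invr_ge0 ?invf_le1 ?ler1n //.
  by apply: leq_trans e43.
have eQ : qs K e k = 2^-1 ^+ e * (2^-1 ^+ k) ^+ 2.
  by rewrite /qs exprD -exprM [(2 * k)%N]mulnC.
have h17 : (2 : K) ^+ 17 * 2^-1 ^+ 17 = 1 by rewrite -exprMn divff // expr1n.
have Q0 : 0 <= 2 * qs K e k by rewrite mulr_ge0 // /qs exprn_ge0 // invr_ge0.
apply: le_trans (ler_wpM2r Q0 h1) _; rewrite eQ exprD.
have /andP[y0 _] := halfX_le1 K k.
have p0 : 0 <= (2 : K) ^+ 17 by rewrite exprn_ge0.
move: hL he h17 y0 p0; move: (2^-1 ^+ k) (2^-1 ^+ e) (tm_ratio k)%:R (2 ^+ 17) (2^-1 ^+ 17).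
move=> y x l p q hL he h17 y0 p0.
have -> : 9 * l * (2 * (x * y ^+ 2)) = 18 * (l * y) * x * y by ring.
rewrite hL [y * _]mulrC ler_pM2r //.
have := ler_wpM2l p0 he; rewrite mulrA h17 mul1r => h3.
have : p * x <= 256^-1 by apply: le_trans h3 _; rewrite le_eqVlt; apply/orP; left; apply/eqP; field.
by lra.
Qed.

Lemma prob_long_path : 2^-1 <= prob K (fun w => `[< long_path w >]).
Proof.
have cardO := card_coins_gt0 n I.
suff : prob K (fun w => ~~ `[< long_path w >]) <= 2^-1 by rewrite probC //; lra.
pose B (w : {ffun I -> coins n}) := ~~ cross x0 w (fun=> 0) (X 0) 1 (3 * T 0).
pose F (k : 'I_m) (w : {ffun I -> coins n}) := [exists p : 'I_(3 * tm_ratio k - 2) * 'I_3, bad_ray k (tilt K p.2) p.1 w].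
apply: (@le_trans _ _ (prob K B + \sum_k prob K (F k))).
  apply: (@le_trans _ _ (prob K (fun w => B w || [exists k, F k w]))).
    apply: prob_le => w /asboolPn nl; apply: contra_notT nl.
    rewrite negb_or => /andP[/negPn hB]; rewrite negb_exists => /forallP hF.
    apply: assemble => // k s km hs.
    have hs' : (s < 3 * tm_ratio k - 2)%N by have := tm_ratio_gt3 k; lia.
    have key (j : 'I_3) : ~~ bad_ray k (tilt K j) s w.
      have := hF (Ordinal km); rewrite /F negb_exists => /forallP /(_ (Ordinal hs', j)).
      by [].
    have t0 : tilt K (inord 1) = 0 by rewrite /tilt inordK // subrr.
    have t1 : tilt K (inord 2) = 1 by rewrite /tilt inordK //; lra.
    have t2 : tilt K (inord 0) = -1 by rewrite /tilt inordK // sub0r.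
    by split; [rewrite -t0|rewrite -t1|rewrite -t2].
  apply: (le_trans (prob_or _ _ _)); rewrite lerD2l.
  by apply: prob_union => w /existsP[k hk]; exists k.
have hB : prob K B <= 4^-1.
  apply: (@le_trans _ _ (qs K e 0)).
    apply: base_cross.
    - by apply: leq_trans nm; rewrite leq_mul2l tm_le.
    - by move=> t; rewrite subrr normr0; have /andP[/ltW] := slope_le K 0; lra.
    - apply: sparse_weaken (x0_sparse (leq0n m)).
        have := tm_big 0; rewrite (natrM _ 40) (natrM _ 5).
        by have : 0 <= (T 0)%:R :> K by []; lra.
      rewrite ler_wpM2r ?ler0n //; apply: le_trans (dens_init K rho 0).
      by rewrite ler_peMr ?ler0n // lerDl; have /andP[/ltW] := eps_bounds K 0.
  rewrite /qs; apply: (@le_trans _ _ (2^-1 ^+ 2)); last by lra.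
  by apply: ler_wiXn2l; rewrite ?invr_ge0 ?invf_le1 ?ler1n //; lia.
have hF : \sum_k prob K (F k) <= 4^-1.
  apply: (@le_trans _ _ (\sum_(k < m) 2^-1 ^+ (k + 3))).
    by apply: ler_sum => k _; apply: prob_level.
  have -> : \sum_(k < m) 2^-1 ^+ (k + 3) = 4^-1 * (1 - 2^-1 ^+ m) :> K.
    elim: m => [|j IHj]; first by rewrite big_ord0 expr0 subrr mulr0.
    by rewrite big_ord_recr /= IHj exprD [2^-1 ^+ j.+1]exprS; field.
  have /andP[q0 q1] := halfX_le1 K m.
  by move: (2^-1 ^+ m) q0 q1 => q; lra.
by lra.
Qed.
End Induction.

(** * Choice of the constants *)

Section Constants.
Variable K : realType.

Lemma tau_le a k : (tau a k <= 4 * a + 16 * k + k * k)%N.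
Proof. by elim: k => [|k IH] /=; lia. Qed.

Lemma expR_half j : expR (- j%:R) <= 2^-1 ^+ j :> K.
Proof.
have h : expR (- 1) <= 2^-1 :> K.
  rewrite expRN lef_pV2 ?posrE ?expR_gt0 //.
  by have := expR_ge1Dx (1 : K); lra.
rewrite (_ : - j%:R = j%:R * (- 1)); last by rewrite mulrN1.
rewrite expRM_natl.
by apply: lerXn2r; rewrite ?nnegrE ?expR_ge0 ?invr_ge0.
Qed.

Lemma pow_grow (f : nat -> nat) b : (f 0 <= 2 ^ b)%N ->
  (forall k, f k.+1 <= 4 * f k)%N -> forall k, (f k <= 2 ^ (b + 2 * k))%N.
Proof.
move=> f0 fS; elim=> [|k IH]; first by rewrite addn0.
apply: leq_trans (fS k) _; rewrite (_ : b + 2 * k.+1 = 2 + (b + 2 * k))%N; last by lia.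
by rewrite expnD leq_mul2l IH orbT.
Qed.

Lemma exp_linear b : (8 <= b)%N -> (5 * b + 131 <= 2 ^ b)%N.
Proof.
move=> /subnKC <-; elim: (b - 8)%N => [//|j IH].
by rewrite addnS expnS; move: IH; move: (2 ^ (8 + j))%N => z; lia.
Qed.

(** The exponent in [err] has size [2^(a-9+2k)], whereas the logarithm of the number of windows is
    at most quadratic in [k], by [tau_le]. *)
Lemma err_small a k : (17 <= a)%N -> err K a k <= 2^-1 ^+ (2 * 43 + 4 * k + 2).
Proof.
move=> a17.
have hexp : (2 * hlen a k)%:R * eps K k ^+ 2 / 64 = (2 ^ (a - 9 + 2 * k))%N%:R.
  rewrite /hlen /eps -expnS (_ : (a + 4 * k).+1 = (a - 9 + 2 * k) + (2 * k.+2 + 6))%N; last by lia.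
  rewrite -exprM [(k.+2 * 2)%N]mulnC.
  move: (a - 9 + 2 * k)%N (2 * k.+2)%N => p r.
  rewrite expnD expnD (natrM _ (2 ^ p)) (natrM _ (2 ^ r)).
  have c64 : (2 ^ 6)%N%:R = 64 :> K by rewrite natrX; ring.
  have := halfX_inv K r; rewrite c64.
  move: (2 ^ p)%N%:R (2^-1 ^+ r) (2 ^ r)%N%:R => A y B yB.
  by rewrite (_ : A * (B * 64) * y / 64 = A * (y * B)); [rewrite yB mulr1|field].
rewrite /err hexp; apply: le_trans (ler_wpM2l (ler0n _ _) (expR_half _)) _.
have h1 : (2 * (40 * tm a k)).+1%:R <= (2 ^ (tau a k + 7))%N%:R :> K.
  rewrite ler_nat expnD /tm.
  have : (0 < 2 ^ tau a k)%N by rewrite expn_gt0.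
  by rewrite (_ : 2 ^ 7 = 128)%N //; lia.
apply: le_trans (ler_wpM2r _ h1) _; first by rewrite exprn_ge0 // invr_ge0.
have h2 : (tau a k + 7 + (2 * 43 + 4 * k + 2) <= 2 ^ (a - 9 + 2 * k))%N.
  pose f k := (4 * a + 20 * k + k * k + 95)%N.
  apply: leq_trans (_ : f k <= _)%N; first by rewrite /f; have := tau_le a k; lia.
  apply: (@pow_grow f (a - 9)) => [|j]; last by rewrite /f; lia.
  by apply: leq_trans (exp_linear (_ : 8 <= a - 9)%N); rewrite /f; lia.
apply: (@le_trans _ _ ((2 ^ (tau a k + 7))%N%:R *
    2^-1 ^+ (tau a k + 7 + (2 * 43 + 4 * k + 2)))); last first.
  by rewrite exprD mulrA [_%:R * _]mulrC halfX_inv mul1r.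
apply: ler_wpM2l; first exact: ler0n.
by apply: ler_wiXn2l; rewrite ?invr_ge0 ?invf_le1 ?ler1n.
Qed.

(** Bernoulli's inequality for [(1 + d)^j], and [(1 - d) (1 + d) <= 1]. *)
Lemma pow_compl_bound (d : K) j : 0 <= d <= 1 -> (1 - d) ^+ j * (1 + j%:R * d) <= 1.
Proof.
move=> /andP[d0 d1].
have bern : 1 + j%:R * d <= (1 + d) ^+ j.
  elim: j => [|j IH]; first by rewrite mul0r addr0 expr0.
  rewrite exprS; apply: (@le_trans _ _ ((1 + d) * (1 + j%:R * d))); last first.
    by rewrite ler_wpM2l // addr_ge0.
  rewrite -[j.+1%:R]natr1 -subr_ge0.
  have -> : (1 + d) * (1 + j%:R * d) - (1 + (j%:R + 1) * d) = j%:R * d ^+ 2 by ring.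
  by rewrite mulr_ge0 ?ler0n ?sqr_ge0.
have q0 : 0 <= 1 - d by rewrite subr_ge0.
apply: le_trans (ler_wpM2l (exprn_ge0 j q0) bern) _.
rewrite -exprMn; apply: exprn_ile1; nra.
Qed.

(** With [48 j] times to control, [(1 - d)^(4 j)] is the square of a quantity at most [1 / (2 j d)];
    without the square the factor [j] would merely cancel. What remains is [12 / (j d^2)], and
    [d^2 = 2^-(128 rho)] dictates the lower bound on [a]. *)
Lemma base_small a rho : (17 <= a)%N -> (2 ^ (47 + 128 * rho) <= a)%N ->
  (3 * tm a 0)%:R * (1 - 2^-1 ^+ (2 * (32 * rho))) ^+ (2 ^ (4 * a - 1))./2 <= qs K 43 0.
Proof.
move=> a17 arho; set d : K := 2^-1 ^+ _.
pose j := (2 ^ (4 * a - 4))%N.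
have ja : (a <= j)%N.
  rewrite /j; apply: leq_trans (ltnW (ltn_expl a (ltnSn 1))) _.
  by rewrite leq_pexp2l //; lia.
have e1 : ((2 ^ (4 * a - 1))./2 = (2 * j) * 2)%N.
  have -> : (2 ^ (4 * a - 1) = (2 * j * 2).*2)%N.
    rewrite /j (_ : 4 * a - 1 = 4 * a - 4 + 3)%N; last by lia.
    by rewrite expnD -mul2n; lia.
  by rewrite doubleK.
have e2 : tm a 0 = (16 * j)%N.
  by rewrite /tm /j (_ : 16 = 2 ^ 4)%N // -expnD /=; congr expn; lia.
have /andP[d0 d1] : 0 < d <= 1 by apply: halfX_le1.
have dd : 2^-1 ^+ (128 * rho) = d ^+ 2.
  by rewrite /d -exprM; congr (_ ^+ _); lia.
have h := pow_compl_bound (2 * j) (_ : 0 <= d <= 1).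
rewrite e1 exprM e2; set q := (1 - d) ^+ (2 * j).
have q0 : 0 <= q by rewrite exprn_ge0 // subr_ge0.
have jR : 0 < j%:R :> K by rewrite ltr0n expn_gt0.
have hq : q * (2 * j%:R * d) <= 1.
  apply: le_trans (h _); last by rewrite ltW.
  by apply: ler_wpM2l => //; rewrite natrM lerDr.
have hq2 : q ^+ 2 * (2 * j%:R * d) ^+ 2 <= 1.
  rewrite -exprMn; apply: exprn_ile1 => //.
  by rewrite !mulr_ge0 // ltW.
have hj : 2 ^+ 47 <= j%:R * d ^+ 2.
  rewrite -dd; apply: (@le_trans _ _ ((2 ^ (47 + 128 * rho))%N%:R * 2^-1 ^+ (128 * rho))).
    by rewrite expnD natrM -mulrA [_%:R * _ ^+ _]mulrC halfX_inv mulr1 natrX.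
  apply: ler_wpM2r; first by rewrite exprn_ge0 // invr_ge0.
  by rewrite ler_nat (leq_trans arho).
rewrite /qs muln0 addn0 mulnA natrM.
rewrite -[leRHS]mul1r -ler_pdivrMr ?exprn_gt0 ?invr_gt0 //.
rewrite exprVn invrK.
have e3 : q ^+ 2 * (2 * j%:R * d) ^+ 2 = (4 * j%:R * q ^+ 2) * (j%:R * d ^+ 2) by ring.
rewrite e3 in hq2.
have z0 : 0 <= 4 * j%:R * q ^+ 2 by rewrite !mulr_ge0 ?sqr_ge0 // ltW.
have h5 := le_trans (ler_wpM2l z0 hj) hq2.
apply: le_trans h5.
have -> : (2 : K) ^+ 47 = 16 * 2 ^+ 43.
  by rewrite (exprD 2 4 43); congr (_ * _); ring.
have -> : (3 * 16)%:R * j%:R * q ^+ 2 * 2 ^+ 43 = (48 / 64) * (4 * j%:R * q ^+ 2 * (16 * 2 ^+ 43)) :> K.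
  by field.
rewrite ler_piMl //; last by lra.
by rewrite mulr_ge0 // mulr_ge0 // exprn_ge0.
Qed.

(** For a union bound over the left ends of windows at scale [k]; the right sides sum over [k] to at
    most [2^-q]. *)
Lemma init_small a q k : (17 <= a)%N -> (q <= a)%N ->
  (10 * tm a k.+1).+1%:R * 2^-1 ^+ (2 * hlen a k) <= 2^-1 ^+ (q + k.+1) :> K.
Proof.
move=> a17 qa.
have h1 : (10 * tm a k.+1).+1%:R <= (2 ^ (tau a k.+1 + 4))%N%:R :> K.
  rewrite ler_nat expnD /tm.
  have : (0 < 2 ^ tau a k.+1)%N by rewrite expn_gt0.
  by rewrite (_ : 2 ^ 4 = 16)%N //; lia.
apply: le_trans (ler_wpM2r _ h1) _; first by rewrite exprn_ge0 // invr_ge0.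
have h2 : (tau a k.+1 + 4 + (q + k.+1) <= 2 * hlen a k)%N.
  pose f k := (5 * a + 20 * k + k * k + 26)%N.
  apply: leq_trans (_ : f k <= _)%N; first by rewrite /f; have := tau_le a k.+1; lia.
  apply: leq_trans (_ : 2 ^ (a + 2 * k) <= _)%N; last first.
    by rewrite /hlen -expnS leq_pexp2l //; lia.
  apply: (@pow_grow f a) => [|j]; last by rewrite /f; lia.
  by apply: leq_trans (exp_linear (_ : 8 <= a)%N); rewrite /f; lia.
apply: (@le_trans _ _ ((2 ^ (tau a k.+1 + 4))%N%:R *
    2^-1 ^+ (tau a k.+1 + 4 + (q + k.+1)))); last first.
  by rewrite exprD mulrA [_%:R * _]mulrC halfX_inv mul1r.
apply: ler_wpM2l; first exact: ler0n.
by apply: ler_wiXn2l; rewrite ?invr_ge0 ?invf_le1 ?ler1n.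
Qed.
End Constants.

(** * Poisson initial data *)

Section PoissonSums.
Import numFieldNormedType.Exports.
Variables (K : realType) (lambda : K).
Hypothesis lambda0 : 0 < lambda.

Definition pmf (k : nat) : K := poisson_pmf lambda k.

Lemma pmfE k : pmf k = lambda ^+ k / k`!%:R * expR (- lambda).
Proof. by rewrite /pmf /poisson_pmf lambda0. Qed.

Lemma pmf_ge0 k : 0 <= pmf k.
Proof. by rewrite pmfE !mulr_ge0 ?invr_ge0 ?expR_ge0 ?exprn_ge0 // ltW. Qed.

Lemma exp_series_le (x : K) M : 0 <= x -> \sum_(k < M) x ^+ k / k`!%:R <= expR x.
Proof.
move=> x0; have := nondecreasing_cvgn_le (u_ := series (exp_coeff x)) _
  (is_cvg_series_exp_coeff x) M.
rewrite seriesEnat /= big_mkord; apply.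
by apply: nondecreasing_series => k _ _; apply: exp_coeff_ge0.
Qed.

Lemma pmf_sum_le1 M : \sum_(k < M) pmf k <= 1.
Proof.
under eq_bigr do rewrite pmfE; rewrite -mulr_suml.
apply: le_trans (ler_wpM2r (expR_ge0 _) (exp_series_le M (ltW lambda0))) _.
by rewrite -expRD subrr expR0.
Qed.

(** Truncation of the exponential moment [E 2^N = e^lambda] of a Poisson variable. *)
Lemma pmf_sum_pow2 M : \sum_(k < M) pmf k * 2 ^+ k <= expR lambda.
Proof.
have e k : pmf k * 2 ^+ k = (lambda * 2) ^+ k / k`!%:R * expR (- lambda).
  by rewrite pmfE exprMn; ring.
under eq_bigr do rewrite e; rewrite -mulr_suml.
have h : 0 <= lambda * 2 by rewrite mulr_ge0 // ltW.
apply: le_trans (ler_wpM2r (expR_ge0 _) (exp_series_le M h)) _.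
by rewrite -expRD; rewrite (_ : lambda * 2 - lambda = lambda) //; ring.
Qed.

Lemma pmf_sum_ge (d : K) : 0 < d -> exists M, 1 - d <= \sum_(k < M) pmf k.
Proof.
move=> d0; have e0 := expR_gt0 lambda.
have hlt : (1 - d) * expR lambda < limn (series (exp_coeff lambda)).
  by rewrite -/(expR lambda) gtr_pMl //; lra.
have hnd : {homo series (exp_coeff lambda) : n m / (n <= m)%N >-> n <= m}.
  by apply: nondecreasing_series => k _ _; apply: exp_coeff_ge0; apply: ltW.
have [M _ hM] := lt_lim hnd (is_cvg_series_exp_coeff lambda) hlt.
exists M; have := hM M (leqnn _); rewrite /= seriesEnat /= big_mkord => h.
under eq_bigr do rewrite pmfE; rewrite -mulr_suml expRN.
by rewrite ler_pdivlMr.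
Qed.
End PoissonSums.

Section Sites.
Variable Wb : nat.
Local Notation N := (2 * Wb).+1.

Definition site (j : 'I_N) : int := (j : nat)%:Z - Wb%:Z.

Definition center : 'I_N := inord Wb.

Lemma site_center : site center = 0.
Proof. by rewrite /site /center inordK ?subrr //; lia. Qed.

End Sites.

Lemma pow_bernoulli (K : realType) (x : K) j : 0 <= x <= 1 -> 1 - j%:R * (1 - x) <= x ^+ j.
Proof.
move=> /andP[x0 x1]; elim: j => [|j IH]; first by rewrite mul0r subr0 expr0.
rewrite exprS -[j.+1%:R]natr1; apply: le_trans (ler_wpM2l x0 IH).
have j0 : 0 <= j%:R :> K by rewrite ler0n.
rewrite -subr_ge0 (_ : _ - _ = j%:R * (1 - x) ^+ 2); last by ring.
by rewrite mulr_ge0 ?sqr_ge0.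
Qed.

Section InitialData.
Variables (K : realType) (lambda : K).
Hypothesis lambda0 : 0 < lambda.
Variables (Wb M : nat).
Local Notation N := (2 * Wb).+1.

(* Labels that carry no particle are parked at Wb + 1, out of the way. *)
Definition start (nu : {ffun 'I_N -> 'I_M}) (i : 'I_N * 'I_M) : int :=
  if (i.2 < nu i.1)%N then site i.1 else Wb.+1%:Z.

Definition weight (nu : {ffun 'I_N -> 'I_M}) : K := \prod_j pmf lambda (nu j).

Lemma weight_ge0 nu : 0 <= weight nu.
Proof. by apply: prodr_ge0 => j _; apply: pmf_ge0. Qed.

Definition window (y : int) (l : nat) : pred 'I_N := fun j => y <= site j < y + l%:Z.

Lemma sum_ltn m v : (\sum_(i < m) (i < v) = minn m v)%N.
Proof.
elim: m => [|m IH]; first by rewrite big_ord0 min0n.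
by rewrite big_ord_recr /= IH; case: (ltnP m v); lia.
Qed.

Lemma count_start nu y l : y + l%:Z <= Wb.+1%:Z ->
  (count_in (start nu) y l <= \sum_(j | window y l j) nu j)%N.
Proof.
move=> hy; rewrite /count_in.
rewrite -(pair_bigA _ (fun j i => (y <= start nu (j, i) < y + l%:Z)%R : nat)) /=.
rewrite [leqRHS]big_mkcond; apply: leq_sum => j _.
apply: leq_trans (_ : \sum_(i < M) ((i < nu j)%N && window y l j) <= _)%N.
  apply: leq_sum => i _; rewrite /start /=; case: ifP => // _.
  by rewrite (_ : (Wb.+1%:Z < y + l%:Z) = false) ?andbF //; lia.
case: ifP => hw; last by rewrite big1 // => i _; rewrite andbF.
under eq_bigr do rewrite andbT.
by rewrite sum_ltn geq_minr.
Qed.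

Lemma card_window y l : (#|window y l| <= l)%N.
Proof.
pose f (j : 'I_N) := absz (site j - y).
have inj j j' : window y l j -> window y l j' -> f j = f j' -> j = j'.
  rewrite /window /f /site => h1 h2 h3.
  by apply: val_inj => /=; lia.
rewrite -[leqRHS](size_iota 0) cardE -(size_map f); apply: uniq_leq_size.
  rewrite map_inj_in_uniq ?enum_uniq // => j j'.
  by rewrite !mem_enum !unfold_in; apply: inj.
move=> z /mapP[j]; rewrite mem_enum mem_iota unfold_in /window => hj ->.
by move: hj; rewrite /f; lia.
Qed.

(** Markov's inequality for 2 to the power of the count: every site of the window contributes at
    most [e^lambda], and [2^-rho * e^lambda <= 1/2]. *)
Lemma dense_weight rho y l : 2 * expR lambda <= 2 ^+ rho -> y + l%:Z <= Wb.+1%:Z ->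
  \sum_nu weight nu * (rho * l < count_in (start nu) y l)%N%:R <= 2^-1 ^+ l.
Proof.
move=> hrho hy.
pose F (j : 'I_N) (k : 'I_M) : K := pmf lambda k * (if window y l j then 2 ^+ k else 1).
apply: (@le_trans _ _ (\sum_(nu : {ffun 'I_N -> 'I_M}) 2^-1 ^+ (rho * l) * \prod_j F j (nu j))).
  apply: ler_sum => nu _; rewrite /F big_split /= -/(weight nu) mulrCA.
  apply: ler_wpM2l; first exact: weight_ge0.
  rewrite -big_mkcond /= prodrXr.
  case: ltnP => h; last by rewrite mulr_ge0 // exprn_ge0 // invr_ge0.
  have h2 := leq_trans (ltnW h) (count_start nu hy).
  rewrite -(subnKC h2) exprD mulrA -exprMn mulVf // expr1n mul1r.
  by apply: exprn_ege1; rewrite ler1n.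
rewrite -mulr_sumr -bigA_distr_bigA /=.
have e1 : 1 <= expR lambda by rewrite -expR0 ler_expR ltW.
have e0 := expR_gt0 lambda.
have hF j : 0 <= \sum_k F j k <= if window y l j then expR lambda else 1.
  rewrite sumr_ge0 /=; last first.
    by move=> k _; rewrite /F mulr_ge0 ?pmf_ge0 //; case: ifP => // _; rewrite exprn_ge0.
  rewrite /F; case: ifP => _; first exact: pmf_sum_pow2.
  by under eq_bigr do rewrite mulr1; apply: pmf_sum_le1.
have h1 : \prod_j \sum_k F j k <= expR lambda ^+ l.
  apply: le_trans (ler_prod _ (fun j _ => hF j)) _.
  rewrite -big_mkcond /= prodr_const; apply: ler_weXn2l => //; exact: card_window.
apply: le_trans (ler_wpM2l _ h1) _; first by rewrite exprn_ge0 // invr_ge0.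
rewrite exprM -exprMn; apply: lerXn2r; rewrite ?nnegrE //.
rewrite exprVn mulrC ler_pdivrMr ?exprn_gt0 //; lra.
Qed.
End InitialData.

Section GoodData.
Variables (K : realType) (lambda : K) (a rho q m Wb : nat).
Hypotheses (lambda0 : 0 < lambda) (a17 : (17 <= a)%N) (qa : (q <= a)%N).
Hypotheses (hrho : 2 * expR lambda <= 2 ^+ rho) (hq : 2^-1 ^+ q <= expR (- lambda) / 4).
Hypothesis hWb : (6 * tm a m.+1 <= Wb)%N.
Local Notation N := (2 * Wb).+1.

Definition good_start M (nu : {ffun 'I_N -> 'I_M}) := forall k, (k <= m)%N ->
  sparse (start nu) 0 (5 * tm a k.+1)%:R (rho%:R * (2 * hlen a k)%:R : K) (2 * hlen a k).

(** The origin is empty with probability [e^-lambda], and [M] is so high that the [2 Wb] other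
    counts all lie below it with probability at least 1/2, by [pow_bernoulli]. *)
Lemma empty_center_weight M : (0 < M)%N -> 1 - (2 * N%:R)^-1 <= \sum_(k < M) pmf lambda k ->
  expR (- lambda) / 2 <=
  \sum_(nu : {ffun 'I_N -> 'I_M}) weight lambda nu * ((nu (center Wb) : nat) == 0%N)%:R.
Proof.
move=> M0 hM.
pose F (j : 'I_N) (k : 'I_M) : K := pmf lambda k * (if j == center Wb then ((k : nat) == 0%N)%:R else 1).
have -> : \sum_(nu : {ffun 'I_N -> 'I_M}) weight lambda nu * ((nu (center Wb) : nat) == 0%N)%:R =
    \sum_(nu : {ffun 'I_N -> 'I_M}) \prod_j F j (nu j).
  apply: eq_bigr => nu _; rewrite /F big_split /= -/(weight lambda nu); congr (_ * _).
  by rewrite -big_mkcond big_pred1_eq.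
rewrite -bigA_distr_bigA /= (bigD1 (center Wb)) //=.
have -> : \sum_k F (center Wb) k = expR (- lambda).
  rewrite (bigD1 (Ordinal M0)) //= big1 ?addr0.
    by rewrite /F eqxx /= mulr1 pmfE // expr0 fact0 divr1 mul1r.
  by move=> k k0; rewrite /F eqxx (_ : (k : nat) == 0%N = false) ?mulr0 //; apply/negbTE.
rewrite ler_pM2l ?expR_gt0 //.
set s := \sum_(k < M) _ in hM.
have -> : \prod_(j | j != center Wb) \sum_k F j k = s ^+ (2 * Wb).
  rewrite (eq_bigr (fun=> s)); last first.
    by move=> j jc; apply: eq_bigr => k _; rewrite /F (negbTE jc) mulr1.
  rewrite prodr_const; congr (_ ^+ _).
  have hc := cardC1 (center Wb); rewrite card_ord /= in hc.
  by rewrite -[RHS]hc; apply: eq_card => j; rewrite !inE.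
have s1 : s <= 1 by apply: pmf_sum_le1.
have s0 : 0 <= s by apply: sumr_ge0 => k _; apply: pmf_ge0.
apply: le_trans (pow_bernoulli (2 * Wb) (_ : 0 <= s <= 1)); last by rewrite s0.
have NR : 0 < N%:R :> K by rewrite ltr0n.
have h1 : (2 * Wb)%:R * (1 - s) <= N%:R * (2 * N%:R)^-1.
  apply: ler_pM; rewrite ?ler0n ?subr_ge0 //; first by rewrite ler_nat.
  by rewrite lerBlDl -lerBlDr.
have h2 : N%:R * (2 * N%:R)^-1 = 2^-1 :> K by field; rewrite gt_eqF.
by rewrite h2 in h1; lra.
Qed.

Lemma good_weight : exists M, expR (- lambda) / 4 <=
  \sum_(nu : {ffun 'I_N -> 'I_M})
     weight lambda nu * (`[< good_start nu >] && ((nu (center Wb) : nat) == 0%N))%:R.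
Proof.
have d0 : 0 < (2 * N%:R)^-1 :> K by rewrite invr_gt0 mulr_gt0 // ltr0n.
have [M hM] := pmf_sum_ge lambda0 d0; exists M.
have M0 : (0 < M)%N.
  rewrite lt0n; apply/eqP => e0; move: hM; rewrite e0 big_ord0 subr_le0 => hM.
  suff : (2 * N%:R)^-1 < 1 :> K by rewrite ltNge hM.
  by rewrite invf_lt1 ?mulr_gt0 ?ltr0n // -(natrM _ 2) ltr1n; lia.
have hc := empty_center_weight M0 hM.
pose y (k : nat) (j : nat) : int := Num.ceil (0 - (5 * tm a k.+1)%:R : K) + j%:Z.
pose l k := (2 * hlen a k)%N.
pose D k j (nu : {ffun 'I_N -> 'I_M}) : K := (rho * l k < count_in (start nu) (y k j) (l k))%N%:R.
have ylt k j : (k <= m)%N -> (j < (2 * (5 * tm a k.+1)).+1)%N -> y k j + (l k)%:Z <= Wb.+1%:Z.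
  move=> km hj.
  have hl : (l k <= tm a m.+1)%N.
    apply: leq_trans (_ : tm a k <= _)%N; last exact/tm_le/leqW.
    by rewrite /l /hlen /tm -expnS leq_pexp2l //; have := tau_ge a k; lia.
  have ht : (tm a k.+1 <= tm a m.+1)%N by apply: tm_le.
  have -> : y k j = - (5 * tm a k.+1)%:Z + j%:Z.
    rewrite /y sub0r; congr (_ + _).
    by rewrite [(_)%:R]pmulrn -rmorphN /= intrKceil.
  by lia.
(* A start that is not good has a dense window, so the indicator of a bad start is dominated by the
   sum of the [D k j]. *)
have key : expR (- lambda) / 2 <=
   \sum_(nu : {ffun 'I_N -> 'I_M})
     weight lambda nu * (`[< good_start nu >] && ((nu (center Wb) : nat) == 0%N))%:R +
   \sum_(k < m.+1) \sum_(j < (2 * (5 * tm a k.+1)).+1)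
     \sum_(nu : {ffun 'I_N -> 'I_M}) weight lambda nu * D k j nu.
  apply: (le_trans hc).
  have -> : \sum_(k < m.+1) \sum_(j < (2 * (5 * tm a k.+1)).+1)
     \sum_(nu : {ffun 'I_N -> 'I_M}) weight lambda nu * D k j nu =
    \sum_(nu : {ffun 'I_N -> 'I_M}) weight lambda nu *
      \sum_(k < m.+1) \sum_(j < (2 * (5 * tm a k.+1)).+1) D k j nu.
    rewrite [RHS](eq_bigr (fun nu => \sum_(k < m.+1) \sum_(j < (2 * (5 * tm a k.+1)).+1)
      weight lambda nu * D k j nu)); last first.
      by move=> nu _; rewrite mulr_sumr; apply: eq_bigr => k _; rewrite mulr_sumr.
    rewrite exchange_big /=; apply: eq_bigr => k _.
    by rewrite exchange_big.
  rewrite -big_split /=; apply: ler_sum => nu _; rewrite -mulrDr.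
  apply: ler_wpM2l; first exact: weight_ge0.
  have S0 : 0 <= \sum_(k < m.+1) \sum_(j < (2 * (5 * tm a k.+1)).+1) D k j nu.
    by apply: sumr_ge0 => k _; apply: sumr_ge0 => j _; rewrite ler0n.
  case: (boolP `[< good_start nu >]) => [_|/asboolPn ng] /=.
    by rewrite lerDl.
  rewrite add0r; apply: (@le_trans _ _ 1); first by case: eqP.
  have [k hk] : exists k : 'I_m.+1, ~ sparse (start nu) 0 (5 * tm a k.+1)%:R
      (rho%:R * (2 * hlen a k)%:R : K) (2 * hlen a k).
    apply: contrapT => /forallNP h; apply: ng => k km.
    by have := h (Ordinal (km : (k < m.+1)%N)) => /contrapT.
  have [z hz] : exists z : int, ~ (`|z%:~R - 0 : K| <= (5 * tm a k.+1)%:R ->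
      (count_in (start nu) z (2 * hlen a k))%:R <= rho%:R * (2 * hlen a k)%:R :> K).
    by apply: contrapT => /forallNP h; apply: hk => z; apply: contrapT; apply: h.
  have [hz1 /negP hz2] := (iffLR (not_implyP _ _)) hz.
  have [j ej] := int_window hz1.
  rewrite (bigD1 k) //= (bigD1 j) //=.
  rewrite /D /y -ej /l -(ltr_nat K) natrM ltNge hz2 -addrA lerDl addr_ge0 //.
    by apply: sumr_ge0 => i _; rewrite ler0n.
  by apply: sumr_ge0 => i _; apply: sumr_ge0 => j' _; rewrite ler0n.
have small : \sum_(k < m.+1) \sum_(j < (2 * (5 * tm a k.+1)).+1)
     \sum_(nu : {ffun 'I_N -> 'I_M}) weight lambda nu * D k j nu <= 2^-1 ^+ q.
  apply: (@le_trans _ _ (\sum_(k < m.+1) 2^-1 ^+ (q + k.+1))).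
    apply: ler_sum => k _; apply: le_trans (init_small K k a17 qa).
    rewrite (_ : (10 * tm a k.+1).+1%:R * 2^-1 ^+ (2 * hlen a k) =
      \sum_(j < (2 * (5 * tm a k.+1)).+1) 2^-1 ^+ (2 * hlen a k)); last first.
      by rewrite sumr_const card_ord mulnA mulr_natl.
    apply: ler_sum => j _; apply: dense_weight => //.
    by apply: ylt => //; have := ltn_ord k; lia.
  have -> : \sum_(k < m.+1) 2^-1 ^+ (q + k.+1) = 2^-1 ^+ q * (1 - 2^-1 ^+ m.+1) :> K.
    elim: m.+1 => [|j IHj]; first by rewrite big_ord0 expr0 subrr mulr0.
    by rewrite big_ord_recr /= IHj exprD [2^-1 ^+ j.+1]exprS; field.
  have /andP[q0 q1] := halfX_le1 K m.+1; have /andP[p0 p1] := halfX_le1 K q.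
  by rewrite ler_piMr ?ltW //; lra.
by move: key small hq; lra.
Qed.
End GoodData.

(** * Measurability and compactness *)

Section Survival.
Import numFieldNormedType.Exports.
Context (d : measure_display) (T : measurableType d) (K : realType)
  (P : probability T K).
Variables (N : int -> {RV P >-> nat}) (X : int -> nat -> nat -> {RV P >-> int}).
Variables (R : K) (Rn : nat).
Hypothesis RRn : R <= Rn%:R.

Definition vacant (n : nat) (x : int) : set T := [set w | occupation N X n x w = 0%E].

Lemma vacantP n x w : vacant n x w <->
  forall y i, (i < N y w)%N -> position X y i n w <> x.
Proof.
rewrite /vacant /occupation /counting /=; split.
- case: ifPn => [/asboolP fin|_] //; case=> /eqP.
  rewrite pnatr_eq0 cardfs_eq0 => /eqP e0 y i iN hx.
  have : [set p : int * nat | (p.2 < N p.1 w)%N /\ position X p.1 p.2 n w = x] = set0.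
    by rewrite -(fset_setK fin) e0 set_fset0.
  by move/seteqP => [/(_ (y, i)) h _]; apply: h.
- move=> H; have -> : [set p : int * nat | (p.2 < N p.1 w)%N /\ position X p.1 p.2 n w = x] = set0.
    by apply/seteqP; split=> // -[y i] /= [h1 h2]; case: (H y i h1).
  by rewrite ifT ?fset_set0 ?cardfs0 //; apply/asboolP.
Qed.

Lemma measurable_countable_union (U : countType) (F : U -> set T) :
  (forall u, measurable (F u)) -> measurable [set w | exists u, F u w].
Proof.
move=> mF; rewrite (_ : [set w | _] = \bigcup_u F u).
  by apply: countable_bigcupT_measurable => //; apply: countableP.
by apply/seteqP; split=> [w [u hu]|w [u _ hu]]; exists u.
Qed.

Lemma measurable_step y i k z : measurable [set w | X y i k w = z].
Proof. exact: (measurable_funPTI (X y i k) (Y := [set z])). Qed.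

Lemma measurable_position y i n x : measurable [set w | position X y i n w = x].
Proof.
elim: n x => [|n IH] x.
  rewrite (_ : [set w | _] = if y == x then setT else set0).
    by case: ifP => _; [exact: measurableT|exact: measurable0].
  apply/seteqP; rewrite /position; split=> w /=; rewrite big_ord0 addr0.
    by move=> ->; rewrite eqxx.
  by case: eqP.
rewrite (_ : [set w | _] = [set w | exists z : int,
    ([set w | position X y i n w = z] `&` [set w | X y i n w = x - z]) w]).
  by apply: measurable_countable_union => z; apply: measurableI => //; apply: measurable_step.
apply/seteqP; rewrite /position; split=> w /=; rewrite big_ord_recr /=.
  by move=> <-; exists (y + \sum_(k < n) X y i k w); rewrite addrA [_ + X _ _ _ _]addrC addrK.
by move=> [z [<- ->]]; rewrite addrA addrC subrK.
Qed.

Lemma measurable_vacant n x : measurable (vacant n x).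
Proof.
rewrite (_ : vacant n x = ~` [set w | exists p : int * nat,
    ([set w | (p.2 < N p.1 w)%N] `&` [set w | position X p.1 p.2 n w = x]) w]).
  apply: measurableC; apply: measurable_countable_union => -[y i] /=.
  apply: measurableI; last exact: measurable_position.
  exact: (measurable_funPTI (N y) (Y := [set k | (i < k)%N])).
apply/seteqP; split=> w.
  by move=> /vacantP H [[y i] [/= h1 h2]]; apply: (H y i).
by move=> H; apply/vacantP => y i h1 h2; apply: H; exists (y, i).
Qed.

(** Finite approximations to [escapes], whose definition quantifies over uncountably many [g]; here
    every step of the recursion is a countable union, hence measurable. *)
Fixpoint alive (L n : nat) (x : int) : set T :=
  if L is L'.+1 then
    vacant n x `&` [set w | exists y : int,
      (`|y - x|%:~R <= R) /\ alive L' n.+1 y w]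
  else vacant n x.

Lemma measurable_alive L n x : measurable (alive L n x).
Proof.
elim: L n x => [|L IH] n x /=; first exact: measurable_vacant.
apply: measurableI; first exact: measurable_vacant.
apply: (measurable_countable_union (F := fun y => [set w | (`|y - x|%:~R <= R) /\ alive L n.+1 y w])) => y.
have [h|h] := boolP (`|y - x|%:~R <= R).
  rewrite (_ : [set w | _] = alive L n.+1 y) //.
  by apply/seteqP; split=> w //= [].
rewrite (_ : [set w | _] = set0) //.
by apply/seteqP; split=> w //= -[].
Qed.

Lemma alive_pred L n x w : alive L.+1 n x w -> alive L n x w.
Proof.
elim: L n x => [|L IH] n x; first by case.
move=> [h1 [y [h2 h3]]]; split=> //; exists y; split=> //.
exact: IH.
Qed.

Lemma alive_mono L L' n x w : (L <= L')%N -> alive L' n x w -> alive L n x w.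
Proof.
move=> /subnKC <-; elim: (L' - L)%N => [|j IH]; first by rewrite addn0.
by rewrite addnS => /alive_pred.
Qed.

(* Only finitely many jumps are allowed, so a particle-free path of every length extends. *)
Lemma alive_extend n x w : (forall L, alive L n x w) ->
  exists y : int, (`|y - x|%:~R <= R) /\ forall L, alive L n.+1 y w.
Proof.
move=> H; apply: contrapT => /forallNP no.
have ex (j : 'I_(2 * Rn).+1) : exists L, forall L', (L <= L')%N ->
    (`|(x - Rn%:Z + j%:Z) - x|%:~R <= R) -> ~ alive L' n.+1 (x - Rn%:Z + j%:Z) w.
  have := no (x - Rn%:Z + j%:Z); set y := x - _ + _ => hno.
  have [h|h] := boolP (`|y - x|%:~R <= R); last by exists 0%N.
  have [L hL] : exists L, ~ alive L n.+1 y w.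
    by apply: contrapT => /forallNP h'; apply: hno; split=> // L; apply: contrapT; apply: h'.
  by exists L => L' LL' _ /(alive_mono LL').
have [f hf] := choice ex.
have [_ [y [h1 h2]]] := H (\max_j f j)%N.+1.
have hy : `|y - x| <= Rn%:Z.
  by rewrite -(ler_int K) (le_trans h1).
have hj : (absz (y - x + Rn%:Z)%R < (2 * Rn).+1)%N by lia.
have ey : y = x - Rn%:Z + (Ordinal hj : nat)%:Z by rewrite /=; lia.
have := hf (Ordinal hj) (\max_j f j)%N (leq_bigmax _); rewrite -ey; exact.
Qed.

Definition escapes : set T := [set w | (exists g : nat -> int,
            [/\ g 0%N = 0,
                forall n, `|g n.+1 - g n|%:~R <= R &
                forall n, occupation N X n (g n) w = 0%E])%R].

Lemma escapesE : escapes = \bigcap_L alive L 0 0.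
Proof.
apply/seteqP; split=> w.
- move=> [g [g0 g1 g2]] L _.
  suff : forall n, alive L n (g n) w by move=> /(_ 0%N); rewrite g0.
  elim: L => [|L IH] n; first exact: g2.
  by split; [exact: g2|exists (g n.+1)].
- move=> H.
  have H0 : forall L, alive L 0 0 w by move=> L; apply: H.
  have nxt (p : nat * int) : exists y : int, (forall L, alive L p.1 p.2 w) ->
      (`|y - p.2|%:~R <= R) /\ forall L, alive L p.1.+1 y w.
    have [h|h] := pselect (forall L, alive L p.1 p.2 w).
      by have [y hy] := alive_extend h; exists y.
    by exists 0 => /h.
  have [f hf] := choice nxt.
  pose g := fix g n := if n is n'.+1 then f (n', g n') else 0.
  have hg n : forall L, alive L n (g n) w.
    by elim: n => [//|n IH]; have [] := hf (n, g n) IH.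
  exists g; split=> // n; first by have [] := hf (n, g n) (hg n).
  exact: (hg n 0%N).
Qed.

(** The events [alive L 0 0] decrease in [L], so this is continuity of the measure from above. *)
Lemma prob_escapes_ge (c : K) : (forall L, (c%:E <= P (alive L 0 0))%E) -> (c%:E <= P escapes)%E.
Proof.
move=> H; rewrite escapesE.
have cv : (P \o (fun L => alive L 0 0)) L @[L --> \oo] --> P (\bigcap_L alive L 0 0).
  apply: nonincreasing_cvg_mu.
  - by apply: le_lt_trans (probability_le1 P _) _; [exact: measurable_alive|rewrite ltry].
  - by move=> L; apply: measurable_alive.
  - by apply: bigcap_measurableType => L _; apply: measurable_alive.
  - by move=> L L' LL; apply/subsetPset => w; apply: alive_mono.
by apply: cvge_ge cv; apply: nearW.
Qed.
End Survival.

(** * From finite systems to the Poisson walks *)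

Section Patterns.
Context (d : measure_display) (T : measurableType d) (K : realType)
  (P : probability T K).
Variables (N : int -> {RV P >-> nat}) (X : int -> nat -> nat -> {RV P >-> int}).
Variable lambda : K.
Hypothesis walks : poisson_walks N X lambda.
Variables (Wb M H : nat).
Local Notation S := (2 * Wb).+1.
Local Notation label := ('I_S * 'I_M)%type.
Local Notation walk := {ffun label -> coins H}.
Implicit Types (nu : {ffun 'I_S -> 'I_M}) (om : walk).

Definition pattern nu om : set T := [set w |
  (forall j, N (site j) w = nu j) /\
  (forall (i : label) (k : 'I_H), X (site i.1) i.2 k w = step (om i k))].

Definition site_of (y : int) : 'I_S := inord (absz (y + Wb%:Z)%R).

Lemma siteK (j : 'I_S) : site_of (site j) = j.
Proof. by apply: val_inj; rewrite /site_of /site /= inordK; have := ltn_ord j; lia. Qed.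

Lemma site_ofK (y : int) : `|y| <= Wb%:Z -> site (site_of y) = y.
Proof. by move=> hy; rewrite /site_of /site inordK; lia. Qed.

Definition source (s : 'I_S + label * 'I_H) : int + int * nat * nat :=
  match s with
  | inl j => inl (site j)
  | inr (i, k) => inr (site i.1, i.2 : nat, k : nat)
  end.

Lemma source_inj : injective source.
Proof.
move=> [j|[[j i] k]] [j'|[[j' i'] k']] //=.
  by move=> [h]; rewrite -(siteK j) h siteK.
move=> [h h1 h2]; congr (inr (_, _, _)); [|exact: val_inj|exact: val_inj].
by rewrite -(siteK j) h siteK.
Qed.

(** The constraint that a pattern puts on a single source, indexed as in [sources_independent]. The
    label of a step is found by the existential and is unique, because [source] is injective. *)
Definition pattern_source nu om (s : int + int * nat * nat) : set T :=
  match s with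
  | inl y => [set w | N y w = nu (site_of y)]
  | inr (y, i, k) => [set w | exists2 p : label * 'I_H,
       source (inr p) = inr (y, i, k) & X y i k w = step (om p.1 p.2)]
  end.

Lemma pattern_source_inr nu om (i : label) (k : 'I_H) :
  pattern_source nu om (source (inr (i, k))) =
  [set w | X (site i.1) i.2 k w = step (om i k)].
Proof.
apply/seteqP; split=> w /=; last by move=> h; exists (i, k).
case=> -[i' k'] h1 h2; have := source_inj (x1 := inr (i', k')) (x2 := inr (i, k)) h1.
by case=> e1 e2; move: h2; rewrite /= e1 e2.
Qed.

Lemma step_law_ffun y i k b : P [set w | X y i k w = step b] = (2^-1)%:E.
Proof. by have [h1 h2] := step_law walks y i k; case: b. Qed.

Lemma patternE nu om :
  pattern nu om = \bigcap_(s in [set` [fset source s | s in {: 'I_S + label * 'I_H}]%fset])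
    pattern_source nu om s.
Proof.
apply/seteqP; split=> w.
- move=> [h1 h2] s /= /imfsetP[[j|[i k]] _ ->] /=; first by rewrite siteK.
  by exists (i, k).
- move=> h; split=> [j|i k].
    have := h (inl (site j)); rewrite /= siteK; apply.
    by apply/imfsetP; exists (inl j).
  have := h (source (inr (i, k))); rewrite pattern_source_inr; apply.
  by apply/imfsetP; exists (inr (i, k)).
Qed.

Lemma measurable_pattern nu om : measurable (pattern nu om).
Proof.
rewrite patternE; apply: fin_bigcap_measurable; first exact: finite_fset.
move=> s /= /imfsetP[[j|[i k]] _ ->].
  exact: (measurable_funPTI (N (site j)) (Y := [set (nu (site_of (site j)) : nat)])).
by rewrite pattern_source_inr; apply: measurable_step.
Qed.

(** Independence splits the event over its sources. The steps contribute 1/2 each, which is the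
    uniform law on the coins: this is the bridge to the finite system. *)
Lemma prob_pattern nu om :
  P (pattern nu om) = (weight lambda nu / #|{: walk}|%:R)%:E.
Proof.
rewrite patternE (sources_independent walks); last first.
  move=> s /imfsetP[[j|[i k]] _ ->].
    exists [set (nu (site_of (site j)) : nat)] => //.
    by rewrite setTI.
  rewrite pattern_source_inr; exists [set step (om i k)] => //.
  by rewrite setTI.
rewrite big_imfset /=; last by move=> s s' _ _; apply: source_inj.
rewrite (_ : \prod_(i <- _) _ = \prod_(s : 'I_S + label * 'I_H) P (pattern_source nu om (source s)))%E; last first.
  by rewrite big_enum.
rewrite big_sumType /=.
have -> : (\prod_(j < S) P [set w | N (site j) w = nu (site_of (site j))] = (weight lambda nu)%:E)%E.
  rewrite /weight -prodEFin; apply: eq_bigr => j _.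
  by rewrite (initial_law walks) siteK.
have -> : (\prod_(p : label * 'I_H) P (pattern_source nu om (source (inr p))) =
    ((#|{: walk}|%:R)^-1)%:E)%E.
  rewrite (eq_bigr (fun=> (2^-1)%:E)); last first.
    by move=> [i k] _; rewrite pattern_source_inr step_law_ffun.
  rewrite prodEFin prodr_const; congr (_%:E).
  rewrite !card_ffun !card_prod !card_ord card_bool.
  by rewrite natrX natrX -exprM exprVn; congr (_ ^- _); rewrite mulnC.
by rewrite -EFinM.
Qed.

Lemma pattern_disjoint : trivIset setT (fun p : {ffun 'I_S -> 'I_M} * walk => pattern p.1 p.2).
Proof.
move=> [nu om] [nu' om'] _ _ [w [[h1 h2] [h3 h4]]]; congr pair.
  by apply/ffunP => j; apply: val_inj => /=; rewrite -h1 h3.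
apply/ffunP => i; apply/ffunP => k; have := h2 i k; rewrite h4.
by rewrite /step; case: (om i k); case: (om' i k).
Qed.

Lemma prob_patterns (G : pred ({ffun 'I_S -> 'I_M} * walk)) :
  P (\bigcup_(p in [set p | G p]) pattern p.1 p.2) =
  (\sum_(p | G p) weight lambda p.1 / #|{: walk}|%:R)%:E.
Proof.
pose F (p : {ffun 'I_S -> 'I_M} * walk) := if G p then pattern p.1 p.2 else set0.
have -> : \bigcup_(p in [set p | G p]) pattern p.1 p.2 = \bigcup_(p in setT) F p.
  apply/seteqP; split=> w [p hp hw]; exists p => //; move: hp hw; rewrite /F /=.
    by move=> ->.
    by case: (G p).
  by case: (G p).
transitivity (\sum_(p \in [set: {ffun 'I_S -> 'I_M} * walk]) P (F p))%E.
  apply: (measure_fin_bigcup P).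
- by apply: (sub_finite_set (B := [set` enum {: {ffun 'I_S -> 'I_M} * walk}])) => // p _; rewrite /= mem_enum.
- move=> p p' _ _ [w []]; rewrite /F; case: (G p) => // h1; case: (G p') => // h2.
  by apply: pattern_disjoint => //; exists w.
- by move=> p _; rewrite /F; case: (G p) => //; apply: measurable_pattern.
rewrite (fsbig_fwiden (enum {: {ffun 'I_S -> 'I_M} * walk})); last 3 first.
- by move=> p _ /=; rewrite mem_enum.
- exact: enum_uniq.
- by move=> p [_] /=.
rewrite big_enum /= [in RHS]big_mkcond -sumEFin; apply: eq_bigr => p _.
by rewrite /F; case: (G p); rewrite ?prob_pattern ?measure0.
Qed.

(** Steps are [1] or [-1] only almost surely. Off this null set every potential particle, also one
    from outside the window, has speed at most one. *)
Definition unruly : set T := [set w | exists p : int * nat * nat,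
  ~ (X p.1.1 p.1.2 p.2 w = 1 \/ X p.1.1 p.1.2 p.2 w = -1)].

Lemma measurable_unruly : measurable unruly.
Proof.
apply: measurable_countable_union => -[[y i] k] /=.
apply: measurableC; apply: measurableU; exact: measurable_step.
Qed.

Lemma unruly_null : P unruly = 0%E.
Proof.
apply/negligibleP; first exact: measurable_unruly.
pose F (n : nat) : set T := if (choice.unpickle n : option (int * nat * nat)) is Some p then
  [set w | ~ (X p.1.1 p.1.2 p.2 w = 1 \/ X p.1.1 p.1.2 p.2 w = -1)] else set0.
apply: (@negligibleS _ _ _ _ (\bigcup_(n in [set: nat]) F n)).
  by move=> w [p hp]; exists (choice.pickle p); [exact: I|rewrite /F choice.pickleK].
apply: negligible_bigcup => n; rewrite /F; case: choice.unpickle => [[[y i] k]|] /=.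
  have m1 := measurable_step X y i k 1; have m2 := measurable_step X y i k (-1).
  apply/negligibleP; first by apply: measurableC; apply: measurableU.
  have [h1 h2] := step_law walks y i k.
  have e : P (~` ([set w | X y i k w = 1] `|` [set w | X y i k w = -1])) = 0%E.
    rewrite probability_setC; last exact: measurableU.
    have -> : P ([set w | X y i k w = 1] `|` [set w | X y i k w = -1]) = ((2^-1)%:E + (2^-1)%:E)%E.
      rewrite -{1}h1 -h2; apply: measureU => //.
      by apply/seteqP; split=> // w [/= ->].
    have -> : ((2^-1)%:E + (2^-1)%:E = 1 :> \bar K)%E by rewrite -EFinD; congr (_%:E); field.
    by rewrite subee.
  exact: e.
exact: negligible_set0.
Qed.
End Patterns.

(** * The finite system inside the infinite one *)

Section Escape.
Context (d : measure_display) (T : measurableType d) (K : realType)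
  (P : probability T K).
Variables (N : int -> {RV P >-> nat}) (X : int -> nat -> nat -> {RV P >-> int}).
Variables (R : K) (a m M : nat).
Local Notation H := (3 * tm a m)%N.
Local Notation jn := (4 * 2 ^ (4 * a - 1) + 8)%N.
Local Notation Wb := (6 * tm a m.+1 + (wd a 0 + jn * H + H))%N.
Local Notation alive := (alive N X R).
Local Notation vacant := (vacant N X).
Hypothesis jnR : jn%:R <= R.

Lemma alive_path (g : nat -> int) L n w :
  (forall t, (n <= t < n + L)%N -> `|g t.+1 - g t|%:~R <= R) ->
  (forall t, (n <= t <= n + L)%N -> vacant t (g t) w) ->
  alive L n (g n) w.
Proof.
elim: L n => [|L IH] n h1 h2; first by apply: h2; rewrite addn0 leqnn.
split; first by apply: h2; rewrite leqnn leq_addr.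
exists (g n.+1); split; first by apply: h1; lia.
by apply: IH => t ht; [apply: h1|apply: h2]; lia.
Qed.

Lemma position_dist w y i t : ~ unruly X w -> `|position X y i t w - y| <= t%:Z.
Proof.
move=> hw; elim: t => [|t IH]; first by rewrite /position big_ord0 addr0 subrr.
have e : position X y i t.+1 w = position X y i t w + X y i t w.
  by rewrite /position big_ord_recr /= addrA.
have : X y i t w = 1 \/ X y i t w = -1.
  by apply: contrapT => h; apply: hw; exists (y, i, t).
by rewrite e => -[] ->; lia.
Qed.

Lemma path_dist O (g : nat -> int) n t : path_on jn%:Z O 1 n g -> (1 <= t <= n)%N ->
  `|g t - g 1%N| <= (jn * t)%:Z.
Proof.
move=> [h _]; elim: t => [//|t IH] ht.
have [t0|t0] := posnP t; first by rewrite t0 subrr normr0.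
have := IH ltac:(lia); have := h t ltac:(lia).
rewrite mulnS PoszD; move: (jn%:Z) (jn * t)%N%:Z => p q; lia.
Qed.

(** [Wb] exceeds the reach [X_0 + jn H] of the path by at least the range [H] of a particle. Hence
    particles from outside the window never meet the path, and those inside follow the pattern. *)
Lemma pattern_alive (nu : {ffun 'I_(2 * Wb).+1 -> 'I_M}) (om : {ffun 'I_(2 * Wb).+1 * 'I_M -> coins H}) w :
  (nu (center Wb) : nat) = 0%N -> long_path K a m (start nu) om ->
  pattern N X nu om w -> ~ unruly X w -> alive m 0 0 w.
Proof.
move=> nu0 [g [pg g1]] [hN hX] hw.
have T0 : (0 < H)%N by rewrite muln_gt0 tm_gt0.
have mH : (m <= H)%N.
  apply: leq_trans (ltnW (ltn_expl m (ltnSn 1))) _; apply: leq_trans (_ : tm a m <= _)%N.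
    by rewrite /tm leq_pexp2l //; have := tau_ge a m; lia.
  by rewrite leq_pmull.
have g1' : `|g 1%N| <= (wd a 0)%:Z.
  by rewrite -(ler_int K) intr_norm -[leRHS]pmulrn.
have poseq j (i : 'I_M) t : (i < nu j)%N -> (t <= H)%N ->
    position X (site j) i t w = pos (start nu) om t (j, i).
  move=> ij tH; rewrite /position /pos /start ij /=; congr (_ + _).
  apply: eq_bigr => k _; have kH : (k < H)%N by apply: leq_trans tH.
  by have := hX (j, i) (Ordinal kH); rewrite /= => ->; rewrite -coinE.
(* The path given by [long_path] starts at time 1. At time 0 the origin is used, which is empty, and
   the first jump is at most [X_0], within [R]. *)
pose g' t := if t is 0%N then 0 else g t.
suff : alive m 0 (g' 0%N) w by [].
apply: alive_path => t ht.
  apply: le_trans jnR; rewrite pmulrn ler_int.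
  case: t ht => [|t] ht; last by apply: pg.1; lia.
  rewrite /g' subr0; apply: le_trans g1' _; rewrite lez_nat /wd /=.
  apply: leq_trans (leq_addr _ _); rewrite subn0.
  rewrite (_ : 4 = 2 ^ 2)%N // -expnD leq_pexp2l //; lia.
apply/vacantP => y i iN hy.
case: t ht hy => [|t] ht hy.
  move: hy; rewrite /g' /position big_ord0 addr0 => hy.
  by move: iN; rewrite hy -(site_center Wb) hN nu0.
have htH : (1 <= t.+1 <= H)%N by lia.
have tH : (t.+1 <= H)%N by lia.
have d1 := path_dist pg htH.
have d2 := position_dist y i t.+1 hw.
have d3 : (jn * t.+1 <= jn * H)%N by rewrite leq_mul2l tH orbT.
have yW : `|y| <= Wb%:Z.
  move: d1 d2 d3 g1' hy tH; rewrite /g' !PoszD.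
  move: (position _ _ _ _ _) (jn * t.+1)%N (jn * H)%N (g t.+1) (g 1%N) => p q r u v.
  by move: (wd a 0) (tm a m.+1) (3 * tm a m)%N => A B C; lia.
have eN : N y w = nu (site_of Wb y) by rewrite -hN site_ofK.
have iM : (i < M)%N by apply: ltn_trans (ltn_ord (nu (site_of Wb y))); rewrite -eN.
have := pg.2 t.+1 htH; move/negP; apply.
apply/existsP; exists (site_of Wb y, Ordinal iM); apply/eqP.
by rewrite -poseq ?site_ofK //= -eN.
Qed.
End Escape.

Section Main.
Context (d : measure_display) (T : measurableType d) (K : realType)
  (P : probability T K).
Variables (N : int -> {RV P >-> nat}) (X : int -> nat -> nat -> {RV P >-> int}).
Variables (lambda R : K) (a rho q m : nat).
Hypothesis walks : poisson_walks N X lambda.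
Hypotheses (lambda0 : 0 < lambda) (a17 : (17 <= a)%N) (qa : (q <= a)%N).
Hypotheses (rho0 : (0 < rho)%N) (arho : (2 ^ (47 + 128 * rho) <= a)%N).
Hypotheses (hrho : 2 * expR lambda <= 2 ^+ rho) (hq : 2^-1 ^+ q <= expR (- lambda) / 4).
Hypothesis jnR : (4 * 2 ^ (4 * a - 1) + 8)%N%:R <= R.

(** The window and the truncation depend on [m], the bound does not: good starts with empty origin
    have weight at least [e^-lambda / 4], and each of them yields a long path with probability at
    least 1/2. *)
Lemma prob_alive_ge : ((expR (- lambda) / 8)%:E <= P (alive N X R m 0 0))%E.
Proof.
set H := (3 * tm a m)%N.
pose Wb := (6 * tm a m.+1 + (wd a 0 + (4 * 2 ^ (4 * a - 1) + 8) * H + H))%N.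
have [M hM] := good_weight lambda0 a17 qa hrho hq (leq_addr _ _ : (6 * tm a m.+1 <= Wb)%N).
pose walk := {ffun 'I_(2 * Wb).+1 * 'I_M -> coins H}.
pose ok (nu : {ffun 'I_(2 * Wb).+1 -> 'I_M}) :=
  `[< good_start K a rho m nu >] && ((nu (center Wb) : nat) == 0%N).
pose G (p : {ffun 'I_(2 * Wb).+1 -> 'I_M} * walk) :=
  ok p.1 && `[< long_path K a m (start p.1) p.2 >].
have mG : measurable (\bigcup_(p in [set p | G p]) pattern N X p.1 p.2).
  apply: fin_bigcup_measurable; last by move=> p _; apply: measurable_pattern.
  by apply: (sub_finite_set (B := [set` enum {: {ffun 'I_(2 * Wb).+1 -> 'I_M} * walk}])) => // p _; rewrite /= mem_enum.
have mA := measurable_alive N X R m 0 0.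
have mU := measurable_unruly X.
have sub : \bigcup_(p in [set p | G p]) pattern N X p.1 p.2 `<=` alive N X R m 0 0 `|` unruly X.
  move=> w [p /andP[/andP[_ /eqP nu0] /asboolP lp] hp].
  have [hu|hu] := pselect (unruly X w); [by right|left].
  exact: (pattern_alive jnR nu0 lp hp hu).
have step1 : (P (\bigcup_(p in [set p | G p]) pattern N X p.1 p.2) <= P (alive N X R m 0 0))%E.
  rewrite -(measureU0 mA mU (unruly_null walks)).
  by apply: le_measure; rewrite ?inE //; apply: measurableU.
apply: le_trans step1; rewrite (prob_patterns walks) lee_fin.
have -> : \sum_(p | G p) weight lambda p.1 / #|{: walk}|%:R =
    \sum_nu weight lambda nu * ((ok nu)%:R * prob K (fun om : walk => `[< long_path K a m (start nu) om >])).
  rewrite big_mkcond /= -(pair_bigA _ (fun nu om => if G (nu, om) then weight lambda nu / #|{: walk}|%:R else 0)) /=.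
  apply: eq_bigr => nu _; rewrite /prob /mean mulr_suml !mulr_sumr; apply: eq_bigr => om _.
  by rewrite /G /=; case: (ok nu); case: `[< _ >]; rewrite /= ?mul1r ?mul0r ?mulr0.
have -> : expR (- lambda) / 8 = expR (- lambda) / 4 * 2^-1 by field.
apply: le_trans (ler_wpM2r _ hM) _; first by rewrite invr_ge0.
rewrite mulr_suml; apply: ler_sum => nu _; rewrite -mulrA.
apply: ler_wpM2l; first exact: weight_ge0.
rewrite -/(ok nu); case okn : (ok nu); last by rewrite !mul0r.
rewrite !mul1r; move: okn => /andP[/asboolP gs _].
apply: (prob_long_path (rho := rho) (e := 43)) => //.
- exact: leq_trans a17.
- by move=> k; apply: err_small.
- exact: base_small.
Qed.
End Main.

Unset Implicit Arguments.
Set Strict Implicit.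

Theorem mainTheorem8 (K : realType) (lambda : K) (lambda_gt0 : 0 < lambda) :
  exists R0 : K, forall R : K, R0 <= R ->
  forall (d : measure_display) (T : measurableType d) (P : probability T K)
    (N : int -> {RV P >-> nat}) (X : int -> nat -> nat -> {RV P >-> int}),
  poisson_walks N X lambda ->
  (0 < P [set w | (exists g : nat -> int,
            [/\ g 0%N = 0,
                forall n, `|g n.+1 - g n|%:~R <= R &
                forall n, occupation N X n (g n) w = 0%E])%R])%E.
Proof.
have pow2_ge j : j%:R <= 2 ^+ j :> K.
  by rewrite -natrX ler_nat ltnW // ltn_expl.
have [rho0 hrho0] : exists j : nat, 2 * expR lambda <= j%:R.
  exists (Num.trunc (2 * expR lambda)).+1; apply/ltW.
  by apply: truncnS_gt.
have [q hq] : exists j : nat, 4 / expR (- lambda) <= j%:R.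
  exists (Num.trunc (4 / expR (- lambda))).+1; apply/ltW.
  by apply: truncnS_gt.
pose rho := rho0.+1.
have hrho : 2 * expR lambda <= 2 ^+ rho.
  apply: le_trans hrho0 _; apply: le_trans (pow2_ge _).
  by rewrite ler_nat leqnSn.
have hq' : 2^-1 ^+ q <= expR (- lambda) / 4.
  have e0 := expR_gt0 (- lambda).
  rewrite exprVn -[leRHS]invrK lef_pV2 ?posrE ?exprn_gt0 ?invr_gt0 ?divr_gt0 //.
  by rewrite invf_div; apply: le_trans hq _.
(* [a] fixes the jump range. It has to exceed what the base scale ([rho]) and the initial data ([q])
   require, and these depend on [lambda] alone. *)
have [a [a17 qa arho]] : exists a, [/\ (17 <= a)%N, (q <= a)%N & (2 ^ (47 + 128 * rho) <= a)%N].
  exists (17 + q + 2 ^ (47 + 128 * rho))%N; split; last exact: leq_addl.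
    by rewrite -addnA leq_addr.
  by rewrite -addnA addnCA leq_addr.
exists (4 * 2 ^ (4 * a - 1) + 8)%N%:R => R hR d T P N X walks.
have RRn : R <= (Num.trunc R).+1%:R by apply/ltW; apply: truncnS_gt.
apply: (@lt_le_trans _ _ (expR (- lambda) / 8)%:E).
  by rewrite lte_fin divr_gt0 // expR_gt0.
apply: (prob_escapes_ge RRn) => L.
(* Scale [L] is enough for a path of length [L], as [L <= 3 T_L]. *)
exact: (prob_alive_ge L walks lambda_gt0 a17 qa (ltn0Sn rho0) arho hrho hq' hR).
Qed.
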